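(* For every integer $n \geq 2$, there exists an LCL problem $\Pi$ on $\mathbb{Z}^n$ such that: (i) $\Pi \notin \mathtt{FIID}(\mathbb{Z}^n)$, (ii) $\Pi \in \mathtt{BaireSHIFT}(\mathbb{Z}^n)$, (iii) $\Pi \in \mathtt{COMPUTABLE}(\mathbb{Z}^n)$.
   Context: Let $\Gamma$ be a finitely generated group. A locally checkable labeling (LCL) problem on $\Gamma$ is a triple $\Pi = (W, \Lambda, \mathcal{A})$ where $W \subseteq \Gamma$ is a finite set, $\Lambda$ is a finite set (of labels, with the discrete topology), and $\mathcal{A} \subseteq \Lambda^W$ is a family of maps $W \to \Lambda$. Given an action of $\Gamma$ on a set $X$, a solution to $\Pi$ on $X$ (or a $\Pi$-labeling of $X$) is a function $f \colon X \to \Lambda$ such that for all $x \in X$, the map $W \to \Lambda$, $w \mapsto f(w \cdot x)$, is in $\mathcal{A}$. An action of $\Gamma$ on $X$ is free if $\gamma \cdot x \neq x$ for all $x \in X$ and all non-identity $\gamma \in \Gamma$. An action of $\Gamma$ on a computable set $X \subseteq \mathbb{N}$ is computable if for each $\gamma \in \Gamma$ the function $X \to X$, $x \mapsto \gamma \cdot x$, is computable. For a set $X$, the shift action of $\Gamma$ on $X^\Gamma$ is $(\gamma \cdot x)(\delta) = x(\delta\gamma)$. Its free part is $\mathcal{F}(X,\Gamma) = \{x \in X^\Gamma : \gamma \cdot x \neq x \text{ for all non-identity } \gamma \in \Gamma\}$. Write $2 = \{0,1\}$ with the discrete topology; $\mathcal{F}(2,\Gamma)$ carries the topology inherited from the product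 topology on $2^\Gamma$. The set $\mathcal{F}([0,1],\Gamma)$ is equipped with (the restriction of) the product measure $\mathcal{L}^\Gamma$, where $\mathcal{L}$ is Lebesgue measure on $[0,1]$; measurability on $\mathcal{F}([0,1],\Gamma)$ refers to this measure. Classes of LCL problems $\Pi = (W,\Lambda,\mathcal{A})$ on $\Gamma$: - $\Pi \in \mathtt{FIID}(\Gamma)$ iff $\Pi$ has a measurable solution on $\mathcal{F}([0,1],\Gamma)$. - $\Pi \in \mathtt{BaireSHIFT}(\Gamma)$ iff $\Pi$ has a Baire-measurable solution on $\mathcal{F}(2,\Gamma)$. - $\Pi \in \mathtt{COMPUTABLE}(\Gamma)$ iff every free computable action of $\Gamma$ on a computable set $X \subseteq \mathbb{N}$ has a computable $\Pi$-labeling $f \colon X \to \Lambda$. *)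

(* Defs.v *)
From HB Require Import structures.
From mathcomp Require Import all_boot all_order all_algebra finmap.
From mathcomp Require Import all_classical all_reals all_analysis.
From mathcomp Require Import measurable_realfun.

Set Implicit Arguments.
Unset Strict Implicit.
Unset Printing Implicit Defensive.
Import Order.TTheory GRing.Theory Num.Theory.
Import numFieldNormedType.Exports.

Local Open Scope classical_set_scope.
Local Open Scope ring_scope.

(* Groups are written additively: [zmodType] covers Z^n = 'rV[int]_n. *)

Section Actions.
Variables (G : zmodType) (T : Type).

Definition is_action (act : G -> T -> T) : Prop :=
  (forall x, act 0 x = x) /\ (forall g h x, act (g + h) x = act g (act h x)).

Definition is_free (act : G -> T -> T) : Prop :=
  forall g x, g <> 0 -> act g x <> x.

End Actions.

Record LCL (G : zmodType) : Type := MkLCL {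
  window : {fset G};
  label : finType;
  allowed : {set {ffun window -> label}}
}.

Definition is_solution (G : zmodType) (Pi : LCL G) (T : Type)
    (act : G -> T -> T) (f : T -> label Pi) : Prop :=
  forall x : T, [ffun w : window Pi => f (act (val w) x)] \in allowed Pi.

Section Shift.
Variables (G : zmodType) (T : Type).

Definition shift (g : G) (x : G -> T) : G -> T := fun d => x (d + g).

Lemma shiftD (g h : G) (x : G -> T) : shift (g + h) x = shift g (shift h x).
Proof. by apply/funext => d; rewrite /shift addrA. Qed.

Lemma shift0 (x : G -> T) : shift 0 x = x.
Proof. by apply/funext => d; rewrite /shift addr0. Qed.

Definition free_part : set (G -> T) :=
  [set x | forall g, g <> 0 -> shift g x <> x].

Lemma free_part_shift (g : G) (x : G -> T) :
  free_part x -> free_part (shift g x).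
Proof.
move=> Fx h h0 e; apply: (Fx h h0).
have := congr1 (shift (- g)) e.
by rewrite -!shiftD -addrA (addrCA (- g)) addNr addr0 shift0.
Qed.

Definition free_shift (g : G) (x : set_type free_part) : set_type free_part :=
  exist _ (shift g (val x)) (mem_set (@free_part_shift g _ (set_mem (valP x)))).

End Shift.

Arguments free_part : clear implicits.

Definition unit_interval (R : realType) : Type :=
  set_type (`[0, 1]%classic : set R).

Lemma unit_interval0 (R : realType) : (0 : R) \in `[0, 1]%classic.
Proof. by rewrite inE /= in_itv /= lexx ler01. Qed.

HB.instance Definition _ (R : realType) := Choice.on (unit_interval R).
HB.instance Definition _ (R : realType) :=
  isPointed.Build (unit_interval R) (exist _ 0 (unit_interval0 R)).

Section FIID.
Variables (R : realType) (G : zmodType).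

Local Notation unit_interval := (unit_interval R).

Definition one_coordinate_sets : set (set (G -> unit_interval)) :=
  [set A | exists g (B : set R),
     measurable B /\ A = [set x | B (val (x g))]].

Definition cube := g_sigma_algebraType one_coordinate_sets.

(* This determines mu uniquely; such a mu exists by Kolmogorov's theorem. *)
Definition is_product_measure (mu : probability cube R) : Prop :=
  forall (s : {fset G}) (B : G -> set R), (forall g, measurable (B g)) ->
    mu [set x : cube | forall g, g \in s -> B g (val (x g))] =
    (\prod_(g <- s) lebesgue_measure (B g `&` `[0%R, 1%R]%classic))%E.

(* The free part is a measurable subset of the cube (for countable G), so a
   subset of it is measurable exactly when its image in the cube belongs to the
   completed sigma-algebra. *)
Definition measurable_labeling (mu : probability cube R) (L : Type)
    (f : set_type (free_part G unit_interval) -> L) : Prop :=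
  forall S : set L,
    completed_algebra_gen mu (set_val @` (f @^-1` S) : set cube).

Definition FIID (Pi : LCL G) : Prop :=
  exists mu : probability cube R, is_product_measure mu /\
  exists f : set_type (free_part G unit_interval) -> label Pi,
    is_solution (@free_shift G unit_interval) f /\ measurable_labeling mu f.

End FIID.

Arguments FIID R {G} Pi.

Section Baire.
Variable T : topologicalType.

Definition nowhere_dense (A : set T) : Prop := (closure A)^° = set0.

Definition meager (A : set T) : Prop :=
  exists F : nat -> set T,
    (forall k, nowhere_dense (F k)) /\ A `<=` \bigcup_k F k.

Definition Baire_property (A : set T) : Prop :=
  exists U : set T, open U /\ meager (A `+` U).

(* Every set of labels is open for the discrete topology. *)
Definition Baire_measurable (L : Type) (f : T -> L) : Prop :=
  forall S : set L, Baire_property (f @^-1` S).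

End Baire.

Definition BaireSHIFT (G : zmodType) (Pi : LCL G) : Prop :=
  exists f : set_type (free_part G bool : set {ptws G -> bool}) -> label Pi,
    is_solution (@free_shift G bool) f /\ Baire_measurable f.

(* Kleene's partial mu-recursive functions of k arguments. *)
Inductive recfun : nat -> Type :=
| RZero k : recfun k
| RSucc : recfun 1
| RProj k : 'I_k -> recfun k
| RComp k m : recfun m -> ('I_m -> recfun k) -> recfun k
| RPrec k : recfun k -> recfun k.+2 -> recfun k.+1
| RMin k : recfun k.+1 -> recfun k.

(* [computes e v y]: e is defined at v, with value y.  The recursion in RPrec
   is on the first argument; its step function takes the predecessor, the
   previous value and the parameters.  In RMin, all values below y must be
   defined and nonzero. *)
Fixpoint computes k (e : recfun k) : k.-tuple nat -> nat -> Prop :=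
  match e in recfun k return k.-tuple nat -> nat -> Prop with
  | RZero _ => fun _ y => y = 0%N
  | RSucc => fun v y => y = (thead v).+1
  | RProj _ i => fun v y => y = tnth v i
  | RComp _ m f g => fun v y =>
      exists w : m.-tuple nat,
        (forall i, computes (g i) v (tnth w i)) /\ computes f w y
  | RPrec _ f g => fun v =>
      let params := [tuple of behead v] in
      (fix rec (n : nat) : nat -> Prop :=
        match n with
        | 0%N => fun y => computes f params y
        | p.+1 => fun y => exists z, rec p z /\
                    computes g [tuple of p :: z :: params] y
        end) (thead v)
  | RMin _ f => fun v y =>
      computes f [tuple of y :: v] 0%N /\
      forall j, (j < y)%N -> exists z, computes f [tuple of j :: v] z.+1
  end.

Definition computable_set (X : pred nat) : Prop :=
  exists e : recfun 1, forall n, computes e [tuple n] (X n : nat).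

(* Values of the program outside X are irrelevant: for the computable X
   considered below, the program can be made to diverge (or to return 0)
   there. *)
Definition computable_on (X : pred nat) (f : {x : nat | X x} -> nat) : Prop :=
  exists e : recfun 1, forall x, computes e [tuple val x] (f x).

Definition COMPUTABLE (G : zmodType) (Pi : LCL G) : Prop :=
  forall (X : pred nat) (act : G -> {x : nat | X x} -> {x : nat | X x}),
    computable_set X -> is_action act -> is_free act ->
    (forall g, computable_on (fun x => val (act g x))) ->
    exists f : {x : nat | X x} -> label Pi,
      is_solution act f /\ computable_on (fun x => enum_rank (f x) : nat).

(* Main.v *)
From mathcomp Require Import all_boot all_order all_algebra finmap zify ring lra.
From mathcomp Require Import all_classical all_reals all_analysis.
Require Import Defs.

Set Implicit Arguments.
Unset Strict Implicit.
Unset Printing Implicit Defensive.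
Import Order.TTheory GRing.Theory Num.Theory.
Import numFieldNormedType.Exports.
Local Open Scope ring_scope.

(** The problem asks for a picture made of right isosceles triangles in the
    planes spanned by the first two coordinates of Z^n.  Six of the ten labels
    draw the boundary of a triangle x >= a, y >= b, x + y <= c: its corners and
    the interiors of its sides.  Two ground colours are used elsewhere, and two
    filler colours complete each triangle to the square with sides x = a and
    y = b.  The local rules force a wall to continue up to the corner that ends
    it, force the filler to be exactly the missing half of the square, make
    both colours alternate in the horizontal direction, and make the ground
    colour constant in the vertical direction.  Triangles may be nested.

    Solutions that use infinitely many scales are easy to produce.  Suppose that
    centres of level k are given, each to carry a square of side 4 r_k, in
    such a way that squares of one level are far apart and that a square of
    lower level is either deep inside the triangle of a higher one or far away
    from it.  Then each cell can take the tile prescribed by the square of least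
    level that covers it ([tiled_rule]).  On a computable free action the point
    k itself is the only centre of level k, and r_k is found by a search
    ([triangle_COMPUTABLE]).  On the free part of 2^(Z^n) the centres of level k
    are the occurrences of the k-th finite pattern, isolated by a wide ring of
    zeros; comeagrely many points are covered together with all their
    translates, and on the meagre remainder the axiom of choice provides a
    solution with two ground colours ([triangle_BaireSHIFT]).

    No solution can be measurable for the product measure, because the shift is
    mixing ([shift_mixing]).  An event recurring along a shift has probability 0
    or 1 ([zero_one]), so almost surely no wall is infinite; then every wall
    cell belongs to a complete triangle, and two triangles that meet are equal
    or nested ([laminar]).  Next, an event cannot be prevented from recurring
    after an odd number of steps unless it is null ([odd_recurrence]).  The
    colours of the ground cells that lie in no triangle are coherent along a
    row: a triangle met on the way is bypassed along its square, which is
    surrounded by ground ([outside_parity]).  Hence almost surely there is no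
    such cell, and every cell lies in a triangle ([all_inside]).  On the other
    hand, the triangles that are maximal among those of size at most D have
    disjoint squares, of which they fill at most 3/4, so a given cell lies in
    one of them with probability at most 3/4, whatever D is ([mass]).  Letting D
    go to infinity gives a contradiction. *)

(** * The local rules and the geometry of triangles *)

(** Labels are coded by numbers below 10: 0 and 1 are the ground colours, 2 to 7
    the wall tiles named below, 8 and 9 the filler colours.  SW, NW and SE are
    the corners of a triangle, West, South and Diag the interiors of its sides. *)
Definition ground (c : nat) : bool := (c <= 1)%N.
Definition filler (c : nat) : bool := (c == 8) || (c == 9).
(** The tiles found on the hypotenuse of a triangle or beyond it.  A cell is a
    filler exactly when its left and lower neighbours are of this kind, which
    makes the filler spread from the hypotenuse over the rest of the square. *)
Definition past_diag (c : nat) : bool := c \in [:: 4; 5; 6; 8; 9].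

Notation SW := 2%N (only parsing).
Notation West := 3%N (only parsing).
Notation NW := 4%N (only parsing).
Notation Diag := 5%N (only parsing).
Notation SE := 6%N (only parsing).
Notation South := 7%N (only parsing).

Definition rule (t : int -> int -> nat) : bool :=
  let c := t 0 0 in
  [&& (c == SW) ==> [&& ground (t (-1) 0), ground (t 0 (-1)), ground (t (-1) (-1)),
        t 1 0 \in [:: SE; South] & t 0 1 \in [:: West; NW]],
      (c == West) ==> [&& ground (t (-1) 0), t 0 1 \in [:: West; NW] & t 0 (-1) \in [:: SW; West]],
      (c == NW) ==> [&& ground (t (-1) 0), t 0 (-1) \in [:: SW; West] & t 1 (-1) \in [:: Diag; SE]],
      (c == Diag) ==> (t 1 (-1) \in [:: Diag; SE]) && (t (-1) 1 \in [:: NW; Diag]),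
      (c == SE) ==> [&& ground (t 1 0), ground (t 0 (-1)), ground (t 1 (-1)),
        t (-1) 0 \in [:: SW; South] & t (-1) 1 \in [:: NW; Diag]],
      (c == South) ==> [&& ground (t 0 (-1)), t 1 0 \in [:: SE; South] & t (-1) 0 \in [:: SW; South]],
      filler c ==> ground (t 1 0) || filler (t 1 0),
      filler c == past_diag (t (-1) 0) && past_diag (t 0 (-1)),
      ground c && ground (t 1 0) ==> (t 1 0 + c == 1)%N,
      filler c && filler (t 1 0) ==> (t 1 0 + c == 17)%N &
      ground c && ground (t 0 1) ==> (t 0 1 == c)].

Lemma eq_rule (t t' : int -> int -> nat) :
  (forall a b : int, -1 <= a <= 1 -> -1 <= b <= 1 -> t a b = t' a b) ->
  rule t = rule t'.
Proof. by move=> tt'; rewrite /rule !tt'. Qed.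

Section Geometry.
Variable t : int -> int -> nat.
Hypothesis t_small : forall a b : int, (t a b < 10)%N.
Hypothesis t_rule : forall a b : int, rule (fun i j => t (a + i) (b + j)).

Local Notation in2 c x y := (c = x \/ c = y) (only parsing).

Lemma mem2 (c x y : nat) : (c \in [:: x; y]) -> c = x \/ c = y.
Proof. by rewrite !inE => /orP[] /eqP; [left|right]. Qed.

Lemma rule_SW a b : t a b = SW ->
  [/\ ground (t (a - 1) b), ground (t a (b - 1)), ground (t (a - 1) (b - 1)),
      in2 (t (a + 1) b) SE South & in2 (t a (b + 1)) West NW].
Proof.
move=> tab; have /andP[+ _] := t_rule a b.
rewrite !addr0 tab /= => /and5P[g1 g2 g3 m1 m2]; split => //; exact: mem2.
Qed.

Lemma rule_West a b : t a b = West ->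
  [/\ ground (t (a - 1) b), in2 (t a (b + 1)) West NW & in2 (t a (b - 1)) SW West].
Proof.
move=> tab; have /and5P[_ + _ _ _] := t_rule a b.
rewrite !addr0 tab /= => /and3P[g1 m1 m2]; split => //; exact: mem2.
Qed.

Lemma rule_NW a b : t a b = NW ->
  [/\ ground (t (a - 1) b), in2 (t a (b - 1)) SW West & in2 (t (a + 1) (b - 1)) Diag SE].
Proof.
move=> tab; have /and5P[_ _ + _ _] := t_rule a b.
rewrite !addr0 tab /= => /and3P[g1 m1 m2]; split => //; exact: mem2.
Qed.

Lemma rule_Diag a b : t a b = Diag ->
  in2 (t (a + 1) (b - 1)) Diag SE /\ in2 (t (a - 1) (b + 1)) NW Diag.
Proof.
move=> tab; have /and5P[_ _ _ + _] := t_rule a b.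
rewrite !addr0 tab /= => /andP[m1 m2]; split => //; exact: mem2.
Qed.

Lemma rule_SE a b : t a b = SE ->
  [/\ ground (t (a + 1) b), ground (t a (b - 1)), ground (t (a + 1) (b - 1)),
      in2 (t (a - 1) b) SW South & in2 (t (a - 1) (b + 1)) NW Diag].
Proof.
move=> tab; have /and5P[_ _ _ _ /andP[+ _]] := t_rule a b.
rewrite !addr0 tab /= => /and5P[g1 g2 g3 m1 m2]; split => //; exact: mem2.
Qed.

Lemma rule_South a b : t a b = South ->
  [/\ ground (t a (b - 1)), in2 (t (a + 1) b) SE South & in2 (t (a - 1) b) SW South].
Proof.
move=> tab; have /and5P[_ _ _ _ /and3P[_ + _]] := t_rule a b.
rewrite !addr0 tab /= => /and3P[g1 m1 m2]; split => //; exact: mem2.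
Qed.

Lemma filler_right a b : filler (t a b) -> ground (t (a + 1) b) \/ filler (t (a + 1) b).
Proof.
move=> tab; have /and5P[_ _ _ _ /and5P[_ _ + _ _]] := t_rule a b.
by rewrite !addr0 tab /= => /orP.
Qed.

Lemma fillerE a b : filler (t a b) = past_diag (t (a - 1) b) && past_diag (t a (b - 1)).
Proof.
have /and5P[_ _ _ _ /and5P[_ _ _ /eqP + _]] := t_rule a b.
by rewrite !addr0.
Qed.

Lemma ground_alternates a b : ground (t a b) -> ground (t (a + 1) b) ->
  (t (a + 1) b + t a b = 1)%N.
Proof.
have /and5P[_ _ _ _ /and5P[_ _ _ _ /and3P[+ _ _]]] := t_rule a b.
by rewrite !addr0 => /implyP h g1 g2; apply/eqP/h/andP.
Qed.

Lemma filler_alternates a b : filler (t a b) -> filler (t (a + 1) b) ->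
  (t (a + 1) b + t a b = 17)%N.
Proof.
have /and5P[_ _ _ _ /and5P[_ _ _ _ /and3P[_ + _]]] := t_rule a b.
by rewrite !addr0 => /implyP h g1 g2; apply/eqP/h/andP.
Qed.

Lemma ground_vertical a b : ground (t a b) -> ground (t a (b + 1)) -> t a (b + 1) = t a b.
Proof.
have /and5P[_ _ _ _ /and5P[_ _ _ _ /and3P[_ _ +]]] := t_rule a b.
by rewrite !addr0 => /implyP h g1 g2; apply/eqP/h/andP.
Qed.

(** Absence of infinite walls or runs of fillers in the direction [(dx, dy)]. *)
Definition noline (P : pred nat) (dx dy : int) :=
  forall a b, exists k : nat, ~~ P (t (a + dx * k%:Z) (b + dy * k%:Z)).

Lemma run_end (c e : nat) (dx dy a b : int) : noline (pred1 c) dx dy ->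
  (forall a b, t a b = c ->
     t (a + dx) (b + dy) = c \/ t (a + dx) (b + dy) = e) ->
  t (a + dx) (b + dy) = c \/ t (a + dx) (b + dy) = e ->
  c != e ->
  exists l : int, [/\ 0 < l, t (a + dx * l) (b + dy * l) = e &
    forall j, 0 < j < l -> t (a + dx * j) (b + dy * j) = c].
Proof.
move=> fin step start ce.
have fin' : exists k : nat, t (a + dx * k.+1%:Z) (b + dy * k.+1%:Z) != c.
  have [k /= ck] := fin (a + dx) (b + dy); exists k.
  by rewrite intS !mulrDr !mulr1 !addrA.
have := ex_minnP fin'; case=> k ck kmin.
have run (j : nat) : (j < k)%N -> t (a + dx * j.+1%:Z) (b + dy * j.+1%:Z) = c.
  move=> jk; apply/eqP/negPn/negP => /kmin; lia.
exists k.+1%:Z; split => //.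
  case: k {kmin} ck run => [|k] ck run.
    by rewrite !mulr1 in ck *; case: start => // /eqP; rewrite (negPf ck).
  have := step _ _ (run k (leqnn _)).
  have next x d : x + d * k.+1%:Z + d = x + d * k.+2%:Z by rewrite (intS k.+1); ring.
  by rewrite !next => -[/eqP|//]; rewrite (negPf ck).
case=> [[|j]|j] //= jk; apply: run; lia.
Qed.

Hypothesis west_up : noline (pred1 West) 0 1.
Hypothesis west_down : noline (pred1 West) 0 (-1).
Hypothesis diag_down : noline (pred1 Diag) 1 (-1).
Hypothesis diag_up : noline (pred1 Diag) (-1) 1.
Hypothesis south_right : noline (pred1 South) 1 0.
Hypothesis south_left : noline (pred1 South) (-1) 0.

Lemma t_eq a b a' b' c : t a b = c -> a = a' -> b = b' -> t a' b' = c.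
Proof. by move=> tab <- <-. Qed.

Lemma go_up (a b : int) : t a b = SW \/ t a b = West -> exists l : int, [/\ b < l, t a l = NW &
  forall y : int, b < y < l -> t a y = West].
Proof.
move=> tab; case: (run_end (a := a) (b := b) (e := NW) west_up) => //.
- by move=> x y /rule_West[_ h _]; rewrite addr0.
- by rewrite addr0; case: tab => [/rule_SW[]|/rule_West[]].
move=> l [l0 tl run]; exists (b + l); split; first by lia.
  by apply: t_eq tl _ _; lia.
by move=> y yl; apply: t_eq (run (y - b) _) _ _; lia.
Qed.

Lemma go_down (a b : int) : t a b = NW \/ t a b = West -> exists l : int, [/\ l < b, t a l = SW &
  forall y : int, l < y < b -> t a y = West].
Proof.
move=> tab; case: (run_end (a := a) (b := b) (e := SW) west_down) => //.
- by move=> x y /rule_West[_ _]; rewrite addr0 => -[|]; [right|left].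
- by rewrite addr0; case: tab => [/rule_NW[_ []]|/rule_West[_ _ []]]; auto.
move=> l [l0 tl run]; exists (b - l); split; first by lia.
  by apply: t_eq tl _ _; lia.
by move=> y yl; apply: t_eq (run (b - y) _) _ _; lia.
Qed.

Lemma go_right (a b : int) : t a b = SW \/ t a b = South -> exists l : int, [/\ a < l, t l b = SE &
  forall x : int, a < x < l -> t x b = South].
Proof.
move=> tab; case: (run_end (a := a) (b := b) (e := SE) south_right) => //.
- by move=> x y /rule_South[_ h _]; rewrite addr0; case: h; auto.
- by rewrite addr0; case: tab => [/rule_SW[_ _ _ []]|/rule_South[_ []]]; auto.
move=> l [l0 tl run]; exists (a + l); split; first by lia.
  by apply: t_eq tl _ _; lia.
by move=> x xl; apply: t_eq (run (x - a) _) _ _; lia.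
Qed.

Lemma go_left (a b : int) : t a b = SE \/ t a b = South -> exists l : int, [/\ l < a, t l b = SW &
  forall x : int, l < x < a -> t x b = South].
Proof.
move=> tab; case: (run_end (a := a) (b := b) (e := SW) south_left) => //.
- by move=> x y /rule_South[_ _]; rewrite addr0; case; auto.
- by rewrite addr0; case: tab => [/rule_SE[_ _ _ []]|/rule_South[_ _ []]]; auto.
move=> l [l0 tl run]; exists (a - l); split; first by lia.
  by apply: t_eq tl _ _; lia.
by move=> x xl; apply: t_eq (run (a - x) _) _ _; lia.
Qed.

Lemma slide_down (a b : int) : t a b = NW \/ t a b = Diag -> exists l : int,
  [/\ a < l, t l (a + b - l) = SE &
  forall x y : int, a < x < l -> x + y = a + b -> t x y = Diag].
Proof.
move=> tab; case: (run_end (a := a) (b := b) (e := SE) diag_down) => //.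
- by move=> x y /rule_Diag[].
- by case: tab => [/rule_NW[]|/rule_Diag[]].
move=> l [l0 tl run]; exists (a + l); split; first by lia.
  by apply: t_eq tl _ _; lia.
by move=> x y xl xy; apply: t_eq (run (x - a) _) _ _; lia.
Qed.

Lemma slide_up (a b : int) : t a b = SE \/ t a b = Diag -> exists l : int,
  [/\ l < a, t l (a + b - l) = NW &
  forall x y : int, l < x < a -> x + y = a + b -> t x y = Diag].
Proof.
move=> tab; case: (run_end (a := a) (b := b) (e := NW) diag_up) => //.
- by move=> x y /rule_Diag[_ []]; auto.
- by case: tab => [/rule_SE[_ _ _ _ []]|/rule_Diag[_ []]]; auto.
move=> l [l0 tl run]; exists (a - l); split; first by lia.
  by apply: t_eq tl _ _; lia.
by move=> x y xl xy; apply: t_eq (run (a - x) _) _ _; lia.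
Qed.

(** The walls of the triangle with vertices (a, b), (a, c - a) and (c - b, b). *)
Definition triangle (a b c : int) :=
  [/\ a + b < c, t a b = SW, t a (c - a) = NW, t (c - b) b = SE &
   [/\ forall y : int, b < y < c - a -> t a y = West,
       forall x : int, a < x < c - b -> t x b = South &
       forall x y : int, a < x -> b < y -> x + y = c -> t x y = Diag]].

Lemma clash a b (c d : nat) : t a b = c -> t a b = d -> c != d ->
  forall P : Prop, P.
Proof. by move=> -> ->; rewrite eqxx. Qed.

(** A complete west wall is a side of a complete triangle.  The hypotenuse that
    leaves its top slides down to a south-east corner, and the south wall from
    that corner must come back to the bottom of the west wall: if it did not,
    a smaller complete triangle would be found inside, by induction on the
    length of the wall, and one of its corners would lie in the middle of
    another wall. *)
Lemma west_wall_triangle (l : nat) (a b h : int) : h = b + l%:Z -> b < h ->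
  t a b = SW -> t a h = NW -> (forall y : int, b < y < h -> t a y = West) ->
  triangle a b (a + h).
Proof.
elim/ltn_ind: l a b h => l IH a b h hl bh tab tah west.
have [s [as_ ts diag]] := slide_down (or_introl tah).
(* a south-west corner strictly inside would carry a smaller complete
   triangle, whose south-east corner sits in the middle of a wall *)
have inner (p q u : int) : a < p -> p < s -> t p q = SW -> b <= q -> q < a + h - p ->
    u <= s -> (forall x : int, p < x < u -> t x q = South) -> a + h - q <= u -> False.
  move=> ap ps tpq bq qd us south qu.
  have [k [qk tk westp]] := go_up (or_introl tpq).
  have tpd : t p (a + h - p) = Diag by apply: diag; lia.
  have kd : k < a + h - p.
    rewrite ltNge; apply/negP => le; have [e|ne] := eqVneq k (a + h - p).
      by apply: (clash tpd (d := NW)) => //; rewrite -e.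
    by apply: (clash tpd (westp _ _)) => //; lia.
  have [k' kk'] : exists k' : nat, k = q + k'%:Z by exists (absz (k - q)%R); lia.
  have [] := IH k' _ p q k kk' qk tpq tk westp; first by lia.
  move=> _ _ _ se _; apply: (clash se (south _ _)) => //; lia.
set y0 := a + h - s in ts.
have : b = y0.
  have [//|yb] := eqVneq b y0.
  have [by0|y0b] : b < y0 \/ y0 < b by lia.
    (* the hypotenuse stops too early *)
    have [r [rs tr south]] := go_left (or_introl ts).
    have ta0 : t a y0 = West by apply: west; lia.
    have [ra|ra] : r < a \/ a <= r by lia.
      by apply: (clash ta0 (south _ _)) => //; lia.
    have [e|ne] := eqVneq r a; first by rewrite e in tr; apply: (clash ta0 tr).
    by exfalso; apply: (inner r y0 s) => //; lia.
  (* the hypotenuse crosses the base line *)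
  have [r [ar tr south]] := go_right (or_introl tab).
  set d := a + h - b.
  have td : t d b = Diag by apply: diag; lia.
  have rd : r < d.
    rewrite ltNge; apply/negP => le; have [e|ne] := eqVneq r d.
      by apply: (clash td (d := SE)) => //; rewrite -e.
    by apply: (clash td (south _ _)) => //; lia.
  have [q [qr tq diag']] := slide_up (or_introl tr).
  have aq : a < q.
    have tw : t a (r + b - a) = West by apply: west; lia.
    rewrite ltNge; apply/negP => le; have [e|ne] := eqVneq q a.
      by rewrite e in tq; apply: (clash tw tq).
    by apply: (clash tw (diag' _ _ _ _)) => //; lia.
  have [v [vq tv west']] := go_down (or_introl tq).
  have tqb : t q b = South by apply: south; lia.
  have bv : b < v.
    rewrite ltNge; apply/negP => le; have [e|ne] := eqVneq v b.
      by rewrite e in tv; apply: (clash tqb tv).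
    by apply: (clash tqb (west' _ _)) => //; lia.
  have [k kk] : exists k : nat, r + b - q = v + k%:Z.
    by exists (absz (r + b - q - v)%R); lia.
  have [] := IH k _ q v (r + b - q) kk vq tv tq west'; first by lia.
  move=> _ _ _ se _; apply: (clash se (diag' _ _ _ _)) => //; lia.
move=> by0; rewrite /y0 in by0 *.
have sE : s = a + h - b by lia.
have [r [rs tr southy]] := go_left (or_introl ts).
have south x : r < x < s -> t x b = South.
  by move=> xs; apply: t_eq (southy x xs) _ _; lia.
have ra : r = a.
  have [//|ne] := eqVneq r a; have [lt|lt] : r < a \/ a < r by lia.
    by apply: (clash tab (south _ _)) => //; lia.
  by exfalso; apply: (inner r (a + h - s) s) => //; lia.
split => //.
- by lia.
- by apply: t_eq tah _ _; lia.
- by apply: t_eq ts _ _; lia.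
- split.
  + by move=> y yb; apply: west; lia.
  + by move=> x xa; apply: south; lia.
  + by move=> x y ax yb xy; apply: diag; lia.
Qed.
Lemma SW_triangle (a b : int) : t a b = SW -> exists c, triangle a b c.
Proof.
move=> tab; have [h [bh th west]] := go_up (or_introl tab).
by exists (a + h); apply: (@west_wall_triangle (absz (h - b)%R)) => //; lia.
Qed.

Definition inside (a b c x y : int) := [&& a <= x, b <= y & x + y <= c].

Lemma west_triangle (a y : int) : t a y \in [:: SW; West; NW] ->
  exists b c : int, triangle a b c /\ inside a b c a y.
Proof.
rewrite !inE => /or3P[]/eqP tay.
- have [c T] := SW_triangle tay; exists y, c; split=> //.
  by rewrite /inside; case: T; lia.
- have [b [yb tb west]] := go_down (or_intror tay).
  have [c T] := SW_triangle tb; exists b, c; split=> //.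
  case: T => bc _ tc _ _; rewrite /inside !andbA andbC; apply/andP; split; last by lia.
  rewrite leNgt; apply/negP => lt; have [e|ne] := eqVneq (c - a) y.
    by move: tc; rewrite e => tc; apply: (clash tay tc).
  by apply: (clash tc (west _ _)) => //; lia.
- have [b [yb tb west]] := go_down (or_introl tay).
  have [c T] := SW_triangle tb; exists b, c; split=> //.
  case: T => bc _ tc _ _; rewrite /inside !andbA andbC; apply/andP; split; last by lia.
  rewrite leNgt; apply/negP => lt; have [e|ne] := eqVneq (c - a) y.
    by lia.
  by apply: (clash tc (west _ _)) => //; lia.
Qed.

(** A diagonal cell belongs to the triangle of the west wall below the top of
    its diagonal, which cannot stop before that cell. *)
Lemma diag_triangle (x y : int) : t x y = Diag ->
  exists a b c : int, [/\ triangle a b c, x + y = c, a < x & b < y].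
Proof.
move=> txy; have [a [ax ta diag]] := slide_up (or_intror txy).
have [b [ab tb west]] := go_down (or_introl ta).
exists a, b, (x + y); split => //.
  rewrite (_ : x + y = a + (x + y - a)); last by lia.
  by apply: (@west_wall_triangle (absz (x + y - a - b)%R)) => //; lia.
have [|T] := @west_wall_triangle (absz (x + y - a - b)%R) a b (x + y - a) _ ab tb ta west.
  by lia.
move=> _ _ se [_ south _]; rewrite ltNge; apply/negP => yb.
have [e|ne] := eqVneq y b.
  by apply: (clash (t_eq se _ _) txy) => //; lia.
by apply: (clash se (diag _ _ _ _)) => //; lia.
Qed.

Lemma west_unique a b c b' c' y : triangle a b c -> triangle a b' c' ->
  b <= y <= c - a -> b' <= y <= c' - a -> b = b' /\ c = c'.
Proof.
have low p q r r' : triangle a p r -> triangle a q r' -> p < q -> q <= r - a -> False.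
  move=> [pr sw1 nw1 _ [west1 _ _]] [qr sw2 _ _ _] pq qr1.
  have [e|ne] := eqVneq q (r - a).
    by apply: (clash sw2 (d := NW)) => //; rewrite e.
  by apply: (clash sw2 (west1 _ _)) => //; lia.
have high p r r' : triangle a p r -> triangle a p r' -> r < r' -> False.
  move=> [pr sw1 nw1 _ _] [qr sw2 _ _ [west2 _ _]] rr'.
  by apply: (clash nw1 (west2 _ _)) => //; lia.
move=> T T' yb yb'.
have bb' : b = b'.
  have [//|[lt|lt]] : b = b' \/ (b < b' \/ b' < b) by lia.
    by exfalso; apply: (low _ _ _ _ T T' lt); lia.
  by exfalso; apply: (low _ _ _ _ T' T lt); lia.
rewrite -bb' in T' *; split=> //.
have [//|[lt|lt]] : c = c' \/ (c < c' \/ c' < c) by lia.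
  by exfalso; apply: (high _ _ _ T T').
by exfalso; apply: (high _ _ _ T' T).
Qed.

Lemma diag_unique a b a' b' c x y : triangle a b c -> triangle a' b' c ->
  x + y = c -> a <= x -> b <= y -> a' <= x -> b' <= y -> a = a' /\ b = b'.
Proof.
have left p q r s : triangle p q c -> triangle r s c -> p < r -> r <= c - q -> False.
  move=> [pr _ _ se1 [_ _ diag1]] [qr _ nw2 _ _] pq qr1.
  have [e|ne] := eqVneq r (c - q).
    by apply: (clash nw2 (t_eq se1 _ _)) => //; lia.
  by apply: (clash nw2 (diag1 _ _ _ _ _)) => //; lia.
have right p q s : triangle p q c -> triangle p s c -> q < s -> False.
  move=> [pr _ _ se1 [_ _ diag1]] [qr _ nw2 se2 _] qs.
  by apply: (clash se2 (diag1 _ _ _ _ _)) => //; lia.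
move=> T T' xy ax by_ ax' by'.
have aa' : a = a'.
  have [//|[lt|lt]] : a = a' \/ (a < a' \/ a' < a) by lia.
    by exfalso; apply: (left _ _ _ _ T T' lt); lia.
  by exfalso; apply: (left _ _ _ _ T' T lt); lia.
rewrite -aa' in T' *; split=> //.
have [//|[lt|lt]] : b = b' \/ (b < b' \/ b' < b) by lia.
  by exfalso; apply: (right _ _ _ T T').
by exfalso; apply: (right _ _ _ T' T).
Qed.

Lemma west_tile a b c y : triangle a b c -> b <= y <= c - a ->
  [\/ y = b /\ t a y = SW, t a y = West | y = c - a /\ t a y = NW].
Proof.
move=> [bc sw nw se [west south diag]] yb.
have [->|] := eqVneq y b; first by constructor 1.
have [->|yc yb'] := eqVneq y (c - a); first by constructor 3.
by constructor 2; apply: west; lia.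
Qed.

Lemma south_tile a b c x : triangle a b c -> a <= x <= c - b ->
  [\/ x = a /\ t x b = SW, t x b = South | x = c - b /\ t x b = SE].
Proof.
move=> [bc sw nw se [west south diag]] xa.
have [->|] := eqVneq x a; first by constructor 1.
have [->|xc xa'] := eqVneq x (c - b); first by constructor 3.
by constructor 2; apply: south; lia.
Qed.

Lemma diag_tile a b c x y : triangle a b c -> x + y = c -> a <= x -> b <= y ->
  [\/ x = a /\ t x y = NW, t x y = Diag | y = b /\ t x y = SE].
Proof.
move=> [bc sw nw se [west south diag]] xy ax by_.
have [xa|xa] := eqVneq x a.
  by constructor 1; split=> //; apply: t_eq nw _ _; lia.
have [yb|yb] := eqVneq y b.
  by constructor 3; split=> //; apply: t_eq se _ _; lia.
by constructor 2; apply: diag; lia.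
Qed.

Definition same (a b c a' b' c' : int) := [/\ a = a', b = b' & c = c'].

(** A cell common to sides of different kinds of two triangles carries a label of
    both kinds, so it is a corner of both, and the triangles are equal; the same
    holds for the other two pairs of sides. *)
Lemma west_south a b c a' b' c' : triangle a b c -> triangle a' b' c' ->
  b <= b' <= c - a -> a' <= a <= c' - b' -> same a b c a' b' c'.
Proof.
move=> T T' yb xa.
have [e e'] : b' = b /\ a = a'.
  by case: (west_tile T yb) => [[e tw]|tw|[_ tw]]; case: (south_tile T' xa) => [[e' tw']|tw'|[_ tw']];
    try (by rewrite tw in tw').
subst a' b'; have [_ <-] : b = b /\ c = c' by have [bc _ _ _ _] := T; have [bc' _ _ _ _] := T'; apply: (west_unique (y := b) T T'); lia.
by split.
Qed.

Lemma west_diag a b c a' b' c' y : triangle a b c -> triangle a' b' c' ->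
  b <= y <= c - a -> a' <= a -> b' <= y -> a + y = c' -> same a b c a' b' c'.
Proof.
move=> T T' yb xa yb' ay.
have yc : y = c - a.
  case: (west_tile T yb) => [[_ tw]|tw|[-> //]]; case: (diag_tile T' ay xa yb') => [[_ tw']|tw'|[_ tw']];
    by rewrite tw in tw'.
have cc : c' = c by lia.
subst c'; rewrite cc in T'; have [] := diag_unique (x := a) (y := y) T T'; by [lia|split].
Qed.

Lemma south_diag a b c a' b' c' x : triangle a b c -> triangle a' b' c' ->
  a <= x <= c - b -> a' <= x -> b' <= b -> x + b = c' -> same a b c a' b' c'.
Proof.
move=> T T' xa xa' yb' xb.
have yc : x = c - b.
  case: (south_tile T xa) => [[_ tw]|tw|[-> //]]; case: (diag_tile T' xb xa' yb') => [[_ tw']|tw'|[_ tw']];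
    by rewrite tw in tw'.
have cc : c' = c by lia.
subst c'; rewrite cc in T'; have [] := diag_unique (x := x) (y := b) T T'; by [lia|split].
Qed.

Definition nested (a b c a' b' c' : int) := [&& a' < a, b' < b & c < c'].

(** The intersection of two such triangles is a triangle of the same shape; were
    its sides not all borrowed from one of them, one of its corners would be a
    wall cell of both. *)
Lemma laminar a b c a' b' c' x y : triangle a b c -> triangle a' b' c' ->
  inside a b c x y -> inside a' b' c' x y ->
  [\/ same a b c a' b' c', nested a b c a' b' c' | nested a' b' c' a b c].
Proof.
rewrite /inside /nested => T T' i i'.
have [S|nS] := pselect (same a b c a' b' c'); first by constructor 1.
have nS' : ~ same a' b' c' a b c by case=> e1 e2 e3; apply: nS; split.
have f1 : ~~ ((a' <= a) && (b <= b')).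
  by apply/negP => h; apply: nS; apply: west_south T T' _ _; lia.
have f1' : ~~ ((a <= a') && (b' <= b)).
  by apply/negP => h; apply: nS'; apply: west_south T' T _ _; lia.
have f2 : ~~ ((a' <= a) && (c' <= c)).
  by apply/negP => h; apply: nS; apply: (@west_diag _ _ _ _ _ _ (c' - a) T T'); lia.
have f2' : ~~ ((a <= a') && (c <= c')).
  by apply/negP => h; apply: nS'; apply: (@west_diag _ _ _ _ _ _ (c - a') T' T); lia.
have f3 : ~~ ((b' <= b) && (c' <= c)).
  by apply/negP => h; apply: nS; apply: (@south_diag _ _ _ _ _ _ (c' - b) T T'); lia.
have f3' : ~~ ((b <= b') && (c <= c')).
  by apply/negP => h; apply: nS'; apply: (@south_diag _ _ _ _ _ _ (c - b') T' T); lia.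
have [lt|le] := ltP a' a; [constructor 2|constructor 3]; lia.
Qed.

Lemma filler_past_diag c : filler c -> past_diag c.
Proof. by rewrite /filler /past_diag !inE => /orP[]/eqP->. Qed.

Lemma ground_past_diag c : ground c -> ~~ past_diag c.
Proof. by case: c => [|[]]. Qed.

Lemma triangle_filler a b c x y : triangle a b c -> x <= c - b -> y <= c - a ->
  c < x + y -> filler (t x y).
Proof.
move=> T xc yc xy.
have [k] : exists k : nat, x + y = c + 1 + k%:Z.
  by exists (absz (x + y - c - 1)%R); lia.
elim/ltn_ind: k x y xc yc xy => k IH x y xc yc xy xyk.
have step p q : p <= c - b -> q <= c - a -> p + q = c + k%:Z -> past_diag (t p q).
  move=> pc qc pq; have [k0|k0] := posnP k.
    have [|||[_ ->]|->|[_ ->]] // := @diag_tile a b c p q T; lia.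
  by apply: filler_past_diag; apply: (IH k.-1); lia.
by rewrite fillerE !step //; lia.
Qed.

(** The square of a triangle is surrounded by ground on the left, below and on
    the right.  On the right this is proved upwards from the south-east corner:
    the cell next to a filler is ground or filler, and it is not a filler since
    the cell below it is ground. *)
Lemma ring_right a b c y : triangle a b c -> b <= y <= c - a ->
  ground (t (c - b + 1) y).
Proof.
move=> T yb; have [k] : exists k : nat, y = b + k%:Z.
  by exists (absz (y - b)%R); lia.
elim: k y yb => [|k IH] y yb yk.
  have [bc _ _ /rule_SE[g _ _ _ _] _] := T.
  by rewrite (_ : y = b) //; lia.
have f : filler (t (c - b) y) by apply: triangle_filler T _ _ _; lia.
case: (filler_right f) => //; rewrite fillerE => /andP[_].
by rewrite (negPf (ground_past_diag (IH (y - 1) _ _))) //; lia.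
Qed.

Lemma ring_left a b c y : triangle a b c -> b - 1 <= y <= c - a ->
  ground (t (a - 1) y).
Proof.
move=> T yb; have [->|yb1] := eqVneq y (b - 1).
  by case: T => _ /rule_SW[].
have [|[-> /rule_SW[]]|/rule_West[]|[-> /rule_NW[]]] // := @west_tile a b c y T; lia.
Qed.

Lemma ring_bottom a b c x : triangle a b c -> a - 1 <= x <= c - b + 1 ->
  ground (t x (b - 1)).
Proof.
move=> T xa; have [->|xa1] := eqVneq x (a - 1); first by case: T => _ /rule_SW[].
have [->|xc1] := eqVneq x (c - b + 1); first by case: T => _ _ _ /rule_SE[].
have [|[-> /rule_SW[]]|/rule_South[]|[-> /rule_SE[]]] // := @south_tile a b c x T; lia.
Qed.

Lemma ground_column (x y : int) (k : nat) :
  (forall j, y <= j <= y + k%:Z -> ground (t x j)) -> t x (y + k%:Z) = t x y.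
Proof.
elim: k => [|k IH] g; first by rewrite addr0.
rewrite -IH; last by move=> j yj; apply: g; lia.
rewrite intS (addrC 1) addrA ground_vertical //; apply: g; lia.
Qed.

Lemma ground_parity (x y : int) (k : nat) :
  (forall i, x <= i <= x + k%:Z -> ground (t i y)) ->
  odd (t (x + k%:Z) y) = odd (t x y) (+) odd k.
Proof.
elim: k => [|k IH] g; first by rewrite addr0 addbF.
rewrite /= addbN -IH; last by move=> j yj; apply: g; lia.
have := @ground_alternates (x + k%:Z) y; rewrite (_ : x + k%:Z + 1 = x + k.+1%:Z); last by lia.
move=> h; have {}h := h (g _ _) (g _ _).
have : odd (t (x + k.+1%:Z) y + t (x + k%:Z) y) by rewrite h //; lia.
by rewrite oddD; case: odd; case: odd.
Qed.

(** The colour of the ground on the two sides of a square is compared along the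
    path that goes down its left side, below it, and up its right side; only
    the horizontal steps change the colour. *)
Lemma jump_parity a b c y (k : nat) : triangle a b c -> b <= y <= c - a ->
  c - b + 1 = a - 1 + k%:Z ->
  odd (t (c - b + 1) y) = odd (t (a - 1) y) (+) odd k.
Proof.
move=> T yb ck.
have [j jy] : exists j : nat, y = b - 1 + j%:Z by exists (absz (y - b + 1)%R); lia.
have bottom i : a - 1 <= i <= c - b + 1 -> ground (t i (b - 1)) by exact: ring_bottom.
rewrite jy (@ground_column (a - 1)); last first.
  by move=> i ib; apply: ring_left T _; lia.
rewrite (@ground_column (c - b + 1)); last first.
  move=> i ib; have [->|ib1] := eqVneq i (b - 1).
    by case: T => bc _ _ _ _; apply: bottom; lia.
  by apply: (ring_right (b := b) T); lia.
by rewrite ck; apply: ground_parity => i ib; apply: bottom; lia.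
Qed.

Definition outside (x y : int) := forall a b c, triangle a b c -> ~~ inside a b c x y.

(** The cell that follows the square of a triangle on a row is again outside:
    the west wall of a triangle containing it would otherwise cross this
    square, whose cells are in the triangle, or fillers. *)
Lemma outside_jump a b c x y : triangle a b c -> outside x y -> x = a - 1 ->
  b <= y <= c - a -> outside (c - b + 1) y.
Proof.
move=> T out xa yb a' b' c' T'; apply/negP => i'.
have out' := out _ _ _ T'.
(* the west wall of the other triangle has to cross this square *)
have ca : x < a' <= c - b + 1 by move: i' out'; rewrite /inside; lia.
have tw : t a' y \in [:: SW; West; NW].
  rewrite !inE; case: (@west_tile a' b' c' y T').
  - by move: i'; rewrite /inside; lia.
  - by case=> _ ->.
  - by move=> ->.
  - by case=> _ ->.
have [ac|ac] : a' <= c - y \/ c - y < a' by lia.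
  have := @laminar a b c a' b' c' a' y T T'; rewrite /inside /nested.
  move: i' out'; rewrite /inside => i' out'.
  case; [lia|lia|case; lia|lia|].
  move: i'; lia.
have [e|ne] := eqVneq a' (c - b + 1).
  have := ground_past_diag (ring_right T yb); have := ring_right T yb.
  by rewrite -e; move: tw; rewrite !inE => /or3P[]/eqP->.
have f : filler (t a' y) by apply: triangle_filler T _ _ _; lia.
by move: f tw; rewrite /filler !inE => /orP[]/eqP->.
Qed.

(** The colours of the ground cells outside all triangles are coherent along a
    row.  Going right from such a cell, the next cell is of the same sort or
    belongs to the west wall of a triangle, whose square is then jumped over. *)
Lemma outside_parity (x y : int) (k : nat) : ground (t x y) -> outside x y ->
  ground (t (x + k%:Z) y) -> outside (x + k%:Z) y ->
  odd (t (x + k%:Z) y) = odd (t x y) (+) odd k.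
Proof.
elim/ltn_ind: k x => -[|k] IH x g out g' out'; first by rewrite addr0 addbF.
have [g1|ng1] := boolP (ground (t (x + 1) y)).
  have e : x + k.+1%:Z = x + 1 + k%:Z by lia.
  rewrite e in g' out' *.
  have out1 : outside (x + 1) y.
    move=> a b c T; apply/negP => i; have := out _ _ _ T.
    have [ax|ax] := eqVneq a (x + 1); last by move: i; rewrite /inside; lia.
    move: i; rewrite /inside => i _.
    have g1' : ground (t a y) by rewrite ax.
    by have [|[_ tw]|tw|[_ tw]] := @west_tile a b c y T; first lia;
      rewrite tw in g1'.
  have := ground_alternates g g1; rewrite (IH k) // => h.
  have : odd (t (x + 1) y + t x y) by rewrite h.
  by rewrite oddD /=; case: odd; case: odd; case: odd.
have [tw|ntw] := boolP (t (x + 1) y \in [:: SW; West; NW]).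
  have [b [c [T i]]] := west_triangle tw.
  have [bc _ _ _ _] := T.
  have yb : b <= y <= c - (x + 1) by move: i; rewrite /inside; lia.
  have [m em] : exists m : nat, c - b + 1 = x + m%:Z.
    by exists (absz (c - b + 1 - x)%R); lia.
  have [mk|km] := leqP m k.+1.
    have gm : ground (t (x + m%:Z) y) by rewrite -em; apply: ring_right T yb.
    have om : outside (x + m%:Z) y by rewrite -em; apply: outside_jump T out _ yb; lia.
    have e : x + k.+1%:Z = x + m%:Z + (k.+1 - m)%N%:Z by lia.
    rewrite e (IH (k.+1 - m)%N) -?e //; last by lia.
    rewrite -em (@jump_parity (x + 1) b c y m T yb); last by lia.
    by rewrite (_ : x + 1 - 1 = x) ?oddB //; [case: odd; case: odd; case: odd|lia].
  have [kc|kc] : x + k.+1%:Z <= c - y \/ c - y < x + k.+1%:Z by lia.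
    by have := out' _ _ _ T; rewrite /inside; lia.
  have f : filler (t (x + k.+1%:Z) y) by apply: triangle_filler T _ _ _; lia.
  by have := ground_past_diag g'; rewrite filler_past_diag.
exfalso; move: ntw ng1; have xx : x + 1 - 1 = x by lia.
have [td|ntd] := eqVneq (t (x + 1) y) Diag.
  have [a [b [c [T xy ax by_]]]] := diag_triangle td.
  by have := out _ _ _ T; rewrite /inside; lia.
have [td|ntse] := eqVneq (t (x + 1) y) SE.
  have [_ _ _ + _] := rule_SE td; rewrite xx => -[e|e]; by rewrite e in g.
have [td|ntso] := eqVneq (t (x + 1) y) South.
  have [_ _] := rule_South td; rewrite xx => -[e|e]; by rewrite e in g.
have [f|nf] := boolP (filler (t (x + 1) y)).
  by move: f; rewrite fillerE xx (negPf (ground_past_diag g)).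
move: (t_small (x + 1) y) ntd ntse ntso nf; rewrite !inE /ground /filler.
by case: (t (x + 1) y) => [|[|[|[|[|[|[|[|[|[|c]]]]]]]]]].
Qed.

Lemma filler_parity (x y : int) (k : nat) :
  (forall i, x <= i <= x + k%:Z -> filler (t i y)) ->
  odd (t (x + k%:Z) y) = odd (t x y) (+) odd k.
Proof.
elim: k => [|k IH] g; first by rewrite addr0 addbF.
rewrite /= addbN -IH; last by move=> j yj; apply: g; lia.
have := @filler_alternates (x + k%:Z) y; rewrite (_ : x + k%:Z + 1 = x + k.+1%:Z); last by lia.
move=> h; have {}h := h (g _ _) (g _ _).
have : odd (t (x + k.+1%:Z) y + t (x + k%:Z) y) by rewrite h //; lia.
by rewrite oddD; case: odd; case: odd.
Qed.

Definition square (a b c x y : int) :=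
  [&& a <= x, b <= y, x <= c - b & y <= c - a].

(** Going left from a filler, the run of fillers starts at the hypotenuse of a
    triangle, and it cannot leave the square of that triangle since the square
    is bounded by ground on the right. *)
Lemma filler_square x y : noline filler (-1) 0 -> filler (t x y) ->
  exists a b c : int, [/\ triangle a b c, square a b c x y & c < x + y].
Proof.
move=> fin fxy; have fin' : exists k : nat, ~~ filler (t (x - k%:Z) y).
  by have [k fk] := fin x y; exists k; rewrite mul0r addr0 mulN1r in fk.
case: (ex_minnP fin') => -[|k] nfk kmin; first by rewrite subr0 fxy in nfk.
have run i : x - k%:Z <= i <= x -> filler (t i y).
  move=> ix; apply/negPn/negP => nf; suff : (k.+1 <= absz (x - i)%R)%N by lia.
  by apply: kmin; rewrite (_ : x - _ = i) //; lia.
pose z := x - k.+1%:Z.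
have hz : past_diag (t z y).
  have : filler (t (x - k%:Z) y) by apply: run; lia.
  by rewrite fillerE (_ : x - k%:Z - 1 = z); [case/andP | lia].
have [a [b [c [T zc az bz]]]] : exists a b c : int,
    [/\ triangle a b c, z + y = c, a <= z & b < y].
  move: hz nfk; rewrite -/z /past_diag !inE /filler => /or4P[/eqP tz _|/eqP tz _|/eqP tz _|-> //].
  - have [|b [c [T i]]] := @west_triangle z y; first by rewrite tz !inE eqxx !orbT.
    have [bc _ _ _ _] := T; exists z, b, c.
    have [|[_ tw]|tw|[yc _]] := @west_tile z b c y T; [|by rewrite tw in tz..|].
      by move: i; rewrite /inside; lia.
    by split=> //; lia.
  - by have [a [b [c [T xy ax by_]]]] := diag_triangle tz; exists a, b, c; split=> //; lia.
  - have [g _ _ _ _] := rule_SE tz.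
    have /filler_past_diag : filler (t (z + 1) y) by apply: run; lia.
    by rewrite (negPf (ground_past_diag g)).
have [bc _ _ _ _] := T.
exists a, b, c; split=> //; last by lia.
have [xc|xc] : x <= c - b \/ c - b < x by lia.
  by rewrite /square; lia.
have /ground_past_diag : ground (t (c - b + 1) y) by apply: (ring_right T); lia.
by rewrite filler_past_diag //; apply: run; lia.
Qed.

(** The west wall of the second triangle cannot cross the filler of the square,
    so the second triangle also contains a cell of the hypotenuse of the first;
    [laminar] then leaves only this case. *)
Lemma filler_inside a b c a' b' c' x y : triangle a b c -> triangle a' b' c' ->
  square a b c x y -> c < x + y -> inside a' b' c' x y -> nested a b c a' b' c'.
Proof.
move=> T T' s xy i'.
have [ac|ac] : a' <= c - y \/ c - y < a' by lia.
  have [| |[]|//|] := @laminar a b c a' b' c' (c - y) y T T';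
    move: s i'; rewrite /square /inside /nested; lia.
have f : filler (t a' y).
  by apply: triangle_filler T _ _ _; move: s i'; rewrite /square /inside; lia.
have := @west_tile a' b' c' y T' => -[|[_ tw]|tw|[_ tw]].
  by move: i'; rewrite /inside; lia.
all: by rewrite tw in f.
Qed.

(** Every cell outside all triangles yields a ground cell outside all triangles.
    Wall cells are in a triangle; for a filler, the cell to the left of its
    square, on the same row, is ground and outside. *)
Lemma outside_none : noline filler (-1) 0 ->
  (forall x y, ground (t x y) -> ~ outside x y) ->
  forall x y, exists a b c, triangle a b c /\ inside a b c x y.
Proof.
move=> fin gin x y; apply: contrapT => out.
have {}out : outside x y.
  by move=> a b c T; apply/negP => i; apply: out; exists a, b, c.
have [g|ng] := boolP (ground (t x y)); first exact: gin g out.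
have [tw|ntw] := boolP (t x y \in [:: SW; West; NW]).
  by have [b [c [T i]]] := west_triangle tw; have := out _ _ _ T; rewrite i.
have [td|ntd] := eqVneq (t x y) Diag.
  have [a [b [c [T xy ax by_]]]] := diag_triangle td.
  by have := out _ _ _ T; rewrite /inside; lia.
have [ts|nts] := boolP ((t x y == SE) || (t x y == South)).
  have ts' : t x y = SE \/ t x y = South by case/orP: ts => /eqP; auto.
  have [a [ax ta south]] := go_left ts'; have [c T] := SW_triangle ta.
  have := out _ _ _ T; rewrite /inside; have [bc _ _ se _] := T.
  have [xc|xc] : x <= c - y \/ c - y < x by lia.
    by lia.
  by move=> _; apply: (clash se (south _ _)) => //; lia.
have f : filler (t x y).
  move: (t_small x y) ng ntw ntd nts; rewrite !inE /ground /filler.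
  by case: (t x y) => [|[|[|[|[|[|[|[|[|[|n]]]]]]]]]].
have [a [b [c [T s xy]]]] := filler_square fin f.
have [bc _ _ _ _] := T.
have gl : ground (t (a - 1) y) by apply: (ring_left T); move: s; rewrite /square; lia.
apply: (gin _ _ gl) => a' b' c' T'; apply/negP => i'.
have [bc' _ _ _ _] := T'.
have iay : inside a' b' c' a y.
  have [e|ne] := eqVneq (a - 1 + y) c'; last by move: i'; rewrite /inside; lia.
  have [i1 i2] : a' <= a - 1 /\ b' <= y by move: i'; rewrite /inside; lia.
  by have [[_ tw]|tw|[_ tw]] := diag_tile T' e i1 i2; rewrite tw in gl.
have n : nested a b c a' b' c'.
  have [| |[]|//|] := @laminar a b c a' b' c' a y T T';
    move: s i' iay; rewrite /square /inside /nested; lia.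
have := out _ _ _ T'; rewrite negb_and => o'.
have xc : c' < x + y by move: o' s n; rewrite /square /nested; lia.
have f' : filler (t (c' - y) y).
  by apply: triangle_filler T _ _ _; move: s n; rewrite /square /nested; lia.
have [|||[_ tw]|tw|[_ tw]] := @diag_tile a' b' c' (c' - y) y T'.
1-3: by move: s n; rewrite /square /nested; lia.
all: by rewrite tw in f'.
Qed.

Definition maximal (D a b c : int) := [/\ triangle a b c, c - a - b <= D &
  forall a' b' c', triangle a' b' c' -> c' - a' - b' <= D -> ~~ nested a b c a' b' c'].

Lemma exists_maximal D a b c x y : triangle a b c -> c - a - b <= D ->
  inside a b c x y -> exists a b c, maximal D a b c /\ inside a b c x y.
Proof.
move=> T cD i; have [k] : exists k : nat, c - a - b = D - k%:Z.
  by exists (absz (D - (c - a - b))%R); lia.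
elim/ltn_ind: k a b c T cD i => k IH a b c T cD i ck.
have [M|nM] := pselect (maximal D a b c); first by exists a, b, c.
have [a' [b' [c' [T' cD' n]]]] : exists a' b' c' : int,
    [/\ triangle a' b' c', c' - a' - b' <= D & nested a b c a' b' c'].
  apply: contrapT => no; apply: nM; split=> // a' b' c' T' cD'.
  by apply/negP => n; apply: no; exists a', b', c'.
apply: (IH (absz (D - (c' - a' - b'))%R) _ a' b' c') => //.
- by move: n; rewrite /nested; lia.
- by move: n i; rewrite /nested /inside; lia.
- by move: n; rewrite /nested; lia.
Qed.

(** Triangles that share a cell are equal by maximality.  If a cell of one
    triangle is a filler of the other square, [filler_inside] nests them; and
    if two squares meet in their filler parts, the hypotenuse of one of them
    would run through the filler of the other. *)
Lemma maximal_disjoint D a b c a' b' c' x y :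
  maximal D a b c -> maximal D a' b' c' ->
  square a b c x y -> square a' b' c' x y -> same a b c a' b' c'.
Proof.
move=> [T cD M] [T' cD' M'] s s'.
have both p q : inside a b c p q -> inside a' b' c' p q -> same a b c a' b' c'.
  move=> i i'; have [//|n|n] := laminar T T' i i'.
    by have := M _ _ _ T' cD'; rewrite n.
  by have := M' _ _ _ T cD; rewrite n.
have [xy|xy] : x + y <= c \/ c < x + y by lia.
  have [xy'|xy'] : x + y <= c' \/ c' < x + y by lia.
    by apply: (both x y); move: s s'; rewrite /square /inside; lia.
  have := M' _ _ _ T cD; rewrite (filler_inside T' T s' xy') //.
  by move: s; rewrite /square /inside; lia.
have [xy'|xy'] : x + y <= c' \/ c' < x + y by lia.
  have := M _ _ _ T' cD'; rewrite (filler_inside T T' s xy) //.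
  by move: s'; rewrite /square /inside; lia.
have wall p q r u v : triangle p q r -> square p q r u v -> r < u + v ->
    t (r - v) v = NW \/ t (r - v) v = Diag.
  rewrite /square => P S uv; have [i1 i2 i3] : [/\ r - v + v = r, p <= r - v & q <= v].
    by split; lia.
  have [[_ ->]|->|[vq _]] := diag_tile P i1 i2 i3; [by left|by right|lia].
have clash' p q r p' q' r' : triangle p q r -> square p q r x y -> r < x + y ->
    triangle p' q' r' -> square p' q' r' x y -> r' < x + y -> r < r' -> False.
  move=> P S u P' S' u' rr; have f : filler (t (r' - y) y).
    by apply: triangle_filler P _ _ _; move: S S'; rewrite /square; lia.
  by case: (wall _ _ _ _ _ P' S' u') => tw; rewrite tw in f.
have cc : c = c'.
  have [//|[lt|lt]] : c = c' \/ (c < c' \/ c' < c) by lia.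
    by exfalso; apply: (clash' _ _ _ _ _ _ T s xy T' s' xy').
  by exfalso; apply: (clash' _ _ _ _ _ _ T' s' xy' T s xy).
by apply: (both (c - y) y); move: s s'; rewrite /square /inside; lia.
Qed.
End Geometry.

(** * The labeling problem and its solutions from squares of many scales *)

Section Problem.
Variables (G : zmodType) (u v : G).

Definition emb (a b : int) : G := u *~ a + v *~ b.

Lemma embD (a b a' b' : int) : emb (a + a') (b + b') = emb a b + emb a' b'.
Proof. by rewrite /emb !mulrzDr addrACA. Qed.

Lemma emb0 : emb 0 0 = 0.
Proof. by rewrite /emb !mulr0z addr0. Qed.

Lemma emb_mulrn (a b : int) k : emb a b *+ k = emb (a * k%:Z) (b * k%:Z).
Proof.
elim: k => [|k IH]; first by rewrite mulr0n !mulr0 emb0.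
by rewrite mulrS IH -embD; congr emb; lia.
Qed.

Definition around : {fset G} :=
  [fset g | g in [seq emb (i%:Z - 1) (j%:Z - 1) | i <- iota 0 3, j <- iota 0 3]]%fset.

Lemma around_emb (a b : int) : -1 <= a <= 1 -> -1 <= b <= 1 -> emb a b \in around.
Proof.
move=> a1 b1; apply/imfsetP; exists (emb a b) => //; apply/allpairsP.
exists (absz (a + 1)%R, absz (b + 1)%R); rewrite !mem_iota /=; split; [lia|lia|].
by congr emb => /=; lia.
Qed.

Definition lookup (p : {ffun around -> 'I_10}) (g : G) : nat :=
  if insub g is Some w then p w else 0%N.

Definition triangle_LCL : LCL G :=
  @MkLCL G around 'I_10 [set p | rule (fun a b => lookup p (emb a b))].

Lemma triangle_solutionP (T : Type) (act : G -> T -> T) (f : T -> 'I_10) :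
  is_solution (Pi := triangle_LCL) act f <->
  forall x, rule (fun a b => f (act (emb a b) x)).
Proof.
have E x : rule (fun a b => lookup [ffun w : around => f (act (val w) x)] (emb a b)) =
           rule (fun a b => f (act (emb a b) x)).
  apply: eq_rule => a b a1 b1; rewrite /lookup.
  case: insubP => [w _ <-|]; last by rewrite around_emb.
  by rewrite ffunE.
by split=> sol x; have := sol x; rewrite /= inE E.
Qed.

End Problem.

(** The tile at position (i, j) of the square [0, m] x [0, m] of a triangle; the
    colours follow the parity of the column. *)
Definition tile (m i j : nat) : nat :=
  (if m < i + j then 8 + odd i
   else if i + j == m then
     if i == 0 then NW else if j == 0 then SE else Diag
   else if i == 0 then if j == 0 then SW else West
   else if j == 0 then South
   else odd i)%N.

Lemma tile_ground m i j : (0 < m)%N -> ground (tile m i j) ->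
  [/\ (0 < i)%N, (0 < j)%N & (i + j < m)%N].
Proof.
rewrite /tile /ground => m0; do ![case: ifP => //] => *; split; lia.
Qed.

Lemma tile_core m i j : (0 < i)%N -> (0 < j)%N -> (i + j < m)%N -> tile m i j = odd i.
Proof. by rewrite /tile => i0 j0 ij; do ![case: ifP => //] => *; lia. Qed.

Lemma tile_past_diag m i j : (i + j < m)%N -> ~~ past_diag (tile m i j).
Proof.
by rewrite /tile => ij; do ![case: ifP => //]; rewrite /past_diag !inE => *; [lia..|case: odd].
Qed.

(** A case analysis on the corner, the side or the filler part to which the cell
    belongs; the bound on [m] keeps the neighbourhoods of the corners apart. *)
Lemma frame_rule (t : int -> int -> nat) (m i j : nat) :
  t 0 0 = tile m i j ->
  (forall a b : int, -1 <= a <= 1 -> -1 <= b <= 1 ->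
    (exists i' j' : nat, [/\ i'%:Z = i%:Z + a, j'%:Z = j%:Z + b,
        (i' <= m)%N, (j' <= m)%N & t a b = tile m i' j']) \/
    ([|| i%:Z + a < 0, m%:Z < i%:Z + a, j%:Z + b < 0 | m%:Z < j%:Z + b] /\
     ground (t a b))) ->
  (4 <= m)%N -> (i <= m)%N -> (j <= m)%N ->
  ~~ [&& (0 < i)%N, (0 < j)%N & (i + j < m)%N] -> rule t.
Proof.
move=> t00 N m4 im jm fr.
have Nin (a b : int) (i' j' : nat) : -1 <= a <= 1 -> -1 <= b <= 1 ->
    i'%:Z = i%:Z + a -> j'%:Z = j%:Z + b -> (i' <= m)%N -> (j' <= m)%N ->
    t a b = tile m i' j'.
  move=> a1 b1 ei ej i'm j'm; have [[i2 [j2 [e e' _ _ ->]]]|[out _]] := N a b a1 b1.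
    by congr tile; lia.
  by lia.
have Nout (a b : int) : -1 <= a <= 1 -> -1 <= b <= 1 ->
    [|| i%:Z + a < 0, m%:Z < i%:Z + a, j%:Z + b < 0 | m%:Z < j%:Z + b] -> ground (t a b).
  by move=> a1 b1 o; have [[i2 [j2 [e e' i2m j2m _]]]|[]//] := N a b a1 b1; lia.
have tSW : tile m 0 0 = SW by rewrite /tile; do ![case: ifP => //] => *; lia.
have tW j' : (0 < j' < m)%N -> tile m 0 j' = West.
  by rewrite /tile => *; do ![case: ifP => //] => *; lia.
have tNW j' : j' = m -> tile m 0 j' = NW.
  by rewrite /tile => *; do ![case: ifP => //] => *; lia.
have tS i' : (0 < i' < m)%N -> tile m i' 0 = South.
  by rewrite /tile => *; do ![case: ifP => //] => *; lia.
have tSE i' : i' = m -> tile m i' 0 = SE.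
  by rewrite /tile => *; do ![case: ifP => //] => *; lia.
have tD i' j' : (0 < i')%N -> (0 < j')%N -> (i' + j' = m)%N -> tile m i' j' = Diag.
  by rewrite /tile => *; do ![case: ifP => //] => *; lia.
have tE i' j' : (m < i' + j')%N -> tile m i' j' = (8 + odd i')%N.
  by rewrite /tile => *; do ![case: ifP => //] => *; lia.
have gnh c : ground c -> past_diag c = false by move/ground_past_diag/negPf.
have [ij|ij] := leqP (i + j)%N m; last first.
  have hh p q : (p <= m)%N -> (q <= m)%N -> (m <= p + q)%N -> (0 < q)%N -> past_diag (tile m p q).
    move=> pm qm; rewrite leq_eqVlt => /orP[/eqP pq|pq] q0; last by rewrite tE //; case: odd.
    have [p0|p0] := posnP p; first by rewrite p0 tNW //; lia.
    by rewrite tD //; lia.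
  have hS p : p = m -> past_diag (tile m p 0) by move=> pm; rewrite tSE.
  have e1 : past_diag (t (-1) 0) by rewrite (Nin (-1) 0 i.-1 j) ?hh //; lia.
  have e2 : past_diag (t 0 (-1)).
    rewrite (Nin 0 (-1) i j.-1) //; [|lia..].
    by have [j1|j1] := posnP j.-1; [rewrite j1 hS //; lia|apply: hh; lia].
  have e3 : ground (t 1 0) \/ t 1 0 = (8 + ~~ odd i)%N.
    have [im'|im'] := leqP i.+1 m.
      by right; rewrite (Nin 1 0 i.+1 j) ?tE //; lia.
    by left; apply: Nout => //; lia.
  rewrite /rule t00 tE // e1 e2.
  case: e3 => [g|->]; last by case: odd.
  rewrite g /=; case: odd => /=; rewrite ?andbT /=;
    by move: g; rewrite /ground /filler; case: (t 1 0) => [|[]].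
have [ei|i0] := posnP i.
  have gl : ground (t (-1) 0) by apply: Nout; lia.
  have [ej|j0] := posnP j.
    have gd : ground (t 0 (-1)) by apply: Nout; lia.
    have gc : ground (t (-1) (-1)) by apply: Nout; lia.
    have right : t 1 0 = South by rewrite (Nin 1 0 1%N 0%N); [rewrite tS //; lia|lia..].
    have up : t 0 1 = West by rewrite (Nin 0 1 0%N 1%N); [rewrite tW //; lia|lia..].
    by rewrite /rule t00 ei ej tSW gl gd gc right up /= (gnh _ gl).
  have [ej|jm'] := eqVneq j m.
    have down : t 0 (-1) = West.
      by rewrite (Nin 0 (-1) 0%N j.-1); [rewrite tW //; lia|lia..].
    have diag : t 1 (-1) = Diag.
      by rewrite (Nin 1 (-1) 1%N j.-1); [rewrite tD //; lia|lia..].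
    by rewrite /rule t00 ei tNW // gl down diag /= (gnh _ gl).
  have up : t 0 1 \in [:: West; NW].
    rewrite (Nin 0 1 0%N j.+1); [|lia..].
    by have [e|e] := eqVneq j.+1 m; [rewrite tNW|rewrite tW //; lia].
  have down : t 0 (-1) \in [:: SW; West].
    rewrite (Nin 0 (-1) 0%N j.-1); [|lia..].
    by have [e|e] := posnP j.-1; [rewrite e tSW|rewrite tW //; lia].
  rewrite /rule t00 ei tW ?gl ?up ?down; last by lia.
  by rewrite /= (gnh _ gl).
have [ej|j0] := posnP j.
  have gd : ground (t 0 (-1)) by apply: Nout; lia.
  have [ei|im'] := eqVneq i m.
    have gr : ground (t 1 0) by apply: Nout; lia.
    have gc : ground (t 1 (-1)) by apply: Nout; lia.
    have left : t (-1) 0 = South.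
      by rewrite (Nin (-1) 0 i.-1 0%N); [rewrite tS //; lia|lia..].
    have diag : t (-1) 1 = Diag.
      by rewrite (Nin (-1) 1 i.-1 1%N); [rewrite tD //; lia|lia..].
    by rewrite /rule t00 ej tSE // gd gr gc left diag.
  have right : t 1 0 \in [:: SE; South].
    rewrite (Nin 1 0 i.+1 0%N); [|lia..].
    by have [e|e] := eqVneq i.+1 m; [rewrite tSE|rewrite tS //; lia].
  have left : t (-1) 0 \in [:: SW; South].
    rewrite (Nin (-1) 0 i.-1 0%N); [|lia..].
    by have [e|e] := posnP i.-1; [rewrite e tSW|rewrite tS //; lia].
  rewrite /rule t00 ej tS ?gd ?right ?left; last by lia.
  by rewrite /= (gnh _ gd) andbF.
have ijm : (i + j = m)%N by lia.
have down : t 1 (-1) \in [:: Diag; SE].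
  rewrite (Nin 1 (-1) i.+1 j.-1); [|lia..].
  by have [e|e] := posnP j.-1; [rewrite e tSE //; lia|rewrite tD //; lia].
have up : t (-1) 1 \in [:: NW; Diag].
  rewrite (Nin (-1) 1 i.-1 j.+1); [|lia..].
  by have [e|e] := posnP i.-1; [rewrite e tNW //; lia|rewrite tD //; lia].
have left : past_diag (t (-1) 0) = false.
  by rewrite (Nin (-1) 0 i.-1 j); [rewrite (negPf (@tile_past_diag m i.-1 j _)) //; lia|lia..].
by rewrite /rule t00 tD // down up left.
Qed.

(** Each centre s of level k, that is, with [V k s], is the point at position
    (r k, r k) of a square of side 4 r k.  Squares of one level do not touch,
    by [same_level].  By [lower_level] a square of level j < k is strictly inside
    the core of the triangle of a square of level k, or does not touch that
    square. *)
Section Scheme.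
Variables (G : zmodType) (u v : G).
Hypothesis emb_inj : forall a b : int, emb u v a b = 0 -> a = 0 /\ b = 0.
Variables (T : Type) (act : G -> T -> T).
Hypotheses (act_act : is_action act) (act_free : is_free act).
Local Notation mv a b := (act (emb u v a b)).

Variables (r : nat -> nat) (V : nat -> T -> Prop).
Hypothesis r_gt0 : forall k, (0 < r k)%N.

Definition far (a b R : int) := R < a \/ R < - a \/ R < b \/ R < - b.
Definition near (a b R : int) := [&& - R < a, a < R, - R < b & b < R].

Hypothesis same_level : forall k s (a b : int), V k s -> V k (mv a b s) ->
  far a b (4 * r k + 1)%N%:Z \/ (a = 0 /\ b = 0).
Hypothesis lower_level : forall j k s (a b : int), (j < k)%N -> V k s -> V j (mv a b s) ->
  near a b ((r k)%:Z - 1 - 3 * (r j)%:Z) \/ far a b (3 * r k + 1 + 3 * r j)%N%:Z.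

(** The equation puts [x] at position (i, j) of the square of centre [s]; written
    without subtraction, it can be tested by a program. *)
Definition covers (k : nat) (i j : nat) (x : T) : Prop :=
  [/\ (i <= 4 * r k)%N, (j <= 4 * r k)%N & exists2 s, V k s & mv i j s = mv (r k) (r k) x].

Definition covered (k : nat) (x : T) : Prop := exists i j, covers k i j x.

(** The square of least level wins; it is drawn over the cores of the others. *)
Definition tiled (x : T) (c : nat) : Prop := exists k i j,
  [/\ forall k', (k' < k)%N -> ~ covered k' x, covers k i j x & c = tile (4 * r k) i j].

Lemma mvD (a b a' b' : int) x : mv (a + a') (b + b') x = mv a b (mv a' b' x).
Proof. by case: act_act => _ h; rewrite embD h. Qed.

Lemma mv0 x : mv 0 0 x = x.
Proof. by case: act_act => h _; rewrite emb0 h. Qed.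

Lemma mv_inj (a b a' b' : int) x : mv a b x = mv a' b' x -> a = a' /\ b = b'.
Proof.
move=> e; have e' : mv (a - a') (b - b') x = x.
  by rewrite ![_ - _]addrC mvD e -mvD !addNr mv0.
have [/emb_inj[h h']|/eqP nz] := eqVneq (emb u v (a - a') (b - b')) 0; first lia.
by have := act_free nz e'.
Qed.

Lemma coversP k i j x : covers k i j x -> exists2 s, V k s &
  x = mv (i%:Z - (r k)%:Z) (j%:Z - (r k)%:Z) s.
Proof.
move=> [_ _ [s Vs e]]; exists s => //.
by rewrite ![_ - (r k)%:Z]addrC mvD e -mvD !addNr mv0.
Qed.

(** Neighbouring cells covered at the same level belong to the same square, and
    by [covers_lower] a cell covered at a higher level than a neighbour is in
    the core of its triangle. *)
Lemma covers_same k i j i' j' x (a b : int) : covers k i j x -> covers k i' j' (mv a b x) ->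
  -1 <= a <= 1 -> -1 <= b <= 1 -> i'%:Z = i%:Z + a /\ j'%:Z = j%:Z + b.
Proof.
move=> c c' a1 b1; have [s Vs xs] := coversP c; have [s' Vs' xs'] := coversP c'.
have [i4 j4 _] := c; have [i4' j4' _] := c'.
pose A := i%:Z + a - i'%:Z; pose B := j%:Z + b - j'%:Z.
have ss : s' = mv A B s.
  have /(congr1 (act (emb u v ((r k)%:Z - i'%:Z) ((r k)%:Z - j'%:Z)))) := xs'.
  have z (p q : int) : p - q + (q - p) = 0 by lia.
  rewrite -!mvD !z mv0 => e.
  by rewrite -e xs -!mvD; congr act; congr emb; rewrite /A /B; lia.
rewrite ss in Vs'; have [|] := same_level Vs Vs'; rewrite /far /A /B; lia.
Qed.

Lemma tiled_unique x c c' : tiled x c -> tiled x c' -> c = c'.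
Proof.
move=> [k [i [j [kmin cx ->]]]] [k' [i' [j' [kmin' cx' ->]]]].
have [kk|kk|kk] := ltngtP k k'.
- by case: (kmin' k kk); exists i, j.
- by case: (kmin k' kk); exists i', j'.
- subst k'; have cx0 : covers k i' j' (mv 0 0 x) by rewrite mv0.
  by have [||e e'] := covers_same cx cx0; [lia..|congr tile; lia].
Qed.

Lemma covers_lower j k i1 j1 i2 j2 x (a b : int) : (j < k)%N ->
  covers j i1 j1 x -> covers k i2 j2 (mv a b x) ->
  -1 <= a <= 1 -> -1 <= b <= 1 -> [/\ (0 < i2)%N, (0 < j2)%N & (i2 + j2 < 4 * r k)%N].
Proof.
move=> jk c c' a1 b1; have [s Vs xs] := coversP c; have [s' Vs' xs'] := coversP c'.
have [i4 j4 _] := c; have [i4' j4' _] := c'.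
pose A := i2%:Z - (r k)%:Z - a - (i1%:Z - (r j)%:Z).
pose B := j2%:Z - (r k)%:Z - b - (j1%:Z - (r j)%:Z).
have ss : s = mv A B s'.
  have /(congr1 (act (emb u v ((r j)%:Z - i1%:Z) ((r j)%:Z - j1%:Z)))) := xs.
  have z (p q : int) : p - q + (q - p) = 0 by lia.
  rewrite -!mvD !z mv0 => e.
  rewrite -e; have /(congr1 (act (emb u v (- a) (- b)))) := xs'.
  rewrite -!mvD !addNr mv0 => ->; rewrite -!mvD {e}.
  by congr act; congr emb; rewrite /A /B; lia.
by rewrite ss in Vs; have [|] := lower_level jk Vs' Vs; rewrite /near /far /A /B => h; split; lia.
Qed.

Lemma covers_move k i j x (a b : int) (i' j' : nat) : covers k i j x ->
  i'%:Z = i%:Z + a -> j'%:Z = j%:Z + b -> (i' <= 4 * r k)%N -> (j' <= 4 * r k)%N ->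
  covers k i' j' (mv a b x).
Proof.
move=> [_ _ [s Vs e]] ei ej i4 j4; split=> //; exists s => //.
rewrite ei ej ![_ + a]addrC ![_ + b]addrC mvD e -!mvD.
by congr act; congr emb; lia.
Qed.

(** The cases compare the levels of the two cells: if they are equal, the cells
    are in the same square; if the neighbour has the higher level, it is in the
    core of its triangle, hence ground; if it has the lower level, the cell
    itself is in the core of its triangle. *)
Lemma neighbour (x : T) (a b : int) (k i j c : nat) :
  (forall k', (k' < k)%N -> ~ covered k' x) -> covers k i j x ->
  tiled (mv a b x) c -> -1 <= a <= 1 -> -1 <= b <= 1 ->
  [\/ exists i' j' : nat, [/\ i'%:Z = i%:Z + a, j'%:Z = j%:Z + b,
        (i' <= 4 * r k)%N, (j' <= 4 * r k)%N & c = tile (4 * r k) i' j'],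
      [|| i%:Z + a < 0, (4 * r k)%N%:Z < i%:Z + a, j%:Z + b < 0 |
          (4 * r k)%N%:Z < j%:Z + b] /\ ground c |
      [&& (0 < i)%N, (0 < j)%N & (i + j < 4 * r k)%N] /\
      exists k' i' j' : nat, [/\ (k' < k)%N, covers k' i' j' (mv a b x),
        [|| i'%:Z - a < 0, (4 * r k')%N%:Z < i'%:Z - a, j'%:Z - b < 0 |
          (4 * r k')%N%:Z < j'%:Z - b] & c = tile (4 * r k') i' j']].
Proof.
move=> kmin cx [k' [i' [j' [kmin' cy ->]]]] a1 b1.
have back : x = mv (- a) (- b) (mv a b x) by rewrite -mvD !addNr mv0.
have [i4 j4 _] := cx; have [i4' j4' _] := cy.
have [kk|kk|kk] := ltngtP k k'.
- constructor 2; have [i0 j0 ij] := covers_lower kk cx cy a1 b1; split; last first.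
    by rewrite tile_core //; case: odd.
  apply/negPn/negP => ins; apply: (kmin' k kk).
  exists (absz (i%:Z + a)%R), (absz (j%:Z + b)%R).
  by apply: covers_move cx _ _ _ _; lia.
- constructor 3; have cx' : covers k i j (mv (- a) (- b) (mv a b x)) by rewrite -back.
  have [i0 j0 ij] : [/\ (0 < i)%N, (0 < j)%N & (i + j < 4 * r k)%N].
    by apply: (covers_lower kk cy cx'); lia.
  split; first by rewrite i0 j0.
  exists k', i', j'; split=> //; apply/negPn/negP => ins; apply: (kmin k' kk).
  exists (absz (i'%:Z - a)%R), (absz (j'%:Z - b)%R).
  by rewrite back; apply: covers_move cy _ _ _ _; lia.
- constructor 1; subst k'; have [e e'] := covers_same cx cy a1 b1.
  by exists i', j'.
Qed.

Lemma frame_neighbour (x : T) (a b : int) (k i j c : nat) :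
  (forall k', (k' < k)%N -> ~ covered k' x) -> covers k i j x ->
  tiled (mv a b x) c -> -1 <= a <= 1 -> -1 <= b <= 1 ->
  ~~ [&& (0 < i)%N, (0 < j)%N & (i + j < 4 * r k)%N] ->
  (exists i' j' : nat, [/\ i'%:Z = i%:Z + a, j'%:Z = j%:Z + b,
        (i' <= 4 * r k)%N, (j' <= 4 * r k)%N & c = tile (4 * r k) i' j']) \/
  ([|| i%:Z + a < 0, (4 * r k)%N%:Z < i%:Z + a, j%:Z + b < 0 |
          (4 * r k)%N%:Z < j%:Z + b] /\ ground c).
Proof.
move=> kmin cx ty a1 b1 nc; have [|[]|[co _]] := neighbour kmin cx ty a1 b1; auto.
by rewrite co in nc.
Qed.

(** No filler is called for in the core: a cell whose left and lower neighbours
    are both on the hypotenuse of a smaller square, or beyond it, belongs to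
    that square. *)
Lemma core_past_diag (x : T) (k i j c c' : nat) :
  (forall k', (k' < k)%N -> ~ covered k' x) -> covers k i j x ->
  (0 < i)%N -> (0 < j)%N -> (i + j < 4 * r k)%N ->
  tiled (mv (- 1) 0 x) c -> tiled (mv 0 (- 1) x) c' -> ~~ (past_diag c && past_diag c').
Proof.
move=> kmin cx i0 j0 ij ty ty'; apply/negP => /andP[h h'].
have low (a b : int) d : -1 <= a <= 1 -> -1 <= b <= 1 -> a <= 0 -> b <= 0 ->
    tiled (mv a b x) d -> past_diag d -> exists k' i' j' : nat,
    [/\ (k' < k)%N, covers k' i' j' (mv a b x) & past_diag (tile (4 * r k') i' j')].
  move=> a1 b1 a0 b0 td hd; have [] := neighbour kmin cx td a1 b1.
  - move=> [i' [j' [ei ej _ _ dE]]]; move: hd; rewrite dE (negPf (tile_past_diag _)) //; lia.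
  - by move=> [_ /ground_past_diag]; rewrite hd.
  - by move=> [_ [k' [i' [j' [kk cy _ dE]]]]]; exists k', i', j'; rewrite -dE.
have [||||k1 [i1 [j1 [kk1 c1 h1]]]] := low (- 1) 0 c _ _ _ _ ty h; [lia..|].
have [||||k2 [i2 [j2 [kk2 c2 h2]]]] := low 0 (- 1) c' _ _ _ _ ty' h'; [lia..|].
have [i14 j14 _] := c1; have [i24 j24 _] := c2.
have [lt|lt|kk] := ltngtP k1 k2.
- have c2' : covers k2 i2 j2 (mv 1 (- 1) (mv (- 1) 0 x)) by rewrite -mvD.
  have [||_ _ ij2] := covers_lower lt c1 c2'; [lia..|].
  by rewrite (negPf (tile_past_diag ij2)) in h2.
- have c1' : covers k1 i1 j1 (mv (- 1) 1 (mv 0 (- 1) x)) by rewrite -mvD.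
  have [||_ _ ij1] := covers_lower lt c2 c1'; [lia..|].
  by rewrite (negPf (tile_past_diag ij1)) in h1.
- subst k2; have c2' : covers k1 i2 j2 (mv 1 (- 1) (mv (- 1) 0 x)) by rewrite -mvD.
  have [||e e'] := covers_same c1 c2'; [lia..|].
  apply: (kmin k1 kk1); exists i2, j1.
  have -> : x = mv 1 0 (mv (- 1) 0 x) by rewrite -mvD mv0.
  by apply: covers_move c1 _ _ _ _; lia.
Qed.

(** In the core of its triangle a cell is ground and has only colours to check;
    off the core the neighbours are as in [frame_rule]. *)
Theorem tiled_rule (f : T -> nat) (x : T) :
  (forall a b : int, tiled (mv a b x) (f (mv a b x))) -> rule (fun a b => f (mv a b x)).
Proof.
move=> tf; have [k [i [j [kmin cx fx]]]] := tf 0 0.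
rewrite mv0 in kmin cx fx.
have r4 : (4 <= 4 * r k)%N by have := r_gt0 k; lia.
have [i4 j4 _] := cx.
set t := fun a b => f (mv a b x).
have t00 : t 0 0 = tile (4 * r k) i j by rewrite /t mv0.
have [/and3P[i0 j0 ij]|fr] := boolP [&& (0 < i)%N, (0 < j)%N & (i + j < 4 * r k)%N].
  have t0 : t 0 0 = odd i by rewrite t00 tile_core.
  have E := core_past_diag kmin cx i0 j0 ij (tf (- 1) 0) (tf 0 (- 1)).
  have gcol (a b : int) : 0 <= a <= 1 -> 0 <= b <= 1 -> ground (t a b) -> t a b = odd (absz (i%:Z + a)%R).
    move=> a1 b1 g; have [a2 b2] : -1 <= a <= 1 /\ -1 <= b <= 1 by lia.
    have [] := neighbour kmin cx (tf a b) a2 b2.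
    - move=> [i' [j' [ei ej _ _ dE]]]; move: g; rewrite /t dE => g.
      have [|i0' j0' ij'] := tile_ground _ g; first by lia.
      by rewrite tile_core //; congr (nat_of_bool (odd _)); lia.
    - by move=> [out _]; lia.
    - move=> [_ [k' [i' [j' [kk cy out dE]]]]]; move: g; rewrite /t dE => g.
      have [|i0' j0' ij'] := tile_ground _ g; first by have := r_gt0 k'; lia.
      by case: cy; lia.
  have gh : ground (t 1 0) -> (t 1 0 + odd i = 1)%N.
    by move/(gcol 1 0 isT isT) ->; rewrite (_ : absz _ = i.+1) /=; [case: odd|lia].
  have gv : ground (t 0 1) -> t 0 1 = odd i.
    by move/(gcol 0 1 isT isT) ->; rewrite (_ : absz _ = i) /=; [|lia].
  rewrite -/t /rule t0; move: E gh gv; rewrite -!/(t _ _).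
  case: (odd i) => /= /negPf -> gh gv; rewrite ?eqxx /=;
    by apply/andP; split; apply/implyP => [] h; rewrite ?(gh h) ?(gv h).
have {}N (a b : int) : -1 <= a <= 1 -> -1 <= b <= 1 ->
  (exists i' j' : nat, [/\ i'%:Z = i%:Z + a, j'%:Z = j%:Z + b,
        (i' <= 4 * r k)%N, (j' <= 4 * r k)%N & t a b = tile (4 * r k) i' j']) \/
  ([|| i%:Z + a < 0, (4 * r k)%N%:Z < i%:Z + a, j%:Z + b < 0 |
          (4 * r k)%N%:Z < j%:Z + b] /\ ground (t a b)).
  by move=> a1 b1; apply: frame_neighbour kmin cx (tf a b) a1 b1 fr.
move: (4 * r k)%N t00 N r4 i4 j4 fr => m t00 N r4 i4 j4 fr.
exact: frame_rule t00 N r4 i4 j4 fr.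
Qed.

End Scheme.

(** * The lattice Z^n and the topology of cylinders *)

Section Lattice.
Local Open Scope ring_scope.
Variable n : nat.
Local Notation G := 'rV[int]_n.

Definition norm (g : G) : nat := \max_(i < n) absz (g 0%R i).

Lemma norm_coord (g : G) i : (absz (g 0%R i) <= norm g)%N.
Proof. exact: (leq_bigmax i). Qed.

Lemma norm_le (g : G) m : (forall i, (absz (g 0%R i) <= m)%N) -> (norm g <= m)%N.
Proof. by move=> h; apply/bigmax_leqP => i _. Qed.

Lemma normD (g h : G) : (norm (g + h) <= norm g + norm h)%N.
Proof.
apply: norm_le => i; rewrite mxE.
apply: leq_trans (leq_add (norm_coord g i) (norm_coord h i)).
by move: (g _ i) (h _ i) => x y; lia.
Qed.

Lemma normN (g : G) : norm (- g) = norm g.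
Proof. by apply: eq_bigr => i _; rewrite mxE abszN. Qed.

Definition box (m : nat) : seq G :=
  [seq \row_i ((f i : nat)%:Z - m%:Z) | f : {ffun 'I_n -> 'I_(2 * m).+1}].

Lemma mem_box m (g : G) : (norm g <= m)%N -> g \in box m.
Proof.
move=> gm; apply/mapP; exists [ffun i => inord (absz (g 0%R i + m%:Z)%R)]; first by rewrite mem_enum.
apply/rowP => i; rewrite mxE ffunE; have := leq_trans (norm_coord g i) gm.
by move: (g _ i) => x xm; rewrite inordK; lia.
Qed.

(** The iterates of a point under a nonzero translation leave every finite set. *)
Lemma translate_fset (A : {fset G}) (a g : G) : a \in A ->
  (forall x, x \in A -> x + g \in A) -> g = 0.
Proof.
move=> aA Ag; pose m := \max_(x : A) norm (val x).
have Am x : x \in A -> (norm x <= m)%N by move=> xA; exact: (leq_bigmax [` xA]%fset).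
have iterA k : a + g *+ k \in A.
  by elim: k => [|k IH]; rewrite ?mulr0n ?addr0 // mulrSr addrA Ag.
apply/rowP => i; rewrite mxE; have := leq_trans (norm_coord _ i) (Am _ (iterA (2 * m).+1)).
have := leq_trans (norm_coord _ i) (Am _ aA); rewrite mxE mulmxnE -mulr_natr natz.
move: (a _ i) (g _ i) => x [[|k]|k] //; nia.
Qed.

Hypothesis hn : (2 <= n)%N.

Definition e1 : G := delta_mx 0 (Ordinal (ltnW hn)).
Definition e2 : G := delta_mx 0 (Ordinal hn).

Lemma emb_coord1 a b : (emb e1 e2 a b) 0 (Ordinal (ltnW hn)) = a.
Proof. by rewrite /emb !mxE -!scaler_int !mxE /=; lia. Qed.

Lemma emb_coord2 a b : (emb e1 e2 a b) 0 (Ordinal hn) = b.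
Proof. by rewrite /emb !mxE -!scaler_int !mxE /=; lia. Qed.

Lemma emb12_inj (a b : int) : emb e1 e2 a b = 0 -> a = 0 /\ b = 0.
Proof.
by move=> ab; have := emb_coord1 a b; have := emb_coord2 a b; rewrite ab !mxE.
Qed.

Lemma norm_emb a b : norm (emb e1 e2 a b) = maxn (absz a) (absz b).
Proof.
apply/eqP; rewrite eqn_leq; apply/andP; split; last first.
  have := norm_coord (emb e1 e2 a b); rewrite geq_max => le.
  by have := le (Ordinal hn); have := le (Ordinal (ltnW hn)); rewrite emb_coord1 emb_coord2 => -> ->.
apply: norm_le => i; have [->|i1] := eqVneq i (Ordinal (ltnW hn)).
  by rewrite emb_coord1 leq_maxl.
have [->|i2] := eqVneq i (Ordinal hn); first by rewrite emb_coord2 leq_maxr.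
by rewrite /emb !mxE -!scaler_int !mxE (negPf i1) (negPf i2) !andbF !mulr0 addr0.
Qed.

End Lattice.

Section Cylinders.
Local Open Scope classical_set_scope.
Variable G : choiceType.
Local Notation C := {ptws G -> bool}.

Lemma ptws_cylinder (x : C) (U : set C) : nbhs x U ->
  exists S : {fset G}, forall y : C, (forall d, d \in S -> y d = x d) -> U y.
Proof.
pose cyl (S : {fset G}) : set C := [set y | forall d, d \in S -> y d = x d].
pose F : set_system C := filter_from [set: {fset G}] cyl.
have FF : Filter F.
  apply: filter_from_filter; first by exists fset0.
  move=> S S' _ _; exists (S `|` S')%fset => // y yS.
  by split=> d dS; apply: yS; rewrite inE dS ?orbT.
have : F --> x.
  apply/cvg_sup => i A; rewrite nbhsE => -[B [[W oW <-] Wx] BA].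
  exists [fset i]%fset => // y yi; apply: BA; rewrite /= yi ?inE //.
by move=> Fx /Fx [S _ SU]; exists S => y yS; apply: SU.
Qed.

Variable A : set C.

Lemma open_coord (d : G) (b : bool) : open [set x : set_type A | (val x : C) d = b].
Proof.
have c : continuous (fun x : set_type A => (val x : C) d).
  move=> x; apply: (@continuous_comp _ _ _ (set_val : set_type A -> C) (fun y : C => y d)).
    exact: initial_continuous.
  exact: (@proj_continuous G (fun=> bool) d).
by apply: (open_comp (D := [set b])) => [x _|]; [exact: c | exact: discrete_open].
Qed.

Lemma open_cylinder (S : seq G) (p : G -> G) (q : G -> bool) :
  open [set x : set_type A | all (fun d => (val x : C) (p d) == q d) S].
Proof.
elim: S => [|d S IH]; first by rewrite (_ : [set _ | _] = setT); [exact: openT | apply/seteqP].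
rewrite (_ : [set _ | _] = [set x : set_type A | (val x : C) (p d) = q d] `&`
    [set x : set_type A | all (fun d => (val x : C) (p d) == q d) S]).
  by apply: openI => //; apply: open_coord.
apply/seteqP; split => x /=; first by move=> /andP[/eqP].
by move=> [/eqP -> ->].
Qed.

Lemma closed_cylinder (S : seq G) (p : G -> G) (q : G -> bool) :
  closed [set x : set_type A | all (fun d => (val x : C) (p d) == q d) S].
Proof.
elim: S => [|d S IH]; first by rewrite (_ : [set _ | _] = setT); [exact: closedT | apply/seteqP].
rewrite (_ : [set _ | _] = ~` [set x : set_type A | (val x : C) (p d) = ~~ q d] `&`
    [set x : set_type A | all (fun d => (val x : C) (p d) == q d) S]).
  by apply: closedI => //; apply: open_closedC; apply: open_coord.
apply/seteqP; split => x /=.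
  by move=> /andP[/eqP -> ->]; split=> //; case: (q d).
by move=> [e ->]; rewrite andbT; move: e; case: (q d); case: (_ (p d)).
Qed.

Lemma set_type_cylinder (x : set_type A) (U : set (set_type A)) : nbhs x U ->
  exists S : {fset G}, forall y : set_type A,
    (forall d, d \in S -> (val y : C) d = (val x : C) d) -> U y.
Proof.
rewrite nbhsE => -[B [[W oW <-] Wx] BU].
have [S SW] := ptws_cylinder (open_nbhs_nbhs (conj oW Wx)).
by exists S => y yS; apply: BU; apply: SW.
Qed.

End Cylinders.

(** * A calculus of total recursive functions *)

Section Calculus.
Local Open Scope nat_scope.

(** [F] depends on its environment through finitely many entries, passed as a
    tuple; this form makes composition stable under change of arity. *)
Definition total_rec k (F : (nat -> nat) -> nat) : Prop :=
  exists e : recfun k, forall v : k.-tuple nat, computes e v (F (nth 0 v)).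

Lemma rec_var k i : i < k -> total_rec k (fun s => s i).
Proof. by move=> ik; exists (RProj (Ordinal ik)) => v /=; rewrite (tnth_nth 0). Qed.

(** Every function built in this part takes an environment [s], so that a total
    recursive function is recognized from the shape of its body: each operation
    below is closed under substitution. *)
Lemma rec_comp m k F (g : nat -> (nat -> nat) -> nat) : total_rec m F ->
  (forall i, i < m -> total_rec k (g i)) ->
  total_rec k (fun s => F (nth 0 (mkseq (g^~ s) m))).
Proof.
move=> [e eF] cg.
have [d dP] : exists d : 'I_m -> recfun k,
    forall i v, computes (d i) v (g i (nth 0 v)).
  have [d dP] := fin_all_exists (fun i : 'I_m => cg i (ltn_ord i)).
  by exists d.
exists (RComp e d) => v /=; exists [tuple of mkseq (g^~ (nth 0 v)) m]; split => //.
by move=> i; rewrite (tnth_nth 0) /= nth_mkseq.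
Qed.

Lemma rec_const k c : total_rec k (fun=> c).
Proof.
elim: c => [|c [e eP]]; first by exists (RZero k).
exists (RComp RSucc (fun _ : 'I_1 => e)) => v /=.
by exists [tuple c]; split => // i; rewrite (tnth_nth 0) ord1.
Qed.

Lemma rec_app1 k (h : nat -> nat) F : total_rec 1 (fun s => h (s 0)) ->
  total_rec k F -> total_rec k (fun s => h (F s)).
Proof. by move=> ch cF; apply: (rec_comp (g := fun=> F) ch). Qed.

Lemma rec_app2 k (h : nat -> nat -> nat) F G : total_rec 2 (fun s => h (s 0) (s 1)) ->
  total_rec k F -> total_rec k G -> total_rec k (fun s => h (F s) (G s)).
Proof.
move=> ch cF cG; apply: (rec_comp (g := fun i => if i is 0 then F else G) ch).
by case.
Qed.

Fixpoint prec (f : (nat -> nat) -> nat) (g : nat -> nat -> (nat -> nat) -> nat)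
    (n : nat) (s : nat -> nat) : nat :=
  if n is p.+1 then g p (prec f g p s) s else f s.

Lemma rec_prec k f g N : total_rec k f ->
  total_rec k.+2 (fun s => g (s 0) (s 1) (fun i => s i.+2)) ->
  total_rec k N -> total_rec k (fun s => prec f g (N s) s).
Proof.
move=> [a aP] [b bP] cN.
have c : total_rec k.+1 (fun s => prec f g (s 0) (fun i => s i.+1)).
  exists (RPrec a b) => v /=.
  have -> : thead v = nth 0 v 0 by rewrite /thead (tnth_nth 0).
  have E : (fun i => nth 0 v i.+1) = nth 0 (behead v).
    by apply/funext => i; rewrite nth_behead.
  rewrite E; elim: (nth 0 v 0) => [|n IH] /=; first exact: aP.
  by exists (prec f g n (nth 0 (behead v))); split => //; apply: bP.
pose h i : (nat -> nat) -> nat := if i is j.+1 then (fun s => s j) else N.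
have [e eP] : total_rec k (fun s => prec f g
    (nth 0 (mkseq (h^~ s) k.+1) 0) (fun i => nth 0 (mkseq (h^~ s) k.+1) i.+1)).
  by apply: (rec_comp (g := h) c) => -[|i] ik; [exact: cN|apply: rec_var].
exists e => v; have := eP v; congr (computes e v (prec f g _ _)).
apply/funext => i; have [ik|ik] := ltnP i k; first by rewrite nth_mkseq.
by rewrite !nth_default ?size_mkseq ?size_tuple.
Qed.

Lemma rec_min k (P : nat -> (nat -> nat) -> bool) (ex : forall s, exists n, P n s) :
  total_rec k.+1 (fun s => ~~ P (s 0) (fun i => s i.+1)) ->
  total_rec k (fun s => ex_minn (ex s)).
Proof.
move=> [e eP]; exists (RMin e) => v /=; case: ex_minnP => m Pm mmin.
have E n : (fun i => nth 0 [tuple of n :: v] i.+1) = nth 0 v by [].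
split; first by have := eP [tuple of m :: v]; rewrite /= Pm.
move=> j jm; exists 0; have := eP [tuple of j :: v]; rewrite /=.
by case: (P j _) (mmin j) => // /(_ isT); rewrite leqNgt jm.
Qed.

Lemma rec_iter k h F N : total_rec 1 (fun s => h (s 0)) -> total_rec k F ->
  total_rec k N -> total_rec k (fun s => iter (N s) h (F s)).
Proof.
move=> ch cF cN.
have [e eP] : total_rec k (fun s => prec F (fun _ z _ => h z) (N s) s).
  by apply: rec_prec => //; apply: (rec_app1 ch); apply: rec_var.
exists e => v; have := eP v; congr (computes e v).
by elim: (N _) => //= n ->.
Qed.

Lemma rec_succ k F : total_rec k F -> total_rec k (fun s => (F s).+1).
Proof.
move=> cF; apply: (rec_app1 (h := succn)) cF; exists RSucc => v.
by rewrite /= /thead (tnth_nth 0).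
Qed.

Lemma eq_rec k F F' : F =1 F' -> total_rec k F -> total_rec k F'.
Proof. by move=> /funext ->. Qed.

Lemma rec_add k F F' : total_rec k F -> total_rec k F' ->
  total_rec k (fun s => F s + F' s).
Proof.
move=> cF cF'; apply: (eq_rec (F := fun s => iter (F s) succn (F' s))).
  by move=> s; rewrite iter_succn addnC.
by apply: rec_iter => //; apply: rec_succ; apply: rec_var.
Qed.

Lemma rec_mull k c F : total_rec k F -> total_rec k (fun s => c * F s).
Proof.
move=> cF; elim: c => [|c IH]; first exact: rec_const.
by apply: (eq_rec (F := fun s => F s + c * F s)) => //; apply: rec_add.
Qed.

Lemma rec_shift k F : total_rec k F -> total_rec k.+1 (fun s => F (fun i => s i.+1)).
Proof.
move=> cF; have [|e eP] := @rec_comp k k.+1 F (fun i s => s i.+1) cF.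
  by move=> i ik; apply: rec_var.
exists e => v; have := eP v; congr (computes e v (F _)).
apply/funext => i; have [ik|ik] := ltnP i k; first by rewrite nth_mkseq.
by rewrite !nth_default ?size_mkseq ?size_tuple.
Qed.

Lemma rec_if k (B : _ -> bool) F F' : total_rec k B -> total_rec k F ->
  total_rec k F' -> total_rec k (fun s => if B s then F s else F' s).
Proof.
move=> cB cF cF'; apply: (eq_rec (F := fun s => prec F' (fun _ _ s => F s) (B s) s)).
  by move=> s; case: (B s).
by apply: rec_prec => //; apply: (rec_shift (F := fun s => F (fun i => s i.+1))); apply: rec_shift.
Qed.

Lemma rec_pred k F : total_rec k F -> total_rec k (fun s => (F s).-1).
Proof.
move=> cF; apply: (eq_rec (F := fun s => prec (fun=> 0) (fun n _ _ => n) (F s) s)).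
  by move=> s; case: (F s).
by apply: rec_prec => //; [apply: rec_const | apply: rec_var].
Qed.

Lemma rec_sub k F F' : total_rec k F -> total_rec k F' ->
  total_rec k (fun s => F s - F' s).
Proof.
move=> cF cF'; apply: (eq_rec (F := fun s => iter (F' s) predn (F s))).
  by move=> s; rewrite iter_predn.
by apply: rec_iter => //; apply: rec_pred; apply: rec_var.
Qed.

Lemma rec_eq0 k F : total_rec k F -> total_rec k (fun s => F s == 0).
Proof.
move=> cF; apply: (eq_rec (F := fun s => 1 - F s)); last by apply: rec_sub => //; apply: rec_const.
by move=> s; case: (F s).
Qed.

Lemma rec_leq k F F' : total_rec k F -> total_rec k F' ->
  total_rec k (fun s => F s <= F' s).
Proof. by move=> cF cF'; apply: (@rec_eq0 k (fun s => F s - F' s)); apply: rec_sub. Qed.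

Lemma rec_and k (B B' : _ -> bool) : total_rec k B -> total_rec k B' ->
  total_rec k (fun s => B s && B' s).
Proof.
move=> cB cB'; apply: (eq_rec (F := fun s => if B s then nat_of_bool (B' s) else 0)).
  by move=> s; case: (B s).
by apply: rec_if => //; apply: rec_const.
Qed.

Lemma rec_not k (B : _ -> bool) : total_rec k B -> total_rec k (fun s => ~~ B s).
Proof.
move=> cB; apply: (eq_rec (F := fun s => nat_of_bool (nat_of_bool (B s) == 0))).
  by move=> s; case: (B s).
exact: rec_eq0.
Qed.

Lemma rec_or k (B B' : _ -> bool) : total_rec k B -> total_rec k B' ->
  total_rec k (fun s => B s || B' s).
Proof.
move=> cB cB'; apply: (eq_rec (F := fun s => nat_of_bool (~~ (~~ B s && ~~ B' s)))).
  by move=> s; rewrite negb_and !negbK.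
by apply: rec_not; apply: rec_and; apply: rec_not.
Qed.

Lemma rec_imply k (B B' : _ -> bool) : total_rec k B -> total_rec k B' ->
  total_rec k (fun s => B s ==> B' s).
Proof.
move=> cB cB'; apply: (eq_rec (F := fun s => nat_of_bool (~~ B s || B' s))).
  by move=> s; rewrite implybE.
by apply: rec_or => //; apply: rec_not.
Qed.

Lemma rec_eq k F F' : total_rec k F -> total_rec k F' ->
  total_rec k (fun s => F s == F' s).
Proof.
move=> cF cF'; apply: (eq_rec (F := fun s => nat_of_bool ((F s <= F' s) && (F' s <= F s)))).
  by move=> s; rewrite eqn_leq.
by apply: rec_and; apply: rec_leq.
Qed.

Lemma rec_odd k F : total_rec k F -> total_rec k (fun s => odd (F s)).
Proof.
move=> cF; apply: (eq_rec (F := fun s => iter (F s) (fun n => nat_of_bool (n == 0)) 0)).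
  by move=> s; elim: (F s) => //= n ->; case: odd.
apply: rec_iter => //; last exact: rec_const.
by apply: rec_eq0; apply: rec_var.
Qed.

Lemma rec_all k (B : nat -> (nat -> nat) -> bool) N :
  total_rec k.+1 (fun s => B (s 0) (fun i => s i.+1)) -> total_rec k N ->
  total_rec k (fun s => all (B^~ s) (iota 0 (N s))).
Proof.
move=> [e eP] cN.
apply: (eq_rec (F := fun s => prec (fun=> 1) (fun n z s => nat_of_bool ((z != 0) && B n s)) (N s) s)).
  move=> s; elim: (N s) => // n IH.
  by rewrite -[in RHS](addn1 n) iotaD all_cat /= IH add0n andbT; case: all.
apply: rec_prec => //; first exact: rec_const.
apply: rec_and; first by apply: rec_not; apply: rec_eq0; apply: rec_var.
have c1 : total_rec k.+1 (fun s => B (s 0) (fun i => s i.+1)) by exists e.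
have := @rec_comp k.+1 k.+2 _ (fun i s => if i is j.+1 then s j.+2 else s 0) c1.
case=> [[|i] ik|d dP]; try by apply: rec_var.
exists d => v; have := dP v; congr (computes d v (nat_of_bool (B _ _))).
apply/funext => i; have [ik|ik] := ltnP i k; first by rewrite nth_mkseq.
by rewrite [LHS]nth_default ?[RHS]nth_default ?size_mkseq ?size_tuple.
Qed.

(** A program for a function on X extends to a total one by first deciding X: the
    recursion on the truth value runs the step function, which may diverge off
    X, only when the test succeeds. *)
Lemma rec_guard (X : pred nat) (f : {x : nat | X x} -> nat) :
  computable_set X -> computable_on f ->
  exists2 h : nat -> nat, total_rec 1 (fun s => h (s 0)) &
    forall x, h (val x) = f x.
Proof.
move=> [eX XP] [e eP].
pose h x := if insub x is Some y then f y else 0.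
exists h; last by move=> x; rewrite /h valK.
pose p : recfun 2 := RPrec (RZero 1) (RComp e (fun _ : 'I_1 => @RProj 3 (@Ordinal 3 2 isT))).
exists (RComp p (fun i : 'I_2 => if i == ord0 then eX else @RProj 1 ord0)) => v /=.
have -> : v = [tuple nth 0 v 0].
  by apply: val_inj; case: v => -[|x [|y s]].
move: (nth 0 v 0) => x /=.
exists [tuple (X x : nat); x]; split.
  move=> i; case: eqP => [->|ne]; first by rewrite (tnth_nth 0) /=; apply: XP.
  have -> : i = @Ordinal 2 1 isT by apply: val_inj; case: i ne => -[|[|i]] ? ne //; case: ne; apply: val_inj.
  by rewrite !(tnth_nth 0).
rewrite /thead (tnth_nth 0) /= /h; case: insubP => [y Xy ey|/negPf ->] //.
rewrite Xy; exists 0; split => //; exists [tuple x]; split; last by rewrite -ey; exact: eP.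
by move=> i; rewrite ord1 !(tnth_nth 0).
Qed.

End Calculus.

(** * The program that labels a computable free action *)

Ltac total_rec := repeat match goal with
  | |- total_rec _ (fun s => s _) => exact: rec_var
  | |- total_rec _ (fun s => ?c) => exact: rec_const
  | |- total_rec _ (fun s => addn _ _) => apply: rec_add
  | |- total_rec _ (fun s => S _) => apply: rec_succ
  | |- total_rec _ (fun s => muln ?c _) => apply: rec_mull
  | |- total_rec _ (fun s => nat_of_bool (leq _ _)) => apply: rec_leq
  | |- total_rec _ (fun s => nat_of_bool (andb _ _)) => apply: rec_and
  | |- total_rec _ (fun s => nat_of_bool (orb _ _)) => apply: rec_or
  | |- total_rec _ (fun s => nat_of_bool (implb _ _)) => apply: rec_imply
  | |- total_rec _ (fun s => nat_of_bool (negb _)) => apply: rec_not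
  | |- total_rec _ (fun s => nat_of_bool (odd _)) => apply: rec_odd
  | |- total_rec _ (fun s => nat_of_bool (eq_op _ _)) => apply: rec_eq
  | |- total_rec _ (fun s => nat_of_bool (all _ _)) => apply: rec_all
  | |- total_rec _ (fun s => if _ then _ else _) => apply: rec_if
  end.

(** [X] is the underlying computable set, on which [A1] and [A2] are the moves by
    e1 and e2.  Moves by negative amounts are avoided: two points are compared
    after moving each of them by nonnegative amounts. *)
Section Program.
Local Open Scope nat_scope.
Variables (X : pred nat) (A1 A2 : nat -> nat).
Hypothesis rec_X : total_rec 1 (fun s => X (s 0)).
Hypothesis rec_A1 : total_rec 1 (fun s => A1 (s 0)).
Hypothesis rec_A2 : total_rec 1 (fun s => A2 (s 0)).

Definition walk_to (i j x : nat) : nat := iter i A1 (iter j A2 x).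

Lemma rec_walk_to k F F' H : total_rec k F -> total_rec k F' -> total_rec k H ->
  total_rec k (fun s => walk_to (F s) (F' s) (H s)).
Proof. by move=> cF cF' cH; do 2!apply: rec_iter => //. Qed.

Lemma rec_member k F : total_rec k F -> total_rec k (fun s => X (F s)).
Proof. by apply: (rec_app1 (h := fun n => nat_of_bool (X n))). Qed.

(** [clear_radius r k R] tests that [r] is an admissible radius for the square of
    centre [k] when the centres j < k have radii at most [R]: such a j is either
    so close that its square is in the core of the triangle, or farther than
    the horizon.  The equation says that j is the translate of k by
    (a - horizon, b - horizon). *)
Definition horizon (r R : nat) : nat := 3 * r + 1 + 3 * R.

Definition clear_radius (r k R : nat) : bool :=
  (0 < r) && (X k ==> all (fun j => X j ==>
    all (fun a => all (fun b =>
      (walk_to a b k == walk_to (horizon r R) (horizon r R) j) ==>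
      [&& a + 3 * R + 1 < r + horizon r R, horizon r R + 3 * R + 1 < r + a,
          b + 3 * R + 1 < r + horizon r R & horizon r R + 3 * R + 1 < r + b])
      (iota 0 (2 * horizon r R).+1)) (iota 0 (2 * horizon r R).+1)) (iota 0 k)).

Lemma rec_clear_radius : total_rec 3 (fun s => clear_radius (s 0) (s 1) (s 2)).
Proof.
rewrite /clear_radius /horizon.
by repeat first [apply: rec_member | apply: rec_walk_to | progress total_rec].
Qed.

Hypothesis clear_ex : forall k R, exists r, clear_radius r k R.

Definition radius_after (k R : nat) : nat := ex_minn (clear_ex k R).

(** The sum of the earlier radii bounds each of them, and unlike their maximum it
    comes out of a plain primitive recursion. *)
Fixpoint total_radius (k : nat) : nat :=
  if k is j.+1 then total_radius j + radius_after j (total_radius j) else 0.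

Definition radius (k : nat) : nat := radius_after k (total_radius k).

Lemma rec_radius_after k F F' : total_rec k F -> total_rec k F' ->
  total_rec k (fun s => radius_after (F s) (F' s)).
Proof.
apply: rec_app2; apply: (rec_min (P := fun r s => clear_radius r (s 0) (s 1))).
by apply: rec_not; apply: rec_clear_radius.
Qed.

Lemma rec_radius k F : total_rec k F -> total_rec k (fun s => radius (F s)).
Proof.
move=> cF; apply: rec_radius_after => //.
apply: (eq_rec (F := fun s => prec (fun=> 0) (fun j z _ => z + radius_after j z) (F s) s)).
  by move=> s; elim: (F s) => //= n ->.
by apply: rec_prec; total_rec => //; apply: rec_radius_after; total_rec.
Qed.

Lemma radius_gt0 k : 0 < radius k.
Proof. by rewrite /radius /radius_after; case: ex_minnP => m /andP[]. Qed.

Lemma total_radius_le j k : j < k -> radius j <= total_radius k.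
Proof.
elim: k => // k IH; rewrite ltnS leq_eqVlt => /orP[/eqP ->|/IH le] /=.
  exact: leq_addl.
exact: leq_trans le (leq_addr _ _).
Qed.

Lemma radius_clear j k a b : X k -> X j -> j < k ->
  a <= 2 * horizon (radius k) (total_radius k) ->
  b <= 2 * horizon (radius k) (total_radius k) ->
  walk_to a b k = walk_to (horizon (radius k) (total_radius k))
                          (horizon (radius k) (total_radius k)) j ->
  let N := horizon (radius k) (total_radius k) in let R := total_radius k in
  [&& a + 3 * R + 1 < radius k + N, N + 3 * R + 1 < radius k + a,
      b + 3 * R + 1 < radius k + N & N + 3 * R + 1 < radius k + b].
Proof.
have : clear_radius (radius k) k (total_radius k).
  by rewrite {1}/radius /radius_after; case: ex_minnP.
move: (radius k) (total_radius k) => r R /andP[_ /implyP h] Xk Xj jk aN bN e.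
have in0 (m n : nat) : m < n -> m \in iota 0 n by rewrite mem_iota.
have hj := implyP (allP (h Xk) j (in0 _ _ jk)) Xj.
have hb := allP (allP hj a (in0 _ _ _)) b (in0 _ _ _).
by apply: (implyP (hb _ _)); rewrite ?ltnS ?e.
Qed.

Lemma iota_existsP (p : pred nat) n :
  reflect (exists2 j, j < n & p j) (~~ all (fun j => ~~ p j) (iota 0 n)).
Proof.
rewrite -(has_predC (fun j => ~~ p j)); apply: (iffP hasP) => -[j].
  by rewrite mem_iota /= negbK; exists j.
by exists j; rewrite /= ?negbK // mem_iota.
Qed.

(** The label of [x] is found by searching for the first square over [x] and for
    the position of [x] in it; off [X] the searches are made to stop at once, so
    that they are total. *)
Definition at_pos (k i j x : nat) : bool :=
  walk_to i j k == walk_to (radius k) (radius k) x.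

Definition in_square (k x : nat) : bool :=
  X k && ~~ all (fun i => all (fun j => ~~ at_pos k i j x) (iota 0 (4 * radius k).+1))
                (iota 0 (4 * radius k).+1).

Lemma in_squareP k x : reflect (X k /\ exists i j, [/\ i <= 4 * radius k,
  j <= 4 * radius k & at_pos k i j x]) (in_square k x).
Proof.
rewrite /in_square; apply: (iffP andP) => -[Xk h]; split=> //.
  rewrite -(eq_all (fun i => negbK _)) in h.
  have /iota_existsP[i im /iota_existsP[j jm p]] := h.
  by exists i, j; split.
have [i [j [im jm p]]] := h.
rewrite -(eq_all (fun i => negbK _)); apply/iota_existsP; exists i => //.
by apply/iota_existsP; exists j.
Qed.

Lemma level_ex x : exists k, ~~ X x || in_square k x.
Proof.
exists x; case Xx : (X x) => //=; apply/in_squareP; split=> //.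
by exists (radius x), (radius x); rewrite /at_pos eqxx; split=> //; lia.
Qed.

Definition level x : nat := ex_minn (level_ex x).

Definition has_col (i x : nat) : bool :=
  ~~ all (fun j => ~~ at_pos (level x) i j x) (iota 0 (4 * radius (level x)).+1).

Lemma levelP x : X x -> in_square (level x) x /\
  forall k, in_square k x -> level x <= k.
Proof.
move=> Xx; rewrite /level; case: ex_minnP => m; rewrite Xx /= => sq mmin.
by split=> // k sqk; apply: mmin.
Qed.

Lemma col_ex x : exists i, ~~ X x || has_col i x.
Proof.
case Xx : (X x) => /=; last by exists 0.
have [/in_squareP[_ [i [j [im jm p]]]] _] := levelP Xx.
by exists i; apply/iota_existsP; exists j.
Qed.

Definition col x : nat := ex_minn (col_ex x).

Lemma row_ex x : exists j, ~~ X x || at_pos (level x) (col x) j x.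
Proof.
case Xx : (X x) => /=; last by exists 0.
rewrite /col; case: ex_minnP => i; rewrite Xx /= => /iota_existsP[j _ p] _.
by exists j.
Qed.

Definition row x : nat := ex_minn (row_ex x).

Lemma positionP x : X x ->
  [/\ col x <= 4 * radius (level x), row x <= 4 * radius (level x)
    & at_pos (level x) (col x) (row x) x].
Proof.
move=> Xx; have [/in_squareP[_ [i [j [im jm p]]]] _] := levelP Xx.
have colm : col x <= 4 * radius (level x) /\ has_col (col x) x.
  rewrite /col; case: ex_minnP => m; rewrite Xx /= => hm mmin; split=> //.
  by apply: leq_trans im; apply: mmin; apply/iota_existsP; exists j.
case: colm => colm /iota_existsP[j' jm' p'].
split=> //; rewrite /row; case: ex_minnP => m; rewrite Xx //= => pm mmin.
by have := mmin _ p'; lia.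
Qed.

Definition program_label x : nat :=
  tile (4 * radius (level x)) (col x) (row x).

Lemma rec_at_pos n F1 F2 F3 F4 : total_rec n F1 -> total_rec n F2 ->
  total_rec n F3 -> total_rec n F4 ->
  total_rec n (fun s => at_pos (F1 s) (F2 s) (F3 s) (F4 s)).
Proof.
move=> c1 c2 c3 c4; apply: rec_eq; apply: rec_walk_to => //; exact: rec_radius.
Qed.

Lemma rec_level n F : total_rec n F -> total_rec n (fun s => level (F s)).
Proof.
apply: rec_app1; apply: (rec_min (P := fun k s => ~~ X (s 0) || in_square k (s 0))).
rewrite /in_square.
by repeat first [apply: rec_member | apply: rec_at_pos | apply: rec_radius | progress total_rec].
Qed.

Lemma rec_col n F : total_rec n F -> total_rec n (fun s => col (F s)).
Proof.
apply: rec_app1; apply: (rec_min (P := fun i s => ~~ X (s 0) || has_col i (s 0))).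
rewrite /has_col.
by repeat first [apply: rec_member | apply: rec_at_pos | apply: rec_radius | apply: rec_level | progress total_rec].
Qed.

Lemma rec_row n F : total_rec n F -> total_rec n (fun s => row (F s)).
Proof.
apply: rec_app1.
apply: (rec_min (P := fun j s => ~~ X (s 0) || at_pos (level (s 0)) (col (s 0)) j (s 0))).
by repeat first [apply: rec_member | apply: rec_at_pos | apply: rec_radius | apply: rec_level | apply: rec_col | progress total_rec].
Qed.

Lemma rec_program_label : total_rec 1 (fun s => program_label (s 0)).
Proof.
rewrite /program_label /tile.
by repeat first [apply: rec_radius | apply: rec_level | apply: rec_col | apply: rec_row | progress total_rec].
Qed.

End Program.

Local Open Scope ring_scope.

Lemma tile_lt10 m i j : (tile m i j < 10)%N.
Proof. by rewrite /tile; do ![case: ifP => //] => *; case: odd. Qed.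

(** Each point is the only centre of its level, and it is covered by its own
    square, so that every point has a label. *)
Theorem triangle_COMPUTABLE (G : zmodType) (u v : G) :
  (forall a b : int, emb u v a b = 0 -> a = 0 /\ b = 0) ->
  COMPUTABLE (triangle_LCL u v).
Proof.
move=> emb_inj X act Xc act_act act_free act_c.
have rec_X : total_rec 1 (fun s => X (s 0)).
  have [e eP] := Xc; exists e => w; have := eP (nth 0%N w 0).
  by congr computes; apply: val_inj; case: w => -[|x [|y s]].
have [A1 rec_A1 A1E] := rec_guard Xc (act_c (emb u v 1 0)).
have [A2 rec_A2 A2E] := rec_guard Xc (act_c (emb u v 0 1)).
pose T := {x : nat | X x}.
have mvS1 (i j : int) (x : T) : act (emb u v (1 + i) j) x = act (emb u v 1 0) (act (emb u v i j) x).
  by rewrite -(mvD u v act_act) add0r.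
have walkE (i j : nat) (x : T) : walk_to A1 A2 i j (val x) = val (act (emb u v i j) x).
  rewrite /walk_to; elim: i => [|i IH] /=; last by rewrite IH A1E intS mvS1.
  elim: j => [|j IH] /=; first by rewrite (mv0 u v act_act).
  by rewrite IH A2E intS -(mvD u v act_act) addr0.
have clear_ex k R : exists r, clear_radius X A1 A2 r k R.
  have [Xk|nXk] := boolP (X k); last by exists 1%N; rewrite /clear_radius (negPf nXk).
  pose s : T := exist _ k Xk.
  (* all displacements from k to earlier points of its orbit are bounded *)
  have [B BP] : exists B : nat, forall j (Xj : X j) (a b : int), (j < k)%N ->
      act (emb u v a b) s = exist _ j Xj -> (absz a <= B)%N /\ (absz b <= B)%N.
    elim: {1}k => [|m [B BP]]; first by exists 0%N.
    have [[Xm [a [b ab]]]|no] := pselect (exists (Xm : X m) (a b : int),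
        act (emb u v a b) s = exist _ m Xm); last first.
      exists B => j Xj a b; rewrite ltnS leq_eqVlt => /orP[/eqP jm|jm]; last exact: BP.
      by subst j => e; case: no; exists Xj, a, b.
    exists (B + absz a + absz b)%N => j Xj a' b'.
    rewrite ltnS leq_eqVlt => /orP[/eqP jm|jm] e; last by have := BP _ _ _ _ jm e; lia.
    subst j; rewrite (bool_irrelevance Xj Xm) -ab in e.
    by have [-> ->] := mv_inj emb_inj act_act act_free e; lia.
  exists (B + 3 * R + 2)%N; apply/andP; split; first by lia.
  rewrite Xk implyTb; apply/allP => j; rewrite mem_iota add0n leq0n => jk.
  apply/implyP => Xj; apply/allP => a _; apply/allP => b _; apply/implyP => /eqP.
  rewrite (walkE a b s) (walkE _ _ (exist _ j Xj : T)) => /val_inj e.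
  set N := horizon _ _ in e *.
  have := BP j Xj (a%:Z - N%:Z) (b%:Z - N%:Z) jk.
  have -> : act (emb u v (a%:Z - N%:Z) (b%:Z - N%:Z)) s = exist _ j Xj.
    by rewrite ![_ - N%:Z]addrC (mvD u v act_act) e -(mvD u v act_act) !addNr (mv0 u v act_act).
  by move=> /(_ erefl); lia.
pose r := radius clear_ex; pose label x := program_label clear_ex x.
pose V k (x : T) := val x = k.
have r_gt0 : forall k, (0 < r k)%N by move=> k; apply: radius_gt0.
have same_level k x a b : V k x -> V k (act (emb u v a b) x) ->
    far a b (4 * r k + 1)%N%:Z \/ (a = 0 /\ b = 0).
  move=> <- /val_inj; rewrite -[x in _ = x](mv0 u v act_act).
  by move=> /(mv_inj emb_inj act_act act_free); right.
have lower_level j k x a b : (j < k)%N -> V k x -> V j (act (emb u v a b) x) ->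
    near a b ((r k)%:Z - 1 - 3 * (r j)%:Z) \/ far a b (3 * r k + 1 + 3 * r j)%N%:Z.
  move=> jk xk xj; have := total_radius_le clear_ex jk; rewrite -/(r j) => rj.
  pose R := total_radius clear_ex k; pose N := horizon (r k) R.
  have NE : N = (3 * r k + 1 + 3 * R)%N by [].
  have [out|/norP[a1 /norP[a2 /norP[b1 b2]]]] :=
    boolP [|| N%:Z < a, N%:Z < - a, N%:Z < b | N%:Z < - b].
    by right; rewrite /far; lia.
  left; have := @radius_clear X A1 A2 clear_ex j k (absz (a + N%:Z)%R) (absz (b + N%:Z)%R).
  rewrite -xk -xj (valP x) (valP (act _ x)) xk xj -/R -/(r k) -/N => /(_ isT isT jk).
  have e : walk_to A1 A2 (absz (a + N%:Z)%R) (absz (b + N%:Z)%R) k = walk_to A1 A2 N N j.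
    rewrite -xk -xj !walkE -(mvD u v act_act) ![N%:Z + _]addrC.
    by congr (val (act (emb u v _ _) _)); lia.
  by move=> /(_ _ _ e); rewrite /near; lia.
have coversE k i j (x : T) : covers u v act r V k i j x <->
    [/\ (i <= 4 * r k)%N, (j <= 4 * r k)%N & X k /\ at_pos clear_ex k i j (val x)].
  split=> -[im jm]; last first.
    move=> [Xk /eqP]; rewrite (walkE _ _ (exist _ k Xk : T)) walkE.
    by move=> /val_inj e; split=> //; exists (exist _ k Xk).
  move=> [s sk e]; split=> //; split; first by rewrite -sk; apply: valP.
  by apply/eqP; rewrite -[in LHS]sk !walkE e.
have tiledP (x : T) : tiled u v act r V x (label (val x)).
  have [sq sqmin] := levelP clear_ex (valP x).
  have [cm rm p] := positionP clear_ex (valP x).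
  exists (level clear_ex (val x)), (col clear_ex (val x)), (row clear_ex (val x)).
  split=> //; last by apply/coversE; split=> //; split=> //; case/in_squareP: sq.
  move=> k kl [i [j /coversE[im jm [Xk pk]]]].
  have : (level clear_ex (val x) <= k)%N.
    by apply: sqmin; apply/in_squareP; split=> //; exists i, j.
  by rewrite leqNgt kl.
pose f (x : T) : 'I_10 := Ordinal (tile_lt10 (4 * r (level clear_ex (val x)))
  (col clear_ex (val x)) (row clear_ex (val x))).
exists f; split.
  apply/triangle_solutionP => x.
  have := tiled_rule act_act r_gt0 same_level lower_level
    (f := fun y => label (val y)) (x := x).
  by apply => a b; apply: tiledP.
have [e eP] := rec_program_label rec_X rec_A1 rec_A2 clear_ex.
exists e => x; rewrite enum_rank_ord /=.
exact: (eP [tuple val x]).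
Qed.

(** * A Baire measurable solution *)

Local Open Scope classical_set_scope.
Lemma free_shift_action (G : zmodType) (S : Type) : is_action (@free_shift G S).
Proof.
by split=> [x|g h x]; apply: val_inj; [exact: shift0 | exact: shiftD].
Qed.

Lemma free_shift_free (G : zmodType) (S : Type) : is_free (@free_shift G S).
Proof. by move=> g x g0 /(congr1 val) /=; have /set_mem := valP x; apply. Qed.

(** A solution by ground colours only, built orbit by orbit from a choice of
    origins; it is used on a meagre set. *)
Lemma exists_parity (G : zmodType) (u v : G) (T : Type) (act : G -> T -> T) :
  (forall a b : int, emb u v a b = 0%R -> a = 0%R /\ b = 0%R) ->
  is_action act -> is_free act ->
  exists p : T -> bool, forall x a b, p (act (emb u v a b) x) = p x (+) odd (absz a).
Proof.
move=> emb_inj aP fP; pose orb x : set T := [set y | exists a b, y = act (emb u v a b) x].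
have [rep repP] : exists rep : set T -> option T,
    forall S x, S x -> exists2 y, rep S = Some y & S y.
  have /choice[rep repP] : forall S : set T, exists z : option T,
      forall x, S x -> exists2 y, z = Some y & S y.
    move=> S; have [[y Sy]|no] := pselect (exists y, S y).
      by exists (Some y) => x _; exists y.
    by exists None => x Sx; case: no; exists x.
  by exists rep => S x; apply: repP.
have orb_refl x : orb x x by exists 0%R, 0%R; rewrite (mv0 u v aP).
have /choice [h hP] : forall x, exists a : int, exists b y,
    rep (orb x) = Some y /\ y = act (emb u v a b) x.
  move=> x; have [y oy [a [b yab]]] := repP _ _ (orb_refl x).
  by exists a, b, y.
exists (fun x => odd (absz (h x))) => x a b.
have [c [y [oy yx]]] := hP x; have [c' [y' [oy' yx']]] := hP (act (emb u v a b) x).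
have orbE : orb (act (emb u v a b) x) = orb x.
  apply/seteqP; split=> z [p [q ->]].
    by exists (p + a)%R, (q + b)%R; rewrite (mvD u v aP).
  by exists (p - a)%R, (q - b)%R; rewrite -(mvD u v aP) !subrK.
rewrite orbE oy in oy'; case: oy' => yy'.
rewrite -yy' yx -(mvD u v aP) in yx'.
have [e _] := mv_inj emb_inj aP fP yx'; rewrite e; lia.
Qed.

Section Generic.
Local Open Scope nat_scope.
Variables (n : nat) (hn : 2 <= n).
Local Notation G := 'rV[int]_n.
Local Notation T := (set_type (free_part G bool : set {ptws G -> bool})).
Local Notation mv a b := (@free_shift G bool (emb (e1 hn) (e2 hn) a b)).

(** Level [k] looks for the pattern of code [k]: a finite set of ones in a box of
    size [pat_size k], isolated by zeros up to ten times the radius. *)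
Definition pat_ones (k : nat) : {fset G} :=
  if @choice.unpickle ({fset G} * nat)%type k is Some p then p.1 else fset0%fset.
Definition pat_size (k : nat) : nat :=
  if @choice.unpickle ({fset G} * nat)%type k is Some p then p.2 else 0.

(** A bound for the extent of all the squares of levels below [k]. *)
Fixpoint past_size (k : nat) : nat :=
  if k is j.+1 then past_size j + 3 * (pat_size j + 2 + past_size j) + pat_size j + 1
  else 0.
Definition pat_radius (k : nat) : nat := pat_size k + 2 + past_size k.

Definition is_center (k : nat) (x : G -> bool) : Prop :=
  [/\ exists g, g \in pat_ones k, forall g, g \in pat_ones k -> norm g <= pat_size k &
      all (fun g => x g == (g \in pat_ones k)) (box n (10 * pat_radius k))].

Lemma centerE k x g : is_center k x -> norm g <= 10 * pat_radius k ->
  x g = (g \in pat_ones k).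
Proof. by move=> [_ _ /allP h] gk; apply/eqP/h/mem_box. Qed.

Lemma past_size_lt j k : j < k -> past_size j + 3 * pat_radius j + pat_size j + 1 <= past_size k.
Proof.
elim: k => // k IH; rewrite ltnS leq_eqVlt => /orP[/eqP ->|/IH] /=.
  by rewrite /pat_radius; lia.
by move=> le; lia.
Qed.

(** If two occurrences of a pattern were close, the ones of the first would be the
    ones of the second: a finite set would be invariant under a translation. *)
Lemma generic_same_level k (x : G -> bool) (a b : int) :
  is_center k x -> is_center k (shift (emb (e1 hn) (e2 hn) a b) x) ->
  far a b (4 * pat_radius k + 1)%N%:Z \/ (a = 0 /\ b = 0)%R.
Proof.
have := @emb12_inj n hn a b; have := norm_emb hn a b.
move: (emb _ _ a b) => g norm_g g_inj cx cy.
have rk : pat_size k < pat_radius k by rewrite /pat_radius; lia.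
have [|near_] := leqP (4 * pat_radius k + 2) (norm g).
  by rewrite norm_g /far; left; lia.
right; apply: g_inj; have [[d dA] Am _] := cx.
apply: (translate_fset dA) => x0 x0A; have x0m := Am _ x0A.
have := centerE cy (g := x0); rewrite x0A /shift => e.
rewrite -(centerE cx); first by apply: e; lia.
by apply: leq_trans (normD _ _) _; lia.
Qed.

(** If an occurrence of a smaller pattern is close to an occurrence of pattern k,
    one of its ones falls in the window of the latter, hence among its ones,
    which are close to the centre. *)
Lemma generic_lower_level j k (x : G -> bool) (a b : int) : j < k ->
  is_center k x -> is_center j (shift (emb (e1 hn) (e2 hn) a b) x) ->
  near a b ((pat_radius k)%:Z - 1 - 3 * (pat_radius j)%:Z)%R \/
  far a b (3 * pat_radius k + 1 + 3 * pat_radius j)%N%:Z.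
Proof.
have := norm_emb hn a b; move: (emb _ _ a b) => g norm_g jk cx cy; have pj := past_size_lt jk.
have rk : pat_radius k = pat_size k + 2 + past_size k by [].
have rj : pat_size j < pat_radius j by rewrite /pat_radius; lia.
have [|near_] := leqP (3 * pat_radius k + 2 + 3 * pat_radius j) (norm g).
  by rewrite norm_g /far; right; lia.
left; have [[d dA] Am _] := cy; have dm := Am _ dA.
have xd : x (d + g)%R by have := centerE cy (g := d); rewrite dA /shift => -> //; lia.
have dgm : norm (d + g)%R <= 10 * pat_radius k.
  by apply: leq_trans (normD _ _) _; lia.
have dgA : (d + g)%R \in pat_ones k by rewrite -(centerE cx dgm).
have [_ Akm _] := cx; have := Akm _ dgA.
have : norm g <= norm (d + g)%R + norm d.
  have := normD (d + g)%R (- d)%R; rewrite normN.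
  by rewrite (addrC d) addrK.
by rewrite norm_g /near; lia.
Qed.

Local Notation act := (@free_shift G bool).
Local Notation V := (fun k (x : T) => is_center k (val x)).
Local Notation is_covered := (covered (e1 hn) (e2 hn) act pat_radius V).
Local Notation is_tiled := (tiled (e1 hn) (e2 hn) act pat_radius V).

Lemma pat_radius_gt0 k : 0 < pat_radius k.
Proof. by rewrite /pat_radius; lia. Qed.

Let act_act : is_action act := @free_shift_action G bool.
Let act_free : is_free act := @free_shift_free G bool.

Lemma generic_coversE k i j (x : T) : covers (e1 hn) (e2 hn) act pat_radius V k i j x <->
  [/\ i <= 4 * pat_radius k, j <= 4 * pat_radius k &
      V k (mv ((pat_radius k)%:Z - i%:Z)%R ((pat_radius k)%:Z - j%:Z)%R x)].
Proof.
split=> -[im jm].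
  move=> [s Vs e]; split=> //; rewrite (_ : mv _ _ x = s) //.
  rewrite ![(_%:Z - _)%R]addrC (mvD (e1 hn) (e2 hn) act_act) -e.
  by rewrite -(mvD (e1 hn) (e2 hn) act_act) !addNr (mv0 _ _ act_act).
move=> Vs; split=> //; eexists; first exact: Vs.
by rewrite -(mvD (e1 hn) (e2 hn) act_act) ![(_ + (_ - _))%R]addrC !subrK.
Qed.

Lemma center_shift_clopen k (a b : int) :
  open [set x : T | V k (mv a b x)] /\ closed [set x : T | V k (mv a b x)].
Proof.
have [good|bad] := pselect ((exists g, g \in pat_ones k) /\
    forall g, g \in pat_ones k -> norm g <= pat_size k); last first.
  rewrite (_ : [set _ | _] = set0); first by split; [exact: open0 | exact: closed0].
  by apply/seteqP; split=> // x [h1 h2 _]; apply: bad.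
rewrite (_ : [set _ | _] = [set x : T | all (fun g => (val x : {ptws G -> bool}) (g + emb (e1 hn) (e2 hn) a b)%R
   == (g \in pat_ones k)) (box n (10 * pat_radius k))]).
  by split; [apply: open_cylinder | apply: closed_cylinder].
by apply/seteqP; split=> x /=; [case | case: good => *; split].
Qed.

Lemma covers_clopen k i j :
  open [set x : T | covers (e1 hn) (e2 hn) act pat_radius V k i j x] /\
  closed [set x : T | covers (e1 hn) (e2 hn) act pat_radius V k i j x].
Proof.
have [/andP[im jm]|bad] := boolP ((i <= 4 * pat_radius k) && (j <= 4 * pat_radius k)).
  rewrite (_ : [set _ | _] = [set x : T | V k (mv ((pat_radius k)%:Z - i%:Z)%R ((pat_radius k)%:Z - j%:Z)%R x)]).
    exact: center_shift_clopen.
  by apply/seteqP; split=> x; rewrite /= generic_coversE => // -[].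
rewrite (_ : [set _ | _] = set0); first by split; [exact: open0 | exact: closed0].
by apply/seteqP; split=> // x [im jm _]; rewrite im jm in bad.
Qed.

Lemma covered_closed k : closed [set x : T | is_covered k x].
Proof.
rewrite (_ : [set _ | _] = \bigcup_(i in `I_(4 * pat_radius k).+1) \bigcup_(j in `I_(4 * pat_radius k).+1)
    [set x : T | covers (e1 hn) (e2 hn) act pat_radius V k i j x]).
  apply: closed_bigcup => [|i _]; first exact: finite_II.
  by apply: closed_bigcup => [|j _]; [exact: finite_II | exact: (covers_clopen k i j).2].
apply/seteqP; split=> x; last by case=> i _ [j _ h]; exists i, j.
by case=> i [j h]; have [im jm _] := h; exists i => //; exists j.
Qed.

Lemma tiled_open (S : set nat) : open [set x : T | exists2 c, S c & is_tiled x c].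
Proof.
rewrite (_ : [set _ | _] = \bigcup_k \bigcup_i \bigcup_(j in [set j | S (tile (4 * pat_radius k) i j)])
   ([set x : T | covers (e1 hn) (e2 hn) act pat_radius V k i j x] `&`
    \bigcap_(l in `I_k) ~` [set x : T | is_covered l x])).
  apply: bigcup_open => k _; apply: bigcup_open => i _; apply: bigcup_open => j _.
  apply: openI; first exact: (covers_clopen k i j).1.
  rewrite -setC_bigcup; apply: closed_openC; apply: closed_bigcup => [|l _].
    exact: finite_II.
  exact: covered_closed.
apply/seteqP; split=> x /=.
  move=> [c Sc [k [i [j [kmin cx cE]]]]]; exists k => //; exists i => //.
  by exists j; rewrite /= -?cE //; split.
move=> [k _ [i _ [j Sj [cx kmin]]]]; exists (tile (4 * pat_radius k) i j) => //.
by exists k, i, j; split.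
Qed.

Lemma isolated_free (A : {fset G}) (a : G) : a \in A ->
  free_part G bool (fun g => g \in A).
Proof.
move=> aA g g0 e; apply: g0; apply: (translate_fset aA) => x xA.
by have := congr1 (fun f : G -> bool => f x) e; rewrite /shift xA.
Qed.

(** Keeping finitely many coordinates of [x], replacing the others by zeros, and
    adding a single one outside, gives a nonempty finite set of ones, which is
    an aperiodic configuration; its code is a level of which the new point
    is a centre, and its square covers the given translate. *)
Lemma covered_dense (a b : int) (x : T) (S : {fset G}) : exists y : T,
  (forall d, d \in S -> (val y : G -> bool) d = (val x : G -> bool) d) /\
  exists k, is_covered k (mv a b y).
Proof.
pose m := \max_(d : S) norm (val d) + absz a + absz b.
have Sm d : d \in S -> norm d <= m.
  move=> dS; apply: (@leq_trans (\max_(d : S) norm (val d))); last by rewrite /m; lia.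
  exact: (leq_bigmax [` dS]%fset).
pose star := emb (e1 hn) (e2 hn) m.+1%:Z 0.
have nstar : norm star = m.+1 by rewrite /star norm_emb /=; lia.
pose A := (star |` [fset d in S | (val x : G -> bool) d])%fset.
have sA : star \in A by rewrite !inE eqxx.
pose k := choice.pickle ((A, m.+1) : {fset G} * nat)%type.
have kA : pat_ones k = A by rewrite /pat_ones /k choice.pickleK.
have km : pat_size k = m.+1 by rewrite /pat_size /k choice.pickleK.
pose y : T := exist _ (fun g => g \in A) (mem_set (isolated_free sA)).
exists y; split.
  move=> d dS; rewrite /= !inE dS /=; case: eqP => // ds.
  by have := Sm _ dS; rewrite ds nstar ltnn.
have r_m : m < pat_radius k by rewrite /pat_radius km; lia.
have [i ei] : exists i : nat, (i%:Z = (pat_radius k)%:Z + a)%R.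
  by exists (absz ((pat_radius k)%:Z + a)%R); lia.
have [j ej] : exists j : nat, (j%:Z = (pat_radius k)%:Z + b)%R.
  by exists (absz ((pat_radius k)%:Z + b)%R); lia.
exists k, i, j; apply/generic_coversE; split; [lia..|].
have ea : ((pat_radius k)%:Z - i%:Z + a = 0)%R by lia.
have eb : ((pat_radius k)%:Z - j%:Z + b = 0)%R by lia.
rewrite -(mvD (e1 hn) (e2 hn) act_act) ea eb.
rewrite (mv0 _ _ act_act) /is_center kA km; split; first by exists star.
  move=> g; rewrite !inE => /orP[/eqP ->|/andP[gS _]]; first by rewrite nstar.
  by apply: leq_trans (Sm _ gS) _; lia.
by apply/allP => g _ /=.
Qed.

Lemma covered_tiled (x : T) : (exists k, is_covered k x) -> exists c, is_tiled x c.
Proof.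
move=> [k0 h0]; have ex : exists k, `[< is_covered k x >] by exists k0; apply/asboolP.
case: (ex_minnP ex) => k /asboolP [i [j h]] kmin.
exists (tile (4 * pat_radius k) i j), k, i, j; split=> // l lk /asboolP /kmin.
by rewrite leqNgt lk.
Qed.

Definition fully_covered (x : T) := forall a b : int, exists k, is_covered k (mv a b x).

Lemma fully_covered_shift (a b : int) (x : T) : fully_covered (mv a b x) <-> fully_covered x.
Proof.
split=> h a' b'; last by rewrite -(mvD (e1 hn) (e2 hn) act_act).
have := h (a' - a)%R (b' - b)%R.
by rewrite -(mvD (e1 hn) (e2 hn) act_act) !subrK.
Qed.

Lemma meager_uncovered (B : set T) : B `<=` [set x | ~ fully_covered x] -> meager B.
Proof.
move=> Bsub.
pose N (p : int * int) : set T := [set x | ~ exists k, is_covered k (mv p.1 p.2 x)].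
have Nclosed p : closed (N p).
  rewrite (_ : N p = ~` \bigcup_k [set x | is_covered k (mv p.1 p.2 x)]).
    apply: open_closedC; apply: bigcup_open => k _.
    rewrite (_ : [set _ | _] = \bigcup_i \bigcup_j
       [set x : T | covers (e1 hn) (e2 hn) act pat_radius V k i j (mv p.1 p.2 x)]).
      apply: bigcup_open => i _; apply: bigcup_open => j _.
      have [/andP[im jm]|bad] := boolP ((i <= 4 * pat_radius k) && (j <= 4 * pat_radius k)).
        rewrite (_ : [set _ | _] = [set x : T | V k
          (mv ((pat_radius k)%:Z - i%:Z + p.1)%R ((pat_radius k)%:Z - j%:Z + p.2)%R x)]).
          exact: (center_shift_clopen _ _ _).1.
        apply/seteqP; split=> x /=; rewrite generic_coversE.
          by case=> _ _; rewrite -(mvD (e1 hn) (e2 hn) act_act).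
        by move=> h; split=> //; rewrite -(mvD (e1 hn) (e2 hn) act_act).
      rewrite (_ : [set _ | _] = set0); first exact: open0.
      by apply/seteqP; split=> // x [im jm _]; rewrite im jm in bad.
    apply/seteqP; split=> x; last by case=> i _ [j _ h]; exists i, j.
    by case=> i [j h]; exists i => //; exists j.
  apply/seteqP; split=> x /=; first by move=> h [k _ hk]; apply: h; exists k.
  by move=> h [k hk]; apply: h; exists k.
have Nnd p : nowhere_dense (N p).
  rewrite /nowhere_dense -(closure_id (N p)).1 //; apply/seteqP; split=> // x.
  rewrite /interior => /set_type_cylinder[S NS].
  have [y [yx [k hk]]] := covered_dense p.1 p.2 x S.
  by have := NS y yx; apply; exists k.
exists (fun k => if choice.unpickle k is Some p then N p else set0); split.
  move=> k; case: choice.unpickle => [p|] //.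
  by rewrite /nowhere_dense closure0 interior0.
move=> x /Bsub /= nx; have [a [b nab]] : exists a b : int, ~ exists k, is_covered k (mv a b x).
  apply: contrapT => no; apply: nx => a b; apply: contrapT => nab.
  by apply: no; exists a, b.
have := choice.pickleK (a, b); move: (choice.pickle (a, b)) => k kE.
by exists k => //; rewrite kE.
Qed.

(** On the fully covered points, the set where the label is given is open,
    and the other points form a meagre set. *)
Theorem triangle_BaireSHIFT : BaireSHIFT (triangle_LCL (e1 hn) (e2 hn)).
Proof.
have [p pP] := exists_parity (@emb12_inj n hn) act_act act_free.
pose g (x : T) : nat := if `[< fully_covered x >] then xget 0 [set c | is_tiled x c] else p x.
have tiled_lt10 (x : T) c : is_tiled x c -> c < 10.
  by case=> k [i [j [_ _ ->]]]; apply: tile_lt10.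
have gP x : fully_covered x -> is_tiled x (g x).
  move=> fx; rewrite /g asboolT //.
  have [k hk] := fx 0%R 0%R; rewrite (mv0 _ _ act_act) in hk.
  have [c tc] : exists c, is_tiled x c by apply: covered_tiled; exists k.
  exact: (xgetPex 0 (ex_intro _ c tc)).
have g10 x : g x < 10.
  have [fx|nfx] := pselect (fully_covered x); first exact: tiled_lt10 (gP x fx).
  by rewrite /g asboolF //; case: (p x).
pose f x : 'I_10 := Ordinal (g10 x).
exists f; split.
  apply/triangle_solutionP => x.
  have [fx|nfx] := pselect (fully_covered x).
    have sl k (s : T) (a b : int) : V k s -> V k (mv a b s) ->
        far a b (4 * pat_radius k + 1)%N%:Z \/ a = 0%R /\ b = 0%R.
      exact: generic_same_level.
    have ll j k (s : T) (a b : int) : j < k -> V k s -> V j (mv a b s) ->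
        near a b ((pat_radius k)%:Z - 1 - 3 * (pat_radius j)%:Z)%R \/
        far a b (3 * pat_radius k + 1 + 3 * pat_radius j)%N%:Z.
      exact: generic_lower_level.
    apply: (tiled_rule act_act pat_radius_gt0 sl ll (f := g) (x := x)) => a b.
    by apply: gP; apply/fully_covered_shift.
  rewrite (_ : rule _ = rule (fun a b => p x (+) odd (absz a) : nat)); last first.
    apply: eq_rule => a b _ _; rewrite /= /g asboolF ?pP //.
    by move/fully_covered_shift.
  by rewrite /rule /=; case: (p x).
move=> S; pose U := [set x : T | exists2 c, S (inord c) & is_tiled x c].
exists U; split; first exact: (tiled_open [set c | S (inord c)]).
apply: meager_uncovered => x h fx; suff : S (f x) <-> U x.
  by case: h => -[h1 h2]; tauto.
have fE : f x = inord (g x) by apply: val_inj; rewrite /= inordK.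
split=> [Sf|[c Sc tc]]; first by exists (g x); [rewrite -fE | exact: gP].
rewrite fE (_ : g x = c) //.
apply: (tiled_unique act_act _ (gP x fx) tc) => k s a b.
exact: generic_same_level.
Qed.

End Generic.

(** * Mixing of the shift for the product measure *)

Section Mixing.
Local Open Scope classical_set_scope.
Local Open Scope ring_scope.
Variables (R : realType) (n : nat).
Local Notation G := 'rV[int]_n.
Local Notation cube := (cube R G).
Variable mu : probability cube R.
Hypothesis mu_prod : is_product_measure mu.

Definition cylinder (s : {fset G}) (B : G -> set R) : set cube :=
  [set x | forall g, g \in s -> B g (val (x g))].

Definition cylinders : set (set cube) :=
  [set A | exists s B, (forall g, measurable (B g)) /\ A = cylinder s B].

Lemma measurable_coord g (B : set R) : measurable B ->
  measurable [set x : cube | B (val (x g))].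
Proof. by move=> mB; apply: sub_sigma_algebra; exists g, B. Qed.

Lemma measurable_cylinder s B : (forall g, measurable (B g)) -> measurable (cylinder s B).
Proof.
move=> mB; rewrite (_ : cylinder s B = \bigcap_(g in [set` s]) [set x : cube | B g (val (x g))]).
  rewrite -[X in measurable X]setCK setC_bigcap; apply: measurableC.
  apply: fin_bigcup_measurable; first exact: finite_fset.
  by move=> g _; apply: measurableC; apply: measurable_coord.
by apply/seteqP; split=> x h g; apply: h.
Qed.

Lemma measurable_cylindersE : @measurable _ cube = <<s cylinders >>.
Proof.
apply/seteqP; split.
  apply: smallest_sub => [|A [g [B [mB ->]]]]; first exact: smallest_sigma_algebra.
  apply: sub_sigma_algebra; exists [fset g]%fset, (fun=> B); split=> //.
  apply/seteqP; split=> x /= h; last by apply: h; rewrite inE.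
  by move=> h'; rewrite inE => /eqP ->.
apply: smallest_sub; first exact: sigma_algebra_measurable.
by move=> A [s [B [mB ->]]]; apply: measurable_cylinder.
Qed.

(** The constraints of the intersection of two cylinders. *)
Definition glue (s s' : {fset G}) (B B' : G -> set R) (g : G) : set R :=
  (if g \in s then B g else setT) `&` (if g \in s' then B' g else setT).

Lemma measurable_glue s s' B B' : (forall g, measurable (B g)) ->
  (forall g, measurable (B' g)) -> forall g, measurable (glue s s' B B' g).
Proof.
by move=> mB mB' g; rewrite /glue; apply: measurableI; case: ifP => // _; exact: measurableT.
Qed.

Lemma cylinderI s s' B B' :
  cylinder s B `&` cylinder s' B' = cylinder (s `|` s')%fset (glue s s' B B').
Proof.
apply/seteqP; split=> x /=.
  by move=> [h h'] g _; split; case: ifP => // gs; [exact: h | exact: h'].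
move=> h; split=> g gs; have := h g; rewrite inE gs ?orbT => /(_ isT)[]; rewrite gs //.
Qed.

Lemma setI_closed_cylinders : setI_closed cylinders.
Proof.
move=> _ _ [s [B [mB ->]]] [s' [B' [mB' ->]]].
exists (s `|` s')%fset, (glue s s' B B'); split; last exact: cylinderI.
exact: measurable_glue.
Qed.

Lemma cylinder_indep s s' B B' : (forall g, measurable (B g)) ->
  (forall g, measurable (B' g)) -> [disjoint s & s']%fset ->
  mu (cylinder s B `&` cylinder s' B') = (mu (cylinder s B) * mu (cylinder s' B'))%E.
Proof.
move=> mB mB' dis.
rewrite cylinderI !mu_prod //; last exact: measurable_glue.
have dis' g : g \in s' -> g \notin s.
  by move: dis; rewrite fdisjoint_sym => /fdisjointP; apply.
move/fdisjointP: dis => dis.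
have pe : perm_eq (s `|` s')%fset (s ++ s').
  apply: uniq_perm => [||g]; rewrite ?fset_uniq ?inE ?mem_cat //.
  rewrite cat_uniq !fset_uniq andbT; apply/hasPn => g; exact: dis'.
rewrite (perm_big _ pe) big_cat /=; congr (_ * _)%E; apply: eq_big_seq => g gs; rewrite /glue gs.
  by rewrite (negPf (dis g gs)) setIT.
by rewrite (negPf (dis' g gs)) setTI.
Qed.

Definition shift_cube (v : G) (x : cube) : cube := shift v x.
Local Notation T := shift_cube.

Definition translate (s : {fset G}) (v : G) : {fset G} := [fset (g + v)%R | g : G in s]%fset.

Lemma shift_cylinder v s B :
  T v @^-1` cylinder s B = cylinder (translate s v) (fun g => B (g - v)).
Proof.
apply/seteqP; split=> x /= h g; last first.
  by move=> gs; have := h (g + v); rewrite addrK; apply; apply/imfsetP; exists g.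
by move=> /imfsetP[g' /= gs ->]; rewrite addrK; apply: h.
Qed.

Lemma measurable_shift v (A : set cube) : measurable A -> measurable (T v @^-1` A).
Proof.
have mT : measurable_fun setT (T v : cube -> cube).
  apply: (measurability cylinders); first exact: measurable_cylindersE.
  move=> _ [_ [s [B [mB ->]]] <-]; rewrite setTI shift_cylinder.
  by apply: measurable_cylinder => g; apply: mB.
by move=> mA; rewrite -[_ @^-1` _]setTI; apply: mT.
Qed.

Lemma shift_invariant v (A : set cube) : measurable A -> mu (T v @^-1` A) = mu A.
Proof.
rewrite {1}measurable_cylindersE; move: A.
apply: (dynkin_induction measurable_cylindersE setI_closed_cylinders).
- by rewrite preimage_setT.
- move=> _ [s [B [mB ->]]]; rewrite shift_cylinder !mu_prod; [|by move=> g; apply: mB..].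
  rewrite /translate big_imfset /=; last by move=> x y _ _; apply: addIr.
  by apply: eq_bigr => g _; rewrite addrK.
- move=> S mS PS; rewrite preimage_setC !probability_setC ?PS //.
  exact: measurable_shift.
- move=> F mF tF PF; rewrite preimage_bigcup !measure_bigcup //.
  + by apply: eq_eseriesr => i _; apply: PF.
  + by move=> i _; apply: measurable_shift.
  + by move=> i j _ _ /= [x [Fi Fj]]; apply: (tF i j) => //; exists (T v x).
Qed.

Definition pr (A : set cube) : R := fine (mu A).

Lemma prE A : measurable A -> (pr A)%:E = mu A.
Proof. by move=> mA; rewrite fineK // fin_num_measure. Qed.

Lemma pr_ge0 A : 0 <= pr A.
Proof. by rewrite fine_ge0 // measure_ge0. Qed.

Lemma pr_le1 A : measurable A -> pr A <= 1.
Proof. by move=> mA; rewrite -lee_fin prE // probability_le1. Qed.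

Lemma prD A B : measurable A -> measurable B -> B `<=` A -> pr (A `\` B) = pr A - pr B.
Proof.
move=> mA mB BA; apply: EFin_inj; rewrite EFinB !prE //; last exact: measurableD.
rewrite measureD //; first by rewrite setIidr.
by apply: le_lt_trans (probability_le1 mu mA) _; rewrite ltry.
Qed.

Lemma le_pr A B : measurable A -> measurable B -> A `<=` B -> pr A <= pr B.
Proof. by move=> mA mB AB; rewrite -lee_fin !prE // le_measure // inE. Qed.

Lemma pr_shift v A : measurable A -> pr (T v @^-1` A) = pr A.
Proof. by move=> mA; rewrite /pr shift_invariant. Qed.

Lemma pr_ndseq (F : (set cube)^nat) : (forall k, measurable (F k)) ->
  nondecreasing_seq F -> pr \o F @ \oo --> pr (\bigcup_k F k).
Proof.
move=> mF ndF; have mU : measurable (\bigcup_k F k) by apply: bigcupT_measurable.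
have /fine_cvg : mu \o F @ \oo --> (pr (\bigcup_k F k))%:E.
  by rewrite prE //; exact: nondecreasing_cvg_mu.
by [].
Qed.

Lemma norm_mulrn (v : G) k : v != 0 -> (k <= norm (v *+ k))%N.
Proof.
move=> v0; have [i vi] : exists i, v 0 i != 0.
  apply: contrapT => no; move/eqP: v0; apply; apply/rowP => i; rewrite mxE.
  by apply/eqP/negPn/negP => vi; apply: no; exists i.
apply: leq_trans (norm_coord _ i); rewrite mulmxnE -mulr_natr natz abszM absz_nat.
by rewrite leq_pmull // absz_gt0.
Qed.

(** Far enough along a nonzero direction, two finite sets of coordinates become
    disjoint; this is what makes the shift mixing. *)
Lemma translate_disjoint (s s' : {fset G}) (v : G) : v != 0 ->
  exists K, forall k, (K <= k)%N -> [disjoint s & translate s' (v *+ k)]%fset.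
Proof.
move=> v0; pose N := (\max_(g : s) norm (val g) + \max_(g : s') norm (val g))%N.
exists N.+1 => k Nk; apply/fdisjointP => g gs; apply/negP => /imfsetP[g' /= gs' e].
suff : (k <= N)%N by rewrite leqNgt Nk.
apply: leq_trans (norm_mulrn k v0) _.
rewrite (_ : v *+ k = g - g'); last by rewrite e addrC addKr.
apply: leq_trans (normD _ _) _; rewrite normN; apply: leq_add.
  exact: (leq_bigmax (F := fun g : s => norm (val g)) [` gs]%fset).
exact: (leq_bigmax (F := fun g : s' => norm (val g)) [` gs']%fset).
Qed.

Section MixingAlong.
Variable v : G.
Hypothesis v0 : v != 0.

Definition mixing (A B : set cube) :=
  (fun k => pr (A `&` T (v *+ k) @^-1` B)) @ \oo --> pr A * pr B.

Lemma mixing_cylinders A B : cylinders A -> cylinders B -> mixing A B.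
Proof.
move=> [s [C [mC ->]]] [s' [C' [mC' ->]]].
have [K dis] := translate_disjoint s s' v0.
apply/cvgrPdist_le => e e0; exists K => // k /= Kk.
have mA := measurable_cylinder s mC; have mB := measurable_cylinder s' mC'.
rewrite [X in _ * _ - X]/pr shift_cylinder cylinder_indep //.
  rewrite -shift_cylinder -!prE //; last exact: measurable_shift.
  by rewrite -EFinM /= pr_shift // subrr normr0 ltW.
exact: dis.
Qed.

(** A uniform limit of convergent sequences converges; it reduces mixing for the
    union of a sequence of events to mixing for each of them. *)
Lemma cvg_approx (u : R^nat) (L : R) :
  (forall e, 0 < e -> exists w l, [/\ w @ \oo --> l, forall k, `|u k - w k| <= e & `|L - l| <= e]) ->
  u @ \oo --> L.
Proof.
move=> h; apply/cvgrPdist_le => e e0.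
have e3 : 0 < e / 3 by rewrite divr_gt0.
have [w [l [wl uw Ll]]] := h _ e3.
have /cvgrPdist_le/(_ _ e3) := wl; apply: filterS => k lw.
have -> : L - u k = (L - l) + (l - w k) - (u k - w k) by ring.
apply: le_trans (ler_normB _ _) _; apply: le_trans (lerD (ler_normD _ _) (lexx _)) _.
have := uw k; lra.
Qed.

Lemma mixingD A A' B : measurable A -> measurable A' -> measurable B -> A' `<=` A ->
  mixing A B -> mixing A' B -> mixing (A `\` A') B.
Proof.
move=> mA mA' mB AA mx mx'; rewrite /mixing prD // mulrBl.
have E k : pr ((A `\` A') `&` T (v *+ k) @^-1` B) =
    pr (A `&` T (v *+ k) @^-1` B) - pr (A' `&` T (v *+ k) @^-1` B).
  have mTB := measurable_shift (v *+ k) mB.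
  rewrite -prD; [|exact: measurableI..|by move=> x [/AA]].
  by congr pr; apply/seteqP; split=> x /=; tauto.
by under eq_fun do rewrite E; apply: cvgB.
Qed.

Lemma mixingDr A B B' : measurable A -> measurable B -> measurable B' -> B' `<=` B ->
  mixing A B -> mixing A B' -> mixing A (B `\` B').
Proof.
move=> mA mB mB' BB mx mx'; rewrite /mixing prD // mulrBr.
have E k : pr (A `&` T (v *+ k) @^-1` (B `\` B')) =
    pr (A `&` T (v *+ k) @^-1` B) - pr (A `&` T (v *+ k) @^-1` B').
  have mTB := measurable_shift (v *+ k) mB; have mTB' := measurable_shift (v *+ k) mB'.
  rewrite -prD; [|exact: measurableI..|by move=> x [Ax /BB]].
  by congr pr; apply/seteqP; split=> x /=; tauto.
by under eq_fun do rewrite E; apply: cvgB.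
Qed.

Lemma mixing_nd (F : (set cube)^nat) B : (forall k, measurable (F k)) -> measurable B ->
  nondecreasing_seq F -> (forall k, mixing (F k) B) -> mixing (\bigcup_k F k) B.
Proof.
move=> mF mB ndF mx; apply: cvg_approx => e e0.
have mU : measurable (\bigcup_k F k) by apply: bigcupT_measurable.
have /cvgrPdist_le/(_ _ e0)[N _ /(_ N (leqnn N)) /= FN] := pr_ndseq mF ndF.
exists (fun k => pr (F N `&` T (v *+ k) @^-1` B)), (pr (F N) * pr B).
have sub : F N `<=` \bigcup_k F k by move=> x; exists N.
have dif : pr (\bigcup_k F k) - pr (F N) <= e by apply: le_trans (ler_norm _) FN.
split; first exact: mx.
- move=> k; have mTB := measurable_shift (v *+ k) mB.
  rewrite -prD; [|exact: measurableI..|by move=> x [/sub]].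
  rewrite ger0_norm ?pr_ge0 //; apply: le_trans dif; rewrite -prD //.
  apply: le_pr; [by apply: measurableD; exact: measurableI|exact: measurableD|].
  by move=> x /= [[? ?]] h; split=> // FNx; apply: h.
- rewrite -mulrBl -prD // normrM !ger0_norm ?pr_ge0 // prD //.
  apply: le_trans dif; rewrite -[leRHS]mulr1; apply: ler_wpM2l.
    by rewrite -prD // pr_ge0.
  exact: pr_le1.
Qed.

Lemma mixing_ndr (F : (set cube)^nat) A : (forall k, measurable (F k)) -> measurable A ->
  nondecreasing_seq F -> (forall k, mixing A (F k)) -> mixing A (\bigcup_k F k).
Proof.
move=> mF mA ndF mx; apply: cvg_approx => e e0.
have mU : measurable (\bigcup_k F k) by apply: bigcupT_measurable.
have /cvgrPdist_le/(_ _ e0)[N _ /(_ N (leqnn N)) /= FN] := pr_ndseq mF ndF.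
exists (fun k => pr (A `&` T (v *+ k) @^-1` (F N))), (pr A * pr (F N)).
have sub : F N `<=` \bigcup_k F k by move=> x; exists N.
have dif : pr (\bigcup_k F k) - pr (F N) <= e by apply: le_trans (ler_norm _) FN.
split; first exact: mx.
- move=> k; have mTU := measurable_shift (v *+ k) mU; have mTF := measurable_shift (v *+ k) (mF N).
  rewrite -prD; [|exact: measurableI..|by move=> x [Ax /sub]].
  rewrite ger0_norm ?pr_ge0 //; apply: le_trans dif; rewrite -prD //.
  rewrite -[leRHS](pr_shift (v *+ k)); last exact: measurableD.
  apply: le_pr; [by apply: measurableD; exact: measurableI|apply: measurable_shift; exact: measurableD|].
  by move=> x /= [[? ?]] h; split=> // FNx; apply: h.
- rewrite -mulrBr -prD // normrM !ger0_norm ?pr_ge0 // prD //.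
  apply: le_trans dif; rewrite -[leRHS]mul1r; apply: ler_wpM2r.
    by rewrite -prD // pr_ge0.
  exact: pr_le1.
Qed.

Lemma mixing_cylinderr A B : measurable A -> cylinders B -> mixing A B.
Proof.
move=> mA cB; have mB : measurable B.
  by case: cB => s [C [mC ->]]; apply: measurable_cylinder.
suff : measurable `<=` [set A | measurable A /\ mixing A B] by move=> /(_ _ mA)[].
rewrite {1}measurable_cylindersE; apply: lambda_system_subset => //.
- exact: setI_closed_cylinders.
- split => //.
  + split; first exact: measurableT.
    rewrite /mixing; apply/cvgrPdist_le => e e0; exists 0%N => // k _ /=.
    rewrite setTI pr_shift // /pr probability_setT mul1r subrr normr0 ltW //.
  + move=> X Y YX [mX hX] [mY hY]; split; first exact: measurableD.
    exact: mixingD.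
  + move=> F ndF hF; split; first by apply: bigcupT_measurable => k; case: (hF k).
    by apply: mixing_nd => // k; case: (hF k).
- move=> X cX; split; last exact: mixing_cylinders.
  by case: cX => s [C [mC ->]]; apply: measurable_cylinder.
Qed.

(** Cylinders that are far apart are independent, and the events that are mixed
    with a given one form a lambda-system; Dynkin's theorem is applied to each of
    the two arguments in turn. *)
Theorem shift_mixing A B : measurable A -> measurable B -> mixing A B.
Proof.
move=> mA mB.
suff : measurable `<=` [set B | measurable B /\ mixing A B] by move=> /(_ _ mB)[].
rewrite {1}measurable_cylindersE; apply: lambda_system_subset => //.
- exact: setI_closed_cylinders.
- split => //.
  + split; first exact: measurableT.
    rewrite /mixing; apply/cvgrPdist_le => e e0; exists 0%N => // k _ /=.
    by rewrite preimage_setT setIT [pr setT]/pr probability_setT mulr1 subrr normr0 ltW.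
  + move=> X Y YX [mX hX] [mY hY]; split; first exact: measurableD.
    exact: mixingDr.
  + move=> F ndF hF; split; first by apply: bigcupT_measurable => k; case: (hF k).
    by apply: mixing_ndr => // k; case: (hF k).
- move=> X cX; split; last exact: mixing_cylinderr.
  by case: cX => s [C [mC ->]]; apply: measurable_cylinder.
Qed.

(** By mixing, [A] meets its translate by [v *+ k] with a probability close to
    [pr A ^+ 2] for all large k, the odd ones included. *)
Lemma odd_recurrence A : measurable A ->
  (forall k, odd k -> A `&` T (v *+ k) @^-1` A = set0) -> pr A = 0.
Proof.
move=> mA h; apply/eqP; apply: contraT => pA.
have p0 : 0 < pr A * pr A by rewrite mulr_gt0 // lt_neqAle eq_sym pA pr_ge0.
have /cvgrPdist_lt/(_ _ p0)[K _ hK] := shift_mixing mA mA.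
have := hK K.*2.+1; rewrite /= h /=; last by rewrite odd_double.
by rewrite /pr measure0 subr0 ger0_norm ?(ltW p0) // ltxx => /(_ _); lia.
Qed.

(** Here [A] is contained in all its translates along [v], so that the limit of
    [pr (A & T A)] is [pr A], while mixing makes it [pr A ^+ 2]. *)
Lemma zero_one A : measurable A -> A `<=` T v @^-1` A -> pr A = 0 \/ pr A = 1.
Proof.
move=> mA AT; have ATk k : A `<=` T (v *+ k) @^-1` A.
  elim: k => [|k IH] x Ax /=; first by rewrite /shift_cube mulr0n shift0.
  by rewrite /shift_cube mulrS shiftD; apply: AT; apply: IH.
have := shift_mixing mA mA; rewrite /mixing.
have -> : (fun k => pr (A `&` T (v *+ k) @^-1` A)) = cst (pr A).
  by apply/funext => k; rewrite setIidl.
move=> /cvg_lim; rewrite lim_cst // => /(_ (@Rhausdorff R))/esym/eqP.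
rewrite -subr_eq0 -[X in _ - X]mulr1 -mulrBr mulf_eq0 subr_eq0.
by move=> /orP[]/eqP; [left|right].
Qed.

End MixingAlong.
End Mixing.

(** * Measurable and null events *)

Section FullMeasure.
Local Open Scope classical_set_scope.
Local Open Scope ring_scope.
Variables (R : realType) (n : nat).
Local Notation G := 'rV[int]_n.
Local Notation cube := (cube R G).
Variable mu : probability cube R.
Hypothesis mu_prod : is_product_measure mu.
Local Notation T := (@shift_cube R n).

Lemma measurable_exists (I : countType) (P : I -> set cube) :
  (forall i, measurable (P i)) -> measurable [set x | exists i, P i x].
Proof.
move=> mP; rewrite (_ : [set _ | _] =
    \bigcup_k (if choice.unpickle k is Some i then P i else set0)).
  by apply: bigcupT_measurable => k; case: choice.unpickle.
apply/seteqP; split=> x /=.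
  by move=> [i Pi]; exists (choice.pickle i) => //; rewrite choice.pickleK.
by move=> [k _]; case: choice.unpickle => // i Pi; exists i.
Qed.

Lemma measurable_forall (I : countType) (P : I -> set cube) :
  (forall i, measurable (P i)) -> measurable [set x | forall i, P i x].
Proof.
move=> mP; rewrite (_ : [set _ | _] = ~` [set x | exists i, (~` P i) x]).
  by apply: measurableC; apply: measurable_exists => i; apply: measurableC.
apply/seteqP; split=> x /=; first by move=> h [i]; apply.
by move=> h i; apply: contrapT => nP; apply: h; exists i.
Qed.

Lemma measurable_and (P Q : set cube) : measurable P -> measurable Q ->
  measurable [set x | P x /\ Q x].
Proof. exact: measurableI. Qed.

Lemma measurable_or (P Q : set cube) : measurable P -> measurable Q ->
  measurable [set x | P x \/ Q x].
Proof. exact: measurableU. Qed.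

Lemma measurable_not (P : set cube) : measurable P -> measurable [set x | ~ P x].
Proof. exact: measurableC. Qed.

Lemma measurable_const (P : Prop) : measurable [set x : cube | P].
Proof.
have [p|np] := pselect P.
  by rewrite (_ : [set _ | _] = setT); [exact: measurableT | apply/seteqP; split=> x].
by rewrite (_ : [set _ | _] = set0); [exact: measurable0 | apply/seteqP; split=> x].
Qed.

Lemma measurable_imply (P Q : set cube) : measurable P -> measurable Q ->
  measurable [set x | P x -> Q x].
Proof.
move=> mP mQ; rewrite (_ : [set _ | _] = [set x | (~ P x) \/ Q x]).
  by apply: measurable_or => //; exact: measurable_not.
apply/seteqP; split=> x /=; last by case.
by move=> h; have [p|] := pselect (P x); [right; exact: h | left].
Qed.

Lemma pr0_sub (A B : set cube) : measurable A -> measurable B -> A `<=` B ->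
  pr mu B = 0 -> pr mu A = 0.
Proof.
move=> mA mB AB B0; apply/eqP; rewrite eq_le pr_ge0 andbT -B0; exact: le_pr.
Qed.

Lemma pr0_exists (I : countType) (P : I -> set cube) :
  (forall i, measurable (P i)) -> (forall i, pr mu (P i) = 0) ->
  pr mu [set x | exists i, P i x] = 0.
Proof.
move=> mP P0; have mE := measurable_exists mP.
suff /negligibleP : mu.-negligible [set x | exists i, P i x] by move=> /(_ mE); rewrite /pr => ->.
have : mu.-negligible (\bigcup_k (if choice.unpickle k is Some i then P i else set0)).
  apply: negligible_bigcup => k; case: choice.unpickle => [i|]; last exact: negligible_set0.
  by apply/negligibleP => //; apply: etrans (esym (prE mu (mP i))) _; rewrite P0.
apply: negligibleS => x [i Pi].
by exists (choice.pickle i) => //; rewrite choice.pickleK.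
Qed.

Lemma pr0_or (A B : set cube) : measurable A -> measurable B ->
  pr mu A = 0 -> pr mu B = 0 -> pr mu [set x | A x \/ B x] = 0.
Proof.
move=> mA mB A0 B0.
apply: (pr0_sub (B := [set x | exists b : bool, (if b then A else B) x])).
- exact: measurable_or.
- by apply: measurable_exists => -[].
- by move=> x [?|?]; [exists true | exists false].
- by apply: pr0_exists => -[].
Qed.

Lemma pr_setC (A : set cube) : measurable A -> pr mu (~` A) = 1 - pr mu A.
Proof.
move=> mA; rewrite -setTD prD //.
by congr (_ - _); rewrite /pr probability_setT.
Qed.

Lemma pr_bigcup_le (F : nat -> set cube) (c : R) k : (forall i, measurable (F i)) ->
  (forall i, pr mu (F i) <= c) -> pr mu (\bigcup_(i in `I_k) F i) <= c *+ k.
Proof.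
move=> mF Fc; have mU j : measurable (\bigcup_(i in `I_j) F i).
  by apply: bigcup_measurable.
elim: k => [|k IH].
  by rewrite (_ : \bigcup_(i in _) _ = set0) ?mulr0n ?/pr ?measure0 // -subset0 => x [].
set U := \bigcup_(i in `I_k.+1) F i; set V := \bigcup_(i in `I_k) F i.
have VU : V `<=` U by move=> x [i ik Fi]; exists i => //; apply: ltnW.
have := prD mu (mU k.+1) (mU k) VU; rewrite -/U -/V => e.
have : pr mu (U `\` V) <= pr mu (F k).
  apply: le_pr; [by apply: measurableD; exact: mU|exact: mF|].
  move=> x [[i /= ik Fi] nV]; move: ik; rewrite ltnS leq_eqVlt => /orP[/eqP <- //|ik].
  by exfalso; apply: nV; exists i.
rewrite e mulrSr; have := Fc k; lra.
Qed.

(** Cutting the unit interval in N pieces, two coordinates fall in the same piece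
    with probability at most N * (1/N)^2. *)
Lemma pr_eq_coord (g h : G) : g != h ->
  exists2 Z : set cube, measurable Z /\ pr mu Z = 0 &
    [set x : cube | x g = x h] `<=` Z.
Proof.
move=> gh; pose I (N i : nat) : set R := `[i%:R / N.+1%:R, i.+1%:R / N.+1%:R]%classic.
pose E N : set cube := \bigcup_(i in `I_N.+1) cylinder [fset g; h]%fset (fun=> I N i).
have mI N i : measurable (I N i) by exact: measurable_itv.
have mE N : measurable (E N).
  by apply: bigcup_measurable => i _; apply: measurable_cylinder.
have sub N : [set x : cube | x g = x h] `<=` E N.
  move=> x /= xgh; pose y : R := val (x g).
  have /andP[y0 y1] : 0 <= y <= 1 by have := valP (x g); rewrite inE /= in_itv.
  have [i iN yi] : exists2 i, (i < N.+1)%N & I N i y.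
    have N0 : 0 < N.+1%:R :> R by rewrite ltr0n.
    have [y1'|y1'] := leP 1 y.
      exists N => //; have -> : y = 1 by apply/eqP; rewrite eq_le y1 y1'.
      rewrite /I /= in_itv /= divff ?lexx ?andbT ?gt_eqF //.
      by rewrite ler_pdivrMr // mul1r ler_nat.
    have yN0 : 0 <= y * N.+1%:R by rewrite mulr_ge0 // ltW.
    have /andP[t1 t2] := truncn_itv yN0.
    exists (Num.truncn (y * N.+1%:R)).
      rewrite -(ltr_nat R); apply: le_lt_trans t1 _.
      by rewrite -[ltRHS]mul1r ltr_pM2r.
    by rewrite /I /= in_itv /= ler_pdivrMr // ler_pdivlMr // t1 ltW.
  exists i => //= k; rewrite !inE => /orP[]/eqP -> //.
  by rewrite -xgh.
have prE_le N : pr mu (E N) <= N.+1%:R^-1.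
  have N0 : 0 < N.+1%:R :> R by rewrite ltr0n.
  have -> : N.+1%:R^-1 = ((N.+1%:R^-1 * N.+1%:R^-1) *+ N.+1 : R).
    by rewrite -[RHS]mulr_natr -mulrA mulVf ?mulr1 // gt_eqF.
  apply: pr_bigcup_le => i; first exact: measurable_cylinder.
  have mC : measurable (cylinder [fset g; h]%fset (fun=> I N i)) by exact: measurable_cylinder.
  rewrite -lee_fin prE // mu_prod // big_fsetU1 ?inE //= big_seq_fset1.
  have le : (lebesgue_measure (I N i `&` `[0%R, 1%R]%classic) <= N.+1%:R^-1%:E)%E.
    apply: (@le_trans _ _ (lebesgue_measure (I N i))).
      apply: le_measure; rewrite ?inE; [|exact: mI|exact: subIsetl].
      apply: measurableI; first exact: mI.
      exact: measurable_itv.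
    rewrite /I lebesgue_measure_itv /= lte_fin ltr_pM2r ?invr_gt0 // ltr_nat leqnn.
    by rewrite -EFinB lee_fin -mulrBl -natrB // subSnn mul1r.
  by rewrite EFinM; apply: lee_pmul.
exists (\bigcap_N E N).
  have mB : measurable (\bigcap_N E N) by apply: bigcapT_measurable.
  split=> //; apply/eqP; rewrite eq_le pr_ge0 andbT; apply/ler_addgt0Pl => e e0.
  rewrite addr0; have [N _ Ne] : exists2 N : nat, True & N.+1%:R^-1 <= e.
    exists (Num.truncn e^-1) => //.
    rewrite -[leRHS]invrK lef_pV2 ?posrE ?ltr0n ?invr_gt0 //.
      by apply: ltW; have /andP[] := truncn_itv (ltW (etrans (invr_gt0 e) e0)).
  apply: le_trans Ne; apply: le_trans (prE_le N).
  by apply: le_pr => // x; apply.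
by move=> x xgh N _; apply: sub.
Qed.

End FullMeasure.

(** * Random solutions: almost every cell lies in a triangle *)

Section RandomTiling.
Local Open Scope classical_set_scope.
Local Open Scope ring_scope.
Variables (R : realType) (n : nat) (hn : (1 < n)%N).
Local Notation G := 'rV[int]_n.
Local Notation cube := (cube R G).
Variable mu : probability cube R.
Hypothesis mu_prod : is_product_measure mu.
Local Notation T := (@shift_cube R n).
Local Notation emb := (emb (e1 hn) (e2 hn)).

Variable lab : cube -> nat.
Hypothesis measurable_lab : forall c, measurable [set x | lab x = c].

(** The random picture on the plane through [x] spanned by e1 and e2. *)
Definition cfg (x : cube) (a b : int) : nat := lab (T (emb a b) x).

Lemma cfg_shift x p q a b : cfg (T (emb p q) x) a b = cfg x (a + p) (b + q).
Proof. by rewrite /cfg embD /shift_cube shiftD. Qed.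

Lemma shift_embD x a b p q : T (emb a b) (T (emb p q) x) = T (emb (a + p) (b + q)) x.
Proof. by rewrite embD /shift_cube shiftD. Qed.

Lemma shift_emb0 x : T (emb 0 0) x = x.
Proof. by rewrite emb0 /shift_cube shift0. Qed.

Lemma emb_neq0 (a b : int) : (a != 0) || (b != 0) -> emb a b != 0.
Proof. by move=> ab; apply/eqP => /emb12_inj[a0 b0]; move: ab; rewrite a0 b0. Qed.

Lemma measurable_cell (P : pred nat) a b : measurable [set x | P (cfg x a b)].
Proof.
rewrite (_ : [set _ | _] = [set x | exists c : nat, P c /\ cfg x a b = c]).
  apply: measurable_exists => c; apply: measurable_and; first exact: measurable_const.
  exact: (measurable_shift _ (measurable_lab c)).
by apply/seteqP; split=> x /=; [exists (cfg x a b) | move=> [c [Pc ->]]].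
Qed.

Lemma measurable_cell_eq c a b : measurable [set x | cfg x a b = c].
Proof. exact: (measurable_shift _ (measurable_lab c)). Qed.

Lemma measurable_triangle a b c : measurable [set x | triangle (cfg x) a b c].
Proof.
rewrite (_ : [set _ | _] = [set x | (a + b < c /\ cfg x a b = SW) /\
  (cfg x a (c - a) = NW /\ cfg x (c - b) b = SE) /\
  ((forall y : int, b < y < c - a -> cfg x a y = West) /\
   (forall y : int, a < y < c - b -> cfg x y b = South)) /\
   (forall i j : int, (a < i) && (b < j) && (i + j == c) -> cfg x i j = Diag)]).
  apply: measurable_and; [apply: measurable_and|apply: measurable_and; [apply: measurable_and|
    apply: measurable_and; [apply: measurable_and|]]].
  - exact: measurable_const.
  - exact: measurable_cell_eq.
  - exact: measurable_cell_eq.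
  - exact: measurable_cell_eq.
  - by apply: measurable_forall => y; apply: measurable_imply;
      [exact: measurable_const | exact: measurable_cell_eq].
  - by apply: measurable_forall => y; apply: measurable_imply;
      [exact: measurable_const | exact: measurable_cell_eq].
  - apply: measurable_forall => i; apply: measurable_forall => j; apply: measurable_imply;
      [exact: measurable_const | exact: measurable_cell_eq].
apply/seteqP; split=> x /=.
  move=> [? ? ? ? [? ? h]]; do 3?split=> //; move=> i j /andP[/andP[? ?] /eqP ?]; exact: h.
move=> [[? ?] [[? ?] [[? ?] h]]]; split=> //; split=> // i j ai bj e; apply: h.
by rewrite ai bj e eqxx.
Qed.

Lemma measurable_outside a b : measurable [set x | outside (cfg x) a b].
Proof.
apply: measurable_forall => p; apply: measurable_forall => q; apply: measurable_forall => r.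
by apply: measurable_imply; [exact: measurable_triangle | exact: measurable_const].
Qed.

Lemma measurable_maximal D a b c : measurable [set x | maximal (cfg x) D a b c].
Proof.
rewrite (_ : [set _ | _] = [set x | triangle (cfg x) a b c /\ c - a - b <= D /\
  forall p q r, triangle (cfg x) p q r -> r - p - q <= D -> ~~ nested a b c p q r]).
  apply: measurable_and; first exact: measurable_triangle.
  apply: measurable_and; first exact: measurable_const.
  apply: measurable_forall => p; apply: measurable_forall => q; apply: measurable_forall => r.
  apply: measurable_imply; first exact: measurable_triangle.
  by apply: measurable_imply; exact: measurable_const.
by apply/seteqP; split=> x /= => [[]|[? []]].
Qed.

Lemma triangle_shift x p q a b c :
  triangle (cfg (T (emb p q) x)) a b c <-> triangle (cfg x) (a + p) (b + q) (c + p + q).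
Proof.
split=> -[ac].
  rewrite !cfg_shift => sw nw se [west south diag]; split; [by lia|by []|..].
  - by rewrite -nw; congr cfg; lia.
  - by rewrite -se; congr cfg; lia.
  - split=> [y yb|y yb|i j ip jq ij].
    + by have := west (y - q); rewrite cfg_shift subrK; apply; lia.
    + by have := south (y - p); rewrite cfg_shift subrK; apply; lia.
    + by have := diag (i - p) (j - q); rewrite cfg_shift !subrK; apply; lia.
move=> sw nw se [west south diag]; split; rewrite ?cfg_shift; [by lia|by []|..].
- by rewrite -nw; congr cfg; lia.
- by rewrite -se; congr cfg; lia.
- by split=> [y yb|y yb|i j ip jq ij]; rewrite cfg_shift; [apply: west|apply: south|apply: diag]; lia.
Qed.

Lemma outside_shift x p q a b :
  outside (cfg (T (emb p q) x)) a b <-> outside (cfg x) (a + p) (b + q).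
Proof.
split=> out a' b' c' T'.
  have := out (a' - p) (b' - q) (c' - p - q); rewrite triangle_shift.
  rewrite !subrK (_ : c' - p - q + p + q = c'); last by lia.
  by move=> /(_ T'); rewrite /inside; lia.
by have /out := (triangle_shift _ _ _ _ _ _).1 T'; rewrite /inside; lia.
Qed.

Lemma maximal_shift x p q D a b c :
  maximal (cfg (T (emb p q) x)) D a b c <-> maximal (cfg x) D (a + p) (b + q) (c + p + q).
Proof.
split=> -[T' cD M].
  split; [exact/triangle_shift | by lia |] => a' b' c' T2 D2.
  have := M (a' - p) (b' - q) (c' - p - q); rewrite triangle_shift.
  rewrite !subrK (_ : c' - p - q + p + q = c'); last by lia.
  by move=> /(_ T2); rewrite /nested; lia.
split; [exact/triangle_shift | by lia |] => a' b' c' /triangle_shift T2 D2.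
by have := M _ _ _ T2; rewrite /nested; lia.
Qed.

(** Almost sure properties of the picture are recorded as events of this form:
    being invariant, they hold at all cells of the plane at once. *)
Definition full (P : set cube) :=
  [/\ measurable P, pr mu P = 1 & forall a b x, P x -> P (T (emb a b) x)].

Lemma remove_null good V : full good -> measurable V -> pr mu V = 0 ->
  exists2 good', full good' &
    forall x, good' x -> good x /\ forall a b, ~ V (T (emb a b) x).
Proof.
move=> [mG G1 Ginv] mV V0.
pose W := [set x | exists ab : int * int, V (T (emb ab.1 ab.2) x)].
have mW : measurable W by apply: measurable_exists => ab; exact: measurable_shift.
have W0 : pr mu W = 0.
  apply: pr0_exists => [ab|ab]; first exact: measurable_shift.
  by apply: etrans (pr_shift mu_prod _ mV) V0.
exists (good `\` W); last first.
  by move=> x [gx nW]; split=> // a b Vx; apply: nW; exists (a, b).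
split; first exact: measurableD.
  have mGW : measurable (good `&` W) by exact: measurableI.
  have := prD mu mG mGW (@subIsetl _ _ _); rewrite setDIr setDv set0U => ->.
  by rewrite G1 (pr0_sub mGW mW _ W0) ?subr0 // => x [].
move=> a b x [gx nW]; split; first exact: Ginv.
by move=> [[p q] /=]; rewrite shift_embD => Vx; apply: nW; exists (p + a, q + b).
Qed.

Lemma pr1_meet A B : measurable A -> measurable B -> pr mu A = 1 -> pr mu B = 1 ->
  exists x, A x /\ B x.
Proof.
move=> mA mB A1 B1; apply: contrapT => no.
have : pr mu B <= pr mu (~` A).
  by apply: le_pr => //; [exact: measurableC | move=> x Bx Ax; apply: no; exists x].
by rewrite B1 pr_setC // A1 subrr ler10.
Qed.

(** The event that a half-line from the origin carries only [c] is contained in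
    its translate, so it has probability 0 or 1; it cannot be 1 when two given cells
    never carry the tile [c] together. *)
Lemma line_null good (c : nat) (dx dy p q : int) : full good ->
  (forall x, good x -> cfg x 0 0 = c -> cfg x p q <> c) -> (dx != 0) || (dy != 0) ->
  exists2 good', full good' & forall x, good' x -> good x /\ noline (cfg x) (pred1 c) dx dy.
Proof.
move=> fG sep d0; have [mG G1 Ginv] := fG.
pose V := [set x | good x /\ forall k : nat, cfg x (dx * k%:Z) (dy * k%:Z) = c].
have mV : measurable V.
  by apply: measurable_and => //; apply: measurable_forall => k; exact: measurable_cell_eq.
suff V0 : pr mu V = 0.
  have [good' fG' good'P] := remove_null fG mV V0; exists good' => // x /good'P[gx nV].
  split=> // a b; apply: contrapT => no; apply: (nV a b); split; first exact: Ginv.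
  move=> k; rewrite cfg_shift !(addrC (_ * _)); apply: contrapT => nc; apply: no.
  by exists k; apply/eqP.
have sub : V `<=` T (emb dx dy) @^-1` V.
  move=> x [gx lx]; split; first exact: Ginv.
  by move=> k; rewrite cfg_shift -(lx k.+1); congr cfg; lia.
have [//|V1] := zero_one mu_prod (emb_neq0 d0) mV sub.
have mV' := measurable_shift (emb p q) mV.
have V1' := etrans (pr_shift mu_prod (emb p q) mV) V1.
have [x [[gx lx] [_ lx']]] := pr1_meet mV mV' V1 V1'; exfalso.
have := lx' 0%N; have := lx 0%N; rewrite cfg_shift !mulr0 !add0r; exact: sep.
Qed.

Definition rules (good : set cube) := forall x, good x ->
  (forall a b, (cfg x a b < 10)%N) /\
  (forall a b, rule (fun i j => cfg x (a + i) (b + j))).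

Definition nolines x :=
  [/\ noline (cfg x) (pred1 West) 0 1, noline (cfg x) (pred1 West) 0 (-1),
      noline (cfg x) (pred1 Diag) 1 (-1), noline (cfg x) (pred1 Diag) (-1) 1 &
      noline (cfg x) (pred1 South) 1 0 /\ noline (cfg x) (pred1 South) (-1) 0].

Lemma walls_end good : full good -> rules good ->
  exists2 good', full good' & forall x, good' x -> good x /\ nolines x.
Proof.
move=> fG rG.
have west x : good x -> cfg x 0 0 = West -> cfg x (-1) 0 <> West.
  by move=> /rG[_ r] /(rule_West r)[g _ _] e; move: g; rewrite sub0r e.
have diag x : good x -> cfg x 0 0 = Diag -> cfg x 1 0 <> Diag.
  move=> /rG[_ r] tx e; have := fillerE r 1 0; rewrite subrr tx e /=.
  by have [[]] := rule_Diag r tx; rewrite add0r sub0r => ->.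
have south x : good x -> cfg x 0 0 = South -> cfg x 0 (-1) <> South.
  by move=> /rG[_ r] /(rule_South r)[g _ _] e; move: g; rewrite sub0r e.
have [g1 f1 h1] := @line_null good West 0 1 (-1) 0 fG west isT.
have [g2 f2 h2] := @line_null g1 West 0 (-1) (-1) 0 f1 (fun x gx => west x (h1 x gx).1) isT.
have d2 x (gx : g2 x) := diag x (h1 x (h2 x gx).1).1.
have [g3 f3 h3] := @line_null g2 Diag 1 (-1) 1 0 f2 d2 isT.
have [g4 f4 h4] := @line_null g3 Diag (-1) 1 1 0 f3 (fun x gx => d2 x (h3 x gx).1) isT.
have s4 x (gx : g4 x) := south x (h1 x (h2 x (h3 x (h4 x gx).1).1).1).1.
have [g5 f5 h5] := @line_null g4 South 1 0 0 (-1) f4 s4 isT.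
have [g6 f6 h6] := @line_null g5 South (-1) 0 0 (-1) f5 (fun x gx => s4 x (h5 x gx).1) isT.
exists g6 => // x /h6[/h5[/h4[/h3[/h2[/h1[gx n1] n2] n3] n4] n5] n6].
by split=> //; split.
Qed.

(** When the colours of the cells where [P] holds are coherent along a row, such
    cells of a given colour do not recur after an odd number of steps, so there
    are none. *)
Lemma parity_null good (P : cube -> Prop) : full good ->
  measurable (P : set cube) ->
  (forall x (k : nat), good x -> P x -> P (T (emb k%:Z 0) x) ->
     odd (cfg x k%:Z 0) = odd (cfg x 0 0) (+) odd k) ->
  exists2 good', full good' & forall x, good' x -> good x /\ forall a b, ~ P (T (emb a b) x).
Proof.
move=> fG mP alt; have [mG G1 Ginv] := fG.
pose V (c : nat) := [set x | good x /\ P x /\ cfg x 0 0 = c].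
have mV c : measurable (V c).
  by apply: measurable_and => //; apply: measurable_and => //; exact: measurable_cell_eq.
pose W := [set x | exists c, V c x].
have mW : measurable W by exact: measurable_exists.
have W0 : pr mu W = 0.
  apply: pr0_exists => // c; apply: (odd_recurrence mu_prod (@emb_neq0 1 0 isT)) => // k ok.
  rewrite -subset0 => x [[gx [Px xc]] [_ [Px' xc']]].
  move: Px' xc'; rewrite emb_mulrn mul1r mul0r => Px'.
  rewrite cfg_shift !add0r => xc'.
  by have := alt x k gx Px Px'; rewrite xc xc' ok; case: odd.
have [good' fG' h] := remove_null fG mW W0; exists good' => // x /h[gx nW].
split=> // a b Px; apply: (nW a b); exists (cfg x a b); split; first exact: Ginv.
by split=> //; rewrite cfg_shift !add0r.
Qed.

(** The colour argument is applied twice: to cells at the right end of an infinite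
    run of fillers, then to ground cells outside all triangles. *)
Lemma all_inside good : full good -> rules good ->
  exists2 good', full good' & forall x, good' x -> good x /\
    forall a b, exists p q r, triangle (cfg x) p q r /\ inside p q r a b.
Proof.
move=> fG rG; have [g1 f1 h1] := walls_end fG rG.
pose F x := forall k : nat, filler (cfg x (- k%:Z) 0).
have mF : measurable (F : set cube).
  by apply: measurable_forall => k; exact: measurable_cell.
have [x k g1x Fx Fx'|g2 f2 h2] := parity_null f1 mF.
  have [_ r] := rG _ (h1 _ g1x).1.
  have := @filler_parity _ r 0 0 k; rewrite add0r; apply => i ik.
  have := Fx' (absz (k%:Z - i)%R); rewrite cfg_shift add0r.
  by rewrite (_ : - _ + k%:Z = i) //; lia.
pose O x := ground (cfg x 0 0) /\ outside (cfg x) 0 0.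
have mO : measurable (O : set cube).
  by apply: measurable_and; [exact: measurable_cell | exact: measurable_outside].
have [x k g2x [gx ox] [gx' ox']|g3 f3 h3] := parity_null f2 mO.
  have [g1x _] := h2 _ g2x; have [gd [n1 n2 n3 n4 [n5 n6]]] := h1 _ g1x; have [s r] := rG _ gd.
  move: gx' ox'; rewrite cfg_shift outside_shift add0r => gx' ox'.
  have := outside_parity s r n1 n2 n3 n4 n5 n6 (x := 0) (y := 0) (k := k); rewrite add0r; exact.
exists g3 => // x /h3[g2x nO]; have [g1x nF] := h2 _ g2x.
have [gd [n1 n2 n3 n4 [n5 n6]]] := h1 _ g1x; have [s r] := rG _ gd.
split=> //; apply: (outside_none s r n1 n2 n3 n4 n5 n6) => a b.
  apply: contrapT => no; apply: (nF a b) => k; rewrite cfg_shift.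
  apply: contrapT => nf; apply: no; exists k; apply/negP => f; apply: nf.
  by rewrite -(_ : a + -1 * k%:Z = - k%:Z + a) ?add0r; [rewrite mul0r addr0 in f | lia].
by move=> g o; apply: (nO a b); split; [rewrite cfg_shift !add0r | apply/outside_shift; rewrite !add0r].
Qed.

End RandomTiling.

(** * Triangles of bounded size fill at most three quarters of the plane *)

Section Squares.
Local Open Scope nat_scope.

Definition cells (l : nat) : seq (nat * nat) := [seq (i, j) | i <- iota 0 l.+1, j <- iota 0 l.+1].

Lemma mem_cells l i j : ((i, j) \in cells l) = (i <= l) && (j <= l).
Proof.
apply/allpairsP/andP => [[[i' j'] []]|[il jl]].
  by rewrite !mem_iota /= => il jl [-> ->]; lia.
by exists (i, j); split; rewrite // mem_iota /=; lia.
Qed.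

Lemma size_cells l : size (cells l) = l.+1 ^ 2.
Proof. by rewrite size_allpairs size_iota. Qed.

Lemma uniq_cells l : uniq (cells l).
Proof. by apply: allpairs_uniq; rewrite ?iota_uniq // => -[i j] [i' j'] _ _ [-> ->]. Qed.

Lemma sum_lt k m : \sum_(0 <= j < m) (j < k : nat) = minn m k.
Proof.
elim: m => [|m IH]; first by rewrite big_geq // min0n.
by rewrite big_nat_recr //= IH; lia.
Qed.

Lemma count_cells l : 2 * count (fun p => p.1 + p.2 <= l) (cells l) = l.+1 * l.+2.
Proof.
have -> : count (fun p => p.1 + p.2 <= l) (cells l) = \sum_(0 <= i < l.+1) (l.+1 - i).
  rewrite -sum1_count big_mkcond /cells big_allpairs_dep.
  rewrite /index_iota subn0; apply: eq_big_seq => i; rewrite mem_iota => il.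
  have := sum_lt (l.+1 - i) l.+1; rewrite /index_iota subn0 (minn_idPr (leq_subr _ _)) => <-.
  by apply: eq_bigr => j _; rewrite (_ : (i + j <= l) = (j < l.+1 - i)); [case: ltnP | by lia].
elim: l.+1 => [|m IH]; first by rewrite big_geq.
by rewrite big_nat_recl // mulnDr IH subn0; lia.
Qed.
End Squares.

Section Mass.
Local Open Scope classical_set_scope.
Local Open Scope ring_scope.
Variables (R : realType) (n : nat) (hn : (1 < n)%N).
Local Notation G := 'rV[int]_n.
Local Notation cube := (cube R G).
Variable mu : probability cube R.
Hypothesis mu_prod : is_product_measure mu.
Local Notation T := (@shift_cube R n).
Local Notation emb := (emb (e1 hn) (e2 hn)).

Lemma pr_sum_le1 (I : eqType) (s : seq I) (F : I -> set cube) : uniq s ->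
  (forall i, measurable (F i)) ->
  (forall i j x, i \in s -> j \in s -> F i x -> F j x -> i = j) ->
  \sum_(i <- s) pr mu (F i) <= 1.
Proof.
move=> us mF dis.
suff [U [mU <- _]] : exists U, [/\ measurable U, pr mu U = \sum_(i <- s) pr mu (F i) &
    forall x, U x -> exists2 i, i \in s & F i x] by exact: pr_le1.
elim: s us dis => [|i s IH] /= => [_ _|/andP[si us] dis].
  by exists set0; rewrite big_nil /pr measure0; split=> // x.
have [|U [mU eU hU]] := IH us.
  by move=> j k x js ks; apply: dis; rewrite inE ?js ?ks orbT.
have mV : measurable (F i `|` U) by apply: measurableU.
exists (F i `|` U); split=> //; last first.
  by move=> x [Fi|/hU[j js Fj]]; [exists i; rewrite ?mem_head | exists j; rewrite // inE js orbT].
have := prD mu mV (mF i) (@subsetUl _ _ _); rewrite big_cons -eU.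
rewrite (_ : (F i `|` U) `\` F i = U); first by move->; lra.
apply/seteqP; split=> x; first by move=> [[]].
move=> Ux; split; [by right | move=> Fi].
have [j js Fj] := hU _ Ux; move: si; rewrite (dis i j x) ?js ?mem_head ?inE ?js ?orbT //.
Qed.

Lemma pr_le_sum (I : eqType) (s : seq I) (F : I -> set cube) (A : set cube) : measurable A ->
  (forall i, measurable (F i)) -> (forall x, A x -> exists2 i, i \in s & F i x) ->
  pr mu A <= \sum_(i <- s) pr mu (F i).
Proof.
move=> mA mF; elim: s A mA => [|i s IH] A mA h.
  rewrite big_nil (_ : A = set0) ?/pr ?measure0 // -subset0 => x /h[] //.
rewrite big_cons; have mAF : measurable (A `&` F i) by exact: measurableI.
have mD : measurable (A `\` (A `&` F i)) by exact: measurableD.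
have := prD mu mA mAF (@subIsetl _ _ _).
have : pr mu (A `&` F i) <= pr mu (F i) by apply: le_pr => // x [].
have : pr mu (A `\` (A `&` F i)) <= \sum_(i <- s) pr mu (F i).
  apply: IH => // x [Ax nFi]; have [j] := h _ Ax.
  by rewrite inE => /orP[/eqP -> Fi|js Fj]; [case: nFi | exists j].
lra.
Qed.

Variable lab : cube -> nat.
Hypothesis measurable_lab : forall c, measurable [set x | lab x = c].
Local Notation cfg := (cfg hn lab).
Variable good : set cube.
Hypothesis good_full : full hn mu good.
Hypothesis good_rules : rules hn lab good.

(** Let [a_l] be the probability that the origin is the south-west corner of a
    maximal triangle of size l.  By invariance it is also the probability that
    the origin is at any given position in such a triangle, or in its square.
    The squares are disjoint, so the sum of (l + 1)^2 a_l is at most 1, whereas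
    the event considered has probability at most the sum of
    (l + 1)(l + 2) a_l / 2. *)
Lemma mass (D : nat) :
  pr mu [set x | good x /\ exists p : int * int * int,
    triangle (cfg x) p.1.1 p.1.2 p.2 /\ p.2 - p.1.1 - p.1.2 <= D%:Z /\
    inside p.1.1 p.1.2 p.2 0 0] <= 3 / 4.
Proof.
have [mG G1 Ginv] := good_full.
pose F (l : nat) := [set x | good x /\ maximal (cfg x) D%:Z 0 0 l%:Z].
have mF l : measurable (F l).
  by apply: measurable_and => //; exact: measurable_maximal.
pose E (k : nat * (nat * nat)) : set cube := T (emb (- k.2.1%:Z) (- k.2.2%:Z)) @^-1` F k.1.
have mE k : measurable (E k) by exact: measurable_shift.
have prEk k : pr mu (E k) = pr mu (F k.1) by exact: (pr_shift mu_prod).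
have EP k x : E k x -> good x /\
    maximal (cfg x) D%:Z (- k.2.1%:Z) (- k.2.2%:Z) (k.1%:Z - k.2.1%:Z - k.2.2%:Z).
  move=> [gx /maximal_shift]; rewrite !add0r => M; split=> //.
  by have := Ginv k.2.1%:Z k.2.2%:Z _ gx; rewrite shift_embD !subrr shift_emb0.
pose squares := [seq (l, p) | l <- iota 1 D, p <- cells l].
pose triangles := [seq (l, p) | l <- iota 1 D, p <- [seq p <- cells l | (p.1 + p.2 <= l)%N]].
have le1 : \sum_(k <- squares) pr mu (E k) <= 1.
  apply: pr_sum_le1 => //.
    apply: allpairs_uniq_dep; first exact: iota_uniq.
      by move=> l _; apply: uniq_cells.
    by move=> [l p] [l' p'] _ _ /= [-> ->].
  move=> [l [i j]] [l' [i' j']] x.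
  move=> /allpairsPdep[l1 [[i1 j1] [_ + [-> -> ->]]]]; rewrite mem_cells => ij.
  move=> /allpairsPdep[l2 [[i2 j2] [_ + [-> -> ->]]]]; rewrite mem_cells => ij'.
  move=> /EP[gx /= M] /EP[_ /= M']; have [_ r] := good_rules gx.
  have [e1 e2 e3] := maximal_disjoint (x := 0) (y := 0) r M M' ltac:(rewrite /square; lia) ltac:(rewrite /square; lia).
  by congr (_, (_, _)); lia.
apply: (@le_trans _ _ (\sum_(k <- triangles) pr mu (E k))).
  apply: pr_le_sum => //.
    apply: measurable_and => //; apply: measurable_exists => p.
    apply: measurable_and; first exact: measurable_triangle.
    by apply: measurable_and; exact: measurable_const.
  move=> x [gx [p [Tp [pD ip]]]].
  have [a [b [c [M]]]] := exists_maximal Tp pD ip; rewrite /inside => abc.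
  have [[ab _ _ _ _] cD _] := M.
  exists (absz (c - a - b)%R, (absz a, absz b)).
    apply/allpairsPdep; exists (absz (c - a - b)%R), (absz a, absz b).
    by rewrite mem_iota mem_filter mem_cells /=; split=> //; lia.
  have [na nb] : (- (absz a)%:Z = a) /\ (- (absz b)%:Z = b) by lia.
  split; rewrite /= na nb; first exact: Ginv.
  by apply/maximal_shift; rewrite !add0r (_ : _ + a + b = c) //; lia.
have : \sum_(k <- triangles) pr mu (E k) <= 3 / 4 * \sum_(k <- squares) pr mu (E k).
  rewrite /triangles /squares !big_allpairs_dep mulr_sumr.
  rewrite !big_seq; apply: ler_sum => l; rewrite mem_iota => l1.
  have sum_l (s : seq (nat * nat)) : \sum_(p <- s) pr mu (E (l, p)) = pr mu (F l) *+ size s.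
    by rewrite (eq_bigr (fun=> pr mu (F l))) // big_const_seq count_predT iter_addr_0.
  rewrite !sum_l size_cells size_filter.
  rewrite -(mulr_natr _ (count _ _)) -(mulr_natr _ (l.+1 ^ 2)) mulrCA; apply: ler_wpM2l; first exact: pr_ge0.
  have : (4 * count (fun p : nat * nat => p.1 + p.2 <= l) (cells l) <= 3 * l.+1 ^ 2)%N.
    by have := count_cells l; rewrite expnS expn1; nia.
  by rewrite -(ler_nat R) !natrM; lra.
lra.
Qed.
End Mass.

Section NotFIID.
Local Open Scope classical_set_scope.
Local Open Scope ring_scope.
Variables (R : realType) (n : nat) (hn : (1 < n)%N).
Local Notation G := 'rV[int]_n.
Local Notation cube := (cube R G).
Variable mu : probability cube R.
Hypothesis mu_prod : is_product_measure mu.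
Local Notation T := (@shift_cube R n).
Local Notation emb := (emb (e1 hn) (e2 hn)).

Lemma no_random_solution (lab : cube -> nat) good :
  (forall c, measurable [set x | lab x = c]) ->
  full hn mu good -> rules hn lab good -> False.
Proof.
move=> mlab fG rG; have [g f h] := all_inside mu_prod mlab fG rG.
have rg : rules hn lab g by move=> x /h[/rG].
have [mg g1 _] := f.
pose A (D : nat) := [set x | g x /\ exists p : int * int * int,
  triangle (cfg hn lab x) p.1.1 p.1.2 p.2 /\ p.2 - p.1.1 - p.1.2 <= D%:Z /\
  inside p.1.1 p.1.2 p.2 0 0].
have mA D : measurable (A D).
  apply: measurable_and => //; apply: measurable_exists => p.
  apply: measurable_and; first exact: measurable_triangle.
  by apply: measurable_and; exact: measurable_const.
have ndA : nondecreasing_seq A.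
  move=> D D' DD'; apply/subsetPset => x [gx [p [Tp [pD ip]]]]; split=> //; exists p.
  by split=> //; split=> //; apply: le_trans pD _; rewrite lez_nat.
have UA : pr mu (\bigcup_D A D) = 1.
  have mU : measurable (\bigcup_D A D) by exact: bigcupT_measurable.
  apply/eqP; rewrite eq_le pr_le1 //= -[leLHS]g1; apply: le_pr => //.
  move=> x gx; have [_ /(_ 0 0)[p [q [r [Tp ip]]]]] := h _ gx.
  exists (absz (r - p - q)%R) => //; split=> //; exists (p, q, r).
  by split=> //; split=> //=; lia.
have e4 : 0 < 1 / 4 :> R by lra.
have /cvgrPdist_lt/(_ _ e4)[D _ /(_ D (leqnn D)) /=] := @pr_ndseq _ _ mu _ mA ndA.
have := mass mu_prod mlab f rg D; rewrite -/(A D) UA => le.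
rewrite ger0_norm ?subr_ge0 ?pr_le1 //; lra.
Qed.

(** A point of period g has equal coordinates at 0 and at g. *)
Lemma pr_not_free : exists2 Z : set cube, measurable Z /\ pr mu Z = 0 &
  forall x : cube, ~ Z x -> free_part G (unit_interval R) x.
Proof.
have /choice[Z hZ] (g : G) : exists Z : set cube,
    [/\ measurable Z, pr mu Z = 0 & g <> 0 -> forall x : cube, shift g x = x -> Z x].
  have [->|/eqP g0] := pselect (g = 0).
    by exists set0; split=> //; rewrite /pr measure0.
  have [|Z [mZ Z0] hZ] := pr_eq_coord mu_prod (g := 0) (h := g); first by rewrite eq_sym.
  by exists Z; split=> // _ x e; apply: hZ; rewrite /= -[in LHS]e /shift add0r.
exists [set x | exists g, Z g x].
  split; [apply: measurable_exists|apply: pr0_exists] => g; by have [] := hZ g.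
move=> x nZ g g0 e; apply: nZ; exists g; by have [_ _] := hZ g; apply.
Qed.

(** Off a null set the solution agrees with a labeling of the whole cube whose
    level sets are measurable; the new label 10 marks the exceptional points. *)
Theorem no_measurable_solution (f : set_type (free_part G (unit_interval R)) -> 'I_10) :
  is_solution (Pi := triangle_LCL (e1 hn) (e2 hn)) (@free_shift G (unit_interval R)) f ->
  measurable_labeling mu f -> False.
Proof.
move=> /triangle_solutionP sol mf; have [Zf [mZf Zf0] Zf_free] := pr_not_free.
have /choice[AZ hAZ] (c : 'I_10) : exists AZ : set cube * set cube,
   [/\ measurable AZ.1, measurable AZ.2, pr mu AZ.2 = 0 &
    forall x, ~ AZ.2 x -> AZ.1 x <-> exists2 y, f y = c & val y = x].
  have [A mA [N [Z [mZ Z0 NZ]] e]] := mf [set c].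
  exists (A, Z); split=> //=; first by rewrite /pr Z0.
  move=> x nZ; split=> [Ax|[y fy yx]].
    have : (A `|` N) x by left.
    by rewrite e => -[y fy yx]; exists y.
  have : (A `|` N) x by rewrite e; exists y.
  by case=> // /NZ.
pose Z0 := [set x | Zf x \/ exists c, (AZ c).2 x].
have mZ c : measurable (AZ c).2 by have [] := hAZ c.
have mZ0 : measurable Z0 by apply: measurable_or => //; exact: measurable_exists.
have Z00 : pr mu Z0 = 0.
  apply: pr0_or => //; first exact: measurable_exists.
  by apply: pr0_exists => // c; have [] := hAZ c.
pose flab (x : cube) : nat :=
  if pselect (free_part G (unit_interval R) x) is left Fx then f (exist _ x (mem_set Fx)) else 10.
have flabE y : flab (val y) = f y.
  rewrite /flab; case: pselect => [Fx|[]]; last exact: set_mem (valP y).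
  by congr (_ (f _)); exact: val_inj.
pose lab (x : cube) : nat := if pselect (Z0 x) is left _ then 10 else flab x.
have labE y : ~ Z0 (val y) -> lab (val y) = f y.
  by rewrite /lab; case: pselect.
have mlab c : measurable [set x | lab x = c].
  have [c10|c10] := ltnP c 10; last first.
    rewrite (_ : [set _ | _] = [set x | Z0 x /\ c = 10%N]).
      by apply: measurable_and => //; exact: measurable_const.
    apply/seteqP; split=> x /=; rewrite /lab; case: pselect => [zx|nZ]; [by []| |by case|by case].
    have Fx := Zf_free x (fun h => nZ (or_introl h)).
    move=> e; have := flabE (exist _ x (mem_set Fx)); rewrite /= e => e'.
    by move: c10; rewrite e' leqNgt ltn_ord.
  rewrite (_ : [set _ | _] = [set x | ~ Z0 x /\ (AZ (Ordinal c10)).1 x]).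
    apply: measurable_and; first exact: measurable_not.
    by have [] := hAZ (Ordinal c10).
  have nZ2 x : ~ Z0 x -> ~ (AZ (Ordinal c10)).2 x.
    by move=> nZ h; apply: nZ; right; exists (Ordinal c10).
  have [_ _ _ hA] := hAZ (Ordinal c10).
  apply/seteqP; split=> x /=.
    rewrite /lab; case: pselect => [_ e|nZ]; first by exfalso; move: (c10); rewrite -e.
    have Fx := Zf_free x (fun h => nZ (or_introl h)).
    have := flabE (exist _ x (mem_set Fx)); rewrite /= => -> fc; split=> //.
    apply/hA; first exact: nZ2.
    by exists (exist _ x (mem_set Fx)) => //; apply: val_inj.
  by move=> [nZ /(hA _ (nZ2 _ nZ))[y fy yx]]; rewrite -yx labE ?fy // yx.
have fT : full hn mu setT.
  by split=> //; rewrite /pr probability_setT.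
have [good fG hG] := remove_null mu_prod fT mZ0 Z00.
apply: (no_random_solution mlab fG) => x /hG[_ nZ].
have Fx a b : free_part G (unit_interval R) (T (emb a b) x).
  by apply: Zf_free => h; apply: (nZ a b); left.
pose y a b : set_type (free_part G (unit_interval R)) :=
  exist (fun z => z \in free_part G (unit_interval R)) (T (emb a b) x) (mem_set (Fx a b)).
have cfgE a b : cfg hn lab x a b = f (y a b) by exact: (labE (y a b) (nZ a b)).
split=> [a b|a b]; first by rewrite cfgE.
have := sol (y a b); congr (is_true (rule _)).
apply/funext => i; apply/funext => j; rewrite cfgE; congr (_ (f _)); apply: val_inj => /=.
by rewrite (addrC a) (addrC b) -shift_embD.
Qed.
End NotFIID.

Theorem theorem1p25 (R : realType) (n : nat) (hn : (2 <= n)%N) :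
  exists Pi : LCL 'rV[int]_n,
    ~ FIID R Pi /\ BaireSHIFT Pi /\ COMPUTABLE Pi.
Proof.
exists (triangle_LCL (e1 hn) (e2 hn)); split; [|split].
- by move=> [mu [mu_prod [f [sol mf]]]]; exact: (no_measurable_solution mu_prod sol mf).
- exact: triangle_BaireSHIFT.
- exact: triangle_COMPUTABLE (@emb12_inj n hn).
Qed.
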